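(* The following two questions are equivalent (that is, one has an affirmative answer if and only if the other does). (a) (Lehmer's question) Do there exist integral polynomials with Mahler measures arbitrarily close but not equal to $1$? Equivalently: is it true that for every $\epsilon>0$ there exists a nonzero $f\in\mathbb Z[x]$ with $1<M(f)<1+\epsilon$? (b) Is it true that for every $\epsilon>0$ there exists a $1$-periodic (signed) graph $G$ such that $$1<\lim_{r\to\infty}(\tau_{G_r})^{1/r}<1+\epsilon\,?$$
   Context: The Mahler measure of a nonzero $f(x)\in\mathbb Z[x^{\pm1}]$ is $M(f)=\exp\int_0^1\log|f(e^{2\pi i\theta})|\,d\theta$. Graphs may have loops and multiple edges but no isolated vertices; every edge $e$ carries a sign $\sigma_e\in\{+1,-1\}$. They are not required to be planar. A $1$-periodic graph is a signed graph $G$ with an action of $\mathbb Z$ by sign-preserving graph automorphisms that is free (trivial stabilizers of all vertices and edges) and cofinite (finite quotient graph). For $r\ge1$, $G_r=G/r\mathbb Z$ is the finite signed quotient graph of $G$ by the subgroup $r\mathbb Z$. The tree complexity of a finite connected signed graph $H$ is $\tau_H=\bigl|\sum_T\prod_{e\in E(T)}\sigma_e\bigr|$, the sum being over all spanning trees $T$ of $H$. If $H$ is not connected, $\tau_H$ is the product of the tree complexities of its connected components. *)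

(* Defs.v *)
From HB Require Import structures.
From mathcomp Require Import all_boot all_order all_algebra.
From mathcomp Require Import complex.
From mathcomp Require Import all_classical all_reals all_analysis.

Set Implicit Arguments.
Unset Strict Implicit.
Unset Printing Implicit Defensive.

Import Order.TTheory GRing.Theory Num.Theory.
Import numFieldNormedType.Exports.

Local Open Scope classical_set_scope.
Local Open Scope ring_scope.

(* [ln 0 = 0] here, which is harmless: a nonzero [f] has only finitely many
   zeros on the unit circle. *)
Definition mahler_measure (R : realType) (f : {poly int}) : R :=
  expR (\int[lebesgue_measure]_(t in `[0, 1])
          ln (Normc.normc (map_poly (fun n : int => n%:~R) f).[
                Complex (cos (2 * pi * t)) (sin (2 * pi * t))])).

(* The two ends of an edge form an unordered pair, a singleton for a loop.
   Parallel edges are distinct elements of [edge] with the same [ends]. *)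
Record sgraph := SGraph {
  vertex : choiceType;
  edge : choiceType;
  ends : edge -> set vertex;
  negative : edge -> bool;
  endsP : forall e, exists u v, ends e = [set u; v];
  no_isolated : forall v, exists e, ends e v }.

Definition edge_sign (H : sgraph) (e : edge H) : int := (-1) ^+ negative e.

(* [walk T u s v]: starting from [u], the list [s] gives the successive edges
   traversed, all in [T], each paired with the vertex reached; [v] is last. *)
Fixpoint walk (H : sgraph) (T : set (edge H)) (u : vertex H)
    (s : seq (edge H * vertex H)) (v : vertex H) : Prop :=
  if s is (e, w) :: s' then [/\ T e, ends e = [set u; w] & walk T w s' v]
  else u = v.

(* A loop is a cycle of length 1, two parallel edges form one of length 2. *)
Definition cycle_in (H : sgraph) (T : set (edge H)) (u : vertex H)
    (s : seq (edge H * vertex H)) : Prop :=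
  [/\ s <> [::], walk T u s u, uniq (unzip1 s) & uniq (unzip2 s)].

Definition component (H : sgraph) (v : vertex H) : set (vertex H) :=
  [set w | exists s, walk setT v s w].

Definition components (H : sgraph) : set (set (vertex H)) :=
  range (@component H).

Definition spanning_tree (H : sgraph) (C : set (vertex H))
    (T : set (edge H)) : Prop :=
  [/\ forall e, T e -> ends e `<=` C,
      forall u v, C u -> C v -> exists s, walk T u s v
    & forall u s, ~ cycle_in T u s].

Definition component_complexity (H : sgraph) (C : set (vertex H)) : int :=
  `| \sum_(T \in spanning_tree C) \big[*%R/1]_(e \in T) edge_sign e |.

(* Meaningful for finite [H] only (finitely supported sums and products). When
   [H] is connected the only factor is [component_complexity setT]. *)
Definition tree_complexity (H : sgraph) : int :=
  \big[*%R/1]_(C \in @components H) component_complexity C.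

Record zgraph := ZGraph {
  zg :> sgraph;
  actv : int -> vertex zg -> vertex zg;
  acte : int -> edge zg -> edge zg;
  actv0 : forall v, actv 0 v = v;
  actvD : forall m n v, actv (m + n) v = actv m (actv n v);
  acte0 : forall e, acte 0 e = e;
  acteD : forall m n e, acte (m + n) e = acte m (acte n e);
  act_ends : forall n e, ends (acte n e) = actv n @` ends e;
  act_sign : forall n e, negative (acte n e) = negative e }.

Definition zorbit (X : Type) (act : int -> X -> X) (r : nat) (x : X) : set X :=
  [set act (k * r%:Z) x | k in [set: int]].

Section Quotient.
Variables (G : zgraph) (r : nat).

Definition qvertex : choiceType := set_type (range (zorbit (@actv G) r)).
Definition qedge : choiceType := set_type (range (zorbit (@acte G) r)).

Definition qends (O : qedge) : set qvertex :=
  [set P | exists e v,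
     [/\ sval O e, ends e v & sval P = zorbit (@actv G) r v]].

Definition qnegative (O : qedge) : bool :=
  `[< exists2 e, sval O e & negative e >].

Definition qv (v : vertex G) : qvertex :=
  exist _ (zorbit (@actv G) r v) (mem_set (imageT _ v)).
Definition qe (e : edge G) : qedge :=
  exist _ (zorbit (@acte G) r e) (mem_set (imageT _ e)).

Lemma zorbit_act (k : int) (v : vertex G) :
  zorbit (@actv G) r (actv (k * r%:Z) v) = zorbit (@actv G) r v.
Proof.
apply/seteqP; split => w [m _ <-].
  by exists (m + k) => //; rewrite mulrDl actvD.
by exists (m - k) => //; rewrite -actvD -mulrDl subrK.
Qed.

Lemma qends_qe (e : edge G) : qends (qe e) = qv @` ends e.
Proof.
apply/seteqP; split => P /=.
  move=> [_ [v [[k _ <-]]]]; rewrite act_ends => -[w ew <-]; rewrite zorbit_act.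
  by move=> Pw; exists w => //; apply: val_inj; rewrite /= -Pw.
move=> [v ev <-]; exists e, v; split=> //.
by exists 0 => //; rewrite mul0r acte0.
Qed.

Lemma qeP (O : qedge) : exists e, O = qe e.
Proof.
have [e _ eO] : range (zorbit (@acte G) r) (sval O) by apply: set_mem; case: O.
by exists e; apply: val_inj.
Qed.

Lemma qvP (P : qvertex) : exists v, P = qv v.
Proof.
have [v _ vP] : range (zorbit (@actv G) r) (sval P) by apply: set_mem; case: P.
by exists v; apply: val_inj.
Qed.

Lemma qendsP (O : qedge) : exists P Q, qends O = [set P; Q].
Proof.
have [e ->] := qeP O; have [u [v uv]] := endsP e.
by exists (qv u), (qv v); rewrite qends_qe uv image_setU !image_set1.
Qed.

Lemma qno_isolated (P : qvertex) : exists O, qends O P.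
Proof.
have [v ->] := qvP P; have [e ev] := no_isolated v.
by exists (qe e); rewrite qends_qe; exists v.
Qed.

(* [G / rZ]: vertices and edges are the orbits of [rZ]. *)
Definition quotient : sgraph :=
  @SGraph qvertex qedge qends qnegative qendsP qno_isolated.

End Quotient.

Definition finite_graph (H : sgraph) : Prop :=
  finite_set [set: vertex H] /\ finite_set [set: edge H].

Definition one_periodic (G : zgraph) : Prop :=
  [/\ forall n (v : vertex G), actv n v = v -> n = 0,
      forall n (e : edge G), acte n e = e -> n = 0
    & finite_graph (quotient G 1)].

(* Main.v *)
Require Import Defs.
From HB Require Import structures.
From mathcomp Require Import all_boot all_order fingroup perm all_algebra.
From mathcomp Require Import complex ring lra zify.
From mathcomp Require Import boolp.

Set Implicit Arguments.
Unset Strict Implicit.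
Unset Printing Implicit Defensive.

Import Order.TTheory GRing.Theory Num.Theory.

Local Open Scope ring_scope.

(** A 1-periodic graph is a finite graph whose edges carry integer shifts, and
    its level-[r] quotient is the corresponding cyclic cover. Mark some
    vertices by a variable [y] added to the diagonal of the signed Laplacian.
    The Cauchy-Binet formula ([det_laplacian]) shows that the lowest
    coefficient in [y] of the resulting determinant is the signed number of
    maximal spanning forests times the number of ways to choose one marked vertex in
    each component. On the other hand the marked Laplacian of a cyclic cover is
    block-circulant, so the Fourier transform ([cover_det]) turns its
    determinant into a product, over the [r]-th roots of unity [z], of the
    values at [z] of a single polynomial with coefficients in [Z[x]]. Comparing
    lowest coefficients ([cover_forest_sumE]), the tree complexity, when it is
    not zero, is a constant times the product of [|f(z)|] over the [r]-th roots
    of unity [z <> 1], for one integer polynomial [f], divided by the number of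
    choices of marked vertices.

    Such products grow like the powers of the Mahler measure [M(f)]
    ([growth_cyclic_product]). Splitting [f] into linear factors, this is a
    statement about [|a ^ r - 1|] for each root [a] of [f], combined with
    Jensen's formula ([mahler_measureE]), which makes [M(f)] the product of the
    [max 1 |a|] and of the absolute value of the leading coefficient. The only hard case is a root on
    the unit circle that is not a root of unity, where one needs Gelfond's
    theorem that [|a ^ r - 1|] is not exponentially small ([gelfond]). It is
    proved by the transcendence method. If [a] is very close to a root of unity
    [w] of order [n], the pigeonhole principle provides integers, not all zero,
    such that a combination of the functions [u ^ j * exp(2 i pi l u)] is tiny on
    a long interval ([aux_function]). At the points [r * k / n + s] it takes
    values that are integer polynomials in [w], hence almost the values of the
    same polynomials at [a]. By Liouville's inequality these vanish, which is
    too many zeros ([zero_estimate]).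

    Hence the limit attached to a 1-periodic graph, when it exceeds 1, is the
    Mahler measure of an integer polynomial ([periodic_limit]). Only prime
    levels are used there: for these, [f] has no zero among the nontrivial roots
    of unity, with finitely many exceptions, and the number of choices of marked
    vertices is at most a fixed power of [r].

    Conversely, let [f] have Mahler measure slightly above 1. Its roots that are
    roots of unity can be divided out without changing [M(f)]
    ([strip_roots_of_unity]). The Laurent polynomial
    [f(x) f(1/x) (2 - x - 1/x)] is a sum of terms [2 - x ^ b - x ^ - b] with
    signs ([representable_square]), hence the Laplacian of a signed 1-periodic
    graph with one orbit of vertices. Its tree complexities grow like
    [M(f) ^ 2] ([realisation]), which is again slightly above 1. *)

(** * Determinants of incidence matrices *)

Section CauchyBinet.
Variables (R : comNzRingType) (N : nat) (E : finType).
Implicit Types (a : 'I_N -> E -> R) (w : E -> R) (S : {set E}).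

Definition colmx a (g : 'I_N -> E) : 'M[R]_N := \matrix_(i, j) a i (g j).

(** The square of the determinant of the columns in [S], as [minor_sqrE] shows.
    In this form, which sums over the enumerations of [S], no order on [S] has
    to be chosen. *)
Definition minor_sqr a S : R :=
  \sum_(f : {ffun 'I_N -> E} | injectiveb f && (f @: setT == S))
     (\prod_i a i (f i)) * \det (colmx a f).

(** Expanding the product over rows gives a sum over maps from rows to columns;
    the maps that are not injective contribute a determinant with two equal
    columns, and the others are grouped by their image. *)
Lemma cauchy_binet a w :
  \det (\matrix_(i, j) \sum_e w e * a i e * a j e) =
  \sum_(S : {set E} | #|S| == N) (\prod_(e in S) w e) * minor_sqr a S.
Proof.
have -> : \det (\matrix_(i, j) \sum_e w e * a i e * a j e) =
   \sum_(f : {ffun 'I_N -> E}) (\prod_i w (f i)) * ((\prod_i a i (f i)) * \det (colmx a f)).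
  rewrite /determinant.
  transitivity (\sum_(s : 'S_N) \sum_(f : {ffun 'I_N -> E})
      (-1) ^+ s * ((\prod_i w (f i)) * (\prod_i a i (f i)) * \prod_i a (s i) (f i))).
    apply: eq_bigr => s _; rewrite -mulr_sumr; congr (_ * _).
    under eq_bigr do rewrite mxE.
    rewrite bigA_distr_bigA /=; apply: eq_bigr => f _.
    by rewrite -!big_split /=.
  rewrite exchange_big /=; apply: eq_bigr => f _.
  rewrite mulrA mulr_sumr (reindex_inj invg_inj) /=; apply: eq_bigr => s _.
  rewrite odd_permV mulrCA; congr (_ * (_ * _)).
  rewrite (reindex_inj (@perm_inj _ s)) /=; apply: eq_bigr => i _.
  by rewrite permK mxE.
rewrite (bigID (fun f : {ffun _} => injectiveb f)) /= [X in _ + X]big1 ?addr0; last first.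
  move=> f /injectivePn[i [j ij fij]].
  suff -> : \det (colmx a f) = 0 by rewrite !mulr0.
  rewrite -det_tr; apply: (determinant_alternate ij) => k; by rewrite !mxE fij.
rewrite (partition_big (fun f : {ffun 'I_N -> E} => f @: setT) (fun S => #|S| == N)) /=; last first.
  by move=> f /injectiveP finj; rewrite card_imset // cardsT card_ord.
apply: eq_bigr => S SN; rewrite /minor_sqr mulr_sumr; apply: eq_bigr => f /andP[/injectiveP finj /eqP fS].
congr (_ * _); rewrite -fS big_imset /=; last by move=> ? ? _ _ /finj.
by apply: eq_bigl => i; rewrite inE.
Qed.

Lemma minor_sqrE a (g : 'I_N -> E) : injective g ->
  minor_sqr a (g @: setT) = \det (colmx a g) ^+ 2.
Proof.
move=> ginj.
pose h (s : 'S_N) : {ffun 'I_N -> E} := [ffun i => g (s i)].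
pose h' (f : {ffun 'I_N -> E}) : 'S_N := odflt 1%g [pick s : 'S_N | [forall i, g (s i) == f i]].
rewrite /minor_sqr (reindex_onto h h') /=; last first.
  move=> f /andP[/injectiveP finj /eqP fg]; rewrite /h'.
  have pre i : exists k, g k == f i.
    have : f i \in g @: setT by rewrite -fg imset_f.
    by case/imsetP => k _ ->; exists k.
  pose k i := xchoose (pre i).
  have gk i : g (k i) = f i by apply/eqP; exact: (xchooseP (pre i)).
  have kinj : injective k by move=> i j kij; apply: finj; rewrite -!gk kij.
  case: pickP => [s /forallP sf|/(_ (perm kinj)) /negP[]].
    by apply/ffunP => i; rewrite ffunE (eqP (sf i)).
  by apply/forallP => i; rewrite permE gk.
have hinj s : injective (h s).
  by move=> i j; rewrite !ffunE => /ginj/perm_inj.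
rewrite (eq_bigl xpredT) => [|s]; last first.
  have -> : injectiveb (h s) by apply/injectiveP.
  have -> : h s @: setT = g @: setT.
    apply/setP => x; apply/imsetP/imsetP => -[i _ ->].
      by exists (s i); rewrite ?ffunE.
    by exists (s^-1%g i); rewrite ?ffunE ?permKV.
  rewrite eqxx /= /h'; case: pickP => [s' /forallP s's|/(_ s) /negP[]].
    apply/eqP/permP => i; apply: ginj; have := eqP (s's i); by rewrite ffunE.
  by apply/forallP => i; rewrite ffunE.
have detE s : \det (colmx a (h s)) = (-1) ^+ s * \det (colmx a g).
  have -> : colmx a (h s) = col_perm s (colmx a g).
    by apply/matrixP => i j; rewrite !mxE ffunE.
  by rewrite col_permE det_mulmx det_perm odd_permV mulrC.
under eq_bigr do rewrite detE mulrA [_ * (-1) ^+ _]mulrC.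
rewrite -mulr_suml expr2; congr (_ * _).
by apply: eq_bigr => s _; congr (_ * _); apply: eq_bigr => i _; rewrite mxE ffunE.
Qed.

End CauchyBinet.

Section FiniteGraph.
Variables (N : nat) (E : finType) (s t : E -> 'I_N).
Implicit Types (F : {set E}) (K : {set 'I_N}) (u v : 'I_N) (e : E).

Definition adj F : rel 'I_N := fun x y =>
  [exists e in F, ((s e == x) && (t e == y)) || ((s e == y) && (t e == x))].
Definition conn F : rel 'I_N := connect (adj F).

Lemma adj_sym F : symmetric (adj F).
Proof. by move=> x y; apply: eq_existsb => e; rewrite orbC. Qed.

Lemma conn_sym F x y : conn F x y = conn F y x.
Proof. by apply: sym_connect_sym; exact: adj_sym. Qed.

Lemma conn_refl F x : conn F x x. Proof. exact: connect0. Qed.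

Lemma conn_trans F y x z : conn F x y -> conn F y z -> conn F x z.
Proof. exact: connect_trans. Qed.

Lemma conn_edge F e : e \in F -> conn F (s e) (t e).
Proof. by move=> eF; apply/connect1/existsP; exists e; rewrite eF !eqxx. Qed.

Lemma conn_ind F (Q : 'I_N -> Prop) :
  (forall e, e \in F -> (Q (s e) -> Q (t e)) /\ (Q (t e) -> Q (s e))) ->
  forall x y, conn F x y -> Q x -> Q y.
Proof.
move=> QF x y /connectP[p]; elim: p x => [|z p IHp] x /=; first by move=> _ ->.
move=> /andP[/existsP[e /andP[/QF[Q1 Q2]]] /orP[]/andP[/eqP <- /eqP <-]] zp yp Qx.
  by apply: IHp zp yp _; exact: Q1.
by apply: IHp zp yp _; exact: Q2.
Qed.

Lemma connS F F' x y : F \subset F' -> conn F x y -> conn F' x y.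
Proof.
move=> /subsetP FF' xy; apply: (@conn_ind F (fun y => conn F' x y) _ x y xy); last exact: conn_refl.
move=> e /FF' eF; split=> /conn_trans; apply; last rewrite conn_sym; exact: conn_edge.
Qed.

Lemma conn_del F e x y : conn (F :\ e) (s e) (t e) -> conn F x y -> conn (F :\ e) x y.
Proof.
move=> st xy; apply: (@conn_ind F (fun y => conn (F :\ e) x y) _ x y xy); last exact: conn_refl.
move=> e' eF; have [->|e'e] := eqVneq e' e.
  by split=> /conn_trans; apply => //; rewrite conn_sym.
have e'F : e' \in F :\ e by rewrite !inE e'e.
by split=> /conn_trans; apply; last rewrite conn_sym; exact: conn_edge.
Qed.

(** The vertex-edge incidence matrix, with an extra column for each vertex seen
    as joined to a vertex at infinity. *)
Definition inc (R : comNzRingType) (v : 'I_N) (x : E + 'I_N) : R :=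
  match x with inl e => (v == s e)%:R - (v == t e)%:R | inr u => (v == u)%:R end.

Definition edges_of (S : {set E + 'I_N}) : {set E} := [set e | inl e \in S].
Definition marks_of (S : {set E + 'I_N}) : {set 'I_N} := [set v | inr v \in S].
Definition join F K : {set E + 'I_N} :=
  [set x | match x with inl e => e \in F | inr u => u \in K end].

Lemma edges_of_join F K : edges_of (join F K) = F.
Proof. by apply/setP => e; rewrite !inE. Qed.
Lemma marks_of_join F K : marks_of (join F K) = K.
Proof. by apply/setP => e; rewrite !inE. Qed.
Lemma join_of S : join (edges_of S) (marks_of S) = S.
Proof. by apply/setP => -[e|v]; rewrite !inE. Qed.

Lemma prod_join (R : comNzRingType) F K (w : E + 'I_N -> R) :
  \prod_(x in join F K) w x = (\prod_(e in F) w (inl e)) * \prod_(u in K) w (inr u).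
Proof.
rewrite big_sumType /=; congr (_ * _).
  by apply: eq_bigl => e; rewrite inE.
by apply: eq_bigl => e; rewrite inE.
Qed.

Lemma card_join F K : #|join F K| = (#|F| + #|K|)%N.
Proof.
rewrite -!sum1_card big_sumType /=; congr (_ + _)%N.
  by apply: eq_bigl => e; rewrite inE.
by apply: eq_bigl => e; rewrite inE.
Qed.

Definition cover F K : bool := [forall v, [exists u in K, conn F v u]].

Lemma coverP F K : reflect (forall v, exists2 u, u \in K & conn F v u) (cover F K).
Proof.
apply: (iffP forallP) => h v; first by have /existsP[u /andP[]] := h v; exists u.
by have [u uK vu] := h v; apply/existsP; exists u; rewrite uK.
Qed.

(** When the edges of [F] join every vertex to [K], the columns of [F] and [K]
    span the integer lattice: a unit vector is reached from a marked one by
    adding edge columns along a path. *)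
Lemma cover_span F K k (g : 'I_k -> E + 'I_N) : cover F K ->
  (forall z : E + 'I_N, z \in join F K -> exists j, g j = z) ->
  exists P : 'M[int]_(k, N), (\matrix_(i, j) inc int i (g j)) *m P = 1%:M.
Proof.
move=> /coverP cov gS; set A := \matrix_(i, j) _.
pose unit v : 'cV[int]_N := \col_i (i == v)%:R.
pose span (x : 'cV[int]_N) := exists p : 'cV[int]_k, A *m p = x.
have spanD x y : span x -> span y -> span (x + y).
  by move=> [p <-] [q <-]; exists (p + q); rewrite mulmxDr.
have spanN x : span x -> span (- x).
  by move=> [p <-]; exists (- p); rewrite mulmxN.
have spancol j : span (col j A) by exists (delta_mx j 0); rewrite -colE.
have spanK u : u \in K -> span (unit u).
  move=> uK; have [|j gj] := gS (inr u); first by rewrite inE.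
  suff -> : unit u = col j A by [].
  by apply/colP => i; rewrite !mxE gj.
have spanF e : e \in F -> span (unit (s e) - unit (t e)).
  move=> eF; have [|j gj] := gS (inl e); first by rewrite inE.
  suff -> : unit (s e) - unit (t e) = col j A by [].
  by apply/colP => i; rewrite !mxE gj.
have spanV v : span (unit v).
  have [u uK vu] := cov v; have := spanK u uK; rewrite conn_sym in vu.
  apply: (@conn_ind F (fun v => span (unit v))) vu => e eF; split => se.
    have -> : unit (t e) = unit (s e) + - (unit (s e) - unit (t e)) by rewrite opprB addrC subrK.
    by apply: spanD se _; exact/spanN/spanF.
  have -> : unit (s e) = unit (t e) + (unit (s e) - unit (t e)) by rewrite addrC subrK.
  by apply: spanD se _; exact: spanF.
have [P PE] : exists P : 'I_N -> 'cV[int]_k, forall v, A *m P v = unit v.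
  have [P PE] := @fin_all_exists _ (fun=> 'cV[int]_k) (fun v p => A *m p = unit v) spanV.
  by exists P.
exists (\matrix_(i, j) P j i 0); apply/matrixP => i j.
have := congr1 (fun M : 'cV_N => M i 0) (PE j); rewrite !mxE => <-.
by apply: eq_bigr => l _; rewrite !mxE.
Qed.

Lemma cover_card F K : cover F K -> (N <= #|F| + #|K|)%N.
Proof.
move=> cov; rewrite -card_join; set S := join F K.
have [|P PE] := @cover_span F K #|S| (@enum_val _ (mem S)) cov.
  by move=> x xS; exists (enum_rank_in xS x); rewrite enum_rankK_in.
move: PE; set A := \matrix_(i, j) _ => PE.
have := congr1 (map_mx (intr : int -> rat)) PE; rewrite map_mxM map_mx1.
move=> /(congr1 mxrank); rewrite mxrank1 => rkE.
have := mxrankM_maxl (map_mx (intr : int -> rat) A) (map_mx intr P); rewrite rkE.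
by move=> /leq_trans; apply; exact: rank_leq_col.
Qed.

Lemma inc_rmorph (R : comNzRingType) v x : inc R v x = (inc int v x)%:~R.
Proof. by case: x => [e|u] /=; rewrite ?rmorphB /= !rmorph_nat. Qed.

(** If every vertex is joined to a mark, the columns span the integer lattice
    and the determinant is a unit; otherwise the indicator of a component without
    mark is orthogonal to all columns. *)
Lemma minor_sqr_inc (R : comNzRingType) (S : {set E + 'I_N}) : #|S| = N ->
  minor_sqr (inc R) S = (cover (edges_of S) (marks_of S))%:R.
Proof.
move=> SN; pose g (j : 'I_N) := enum_val (cast_ord (esym SN) j).
have ginj : injective g by move=> i j /enum_val_inj/cast_ord_inj.
have gS : g @: setT = S.
  apply/eqP; rewrite eqEcard card_imset // cardsT card_ord SN leqnn andbT.
  by apply/subsetP => _ /imsetP[j _ ->]; exact: enum_valP.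
have -> : minor_sqr (inc R) S = (\det (colmx (inc int) g) ^+ 2)%:~R.
  rewrite -{1}gS minor_sqrE // rmorphXn /= -det_map_mx; congr (\det _ ^+ 2).
  by apply/matrixP => i j; rewrite !mxE inc_rmorph.
have [cov|ncov] := boolP (cover (edges_of S) (marks_of S)).
  have [|P PE] := @cover_span (edges_of S) (marks_of S) N g cov.
    by move=> x; rewrite join_of -gS => /imsetP[j _ ->]; exists j.
  have := congr1 determinant PE; rewrite det_mulmx det1 -/(colmx _ _).
  set d := \det _ => dP.
  (* an integer with an integer inverse *)
  suff -> : d ^+ 2 = 1 by [].
  have : (absz d * absz (\det P) == 1)%N by rewrite -abszM dP.
  by rewrite muln_eq1 => /andP[/eqP d1 _]; rewrite -(real_normK (num_real d)) -abszE d1 expr1n.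
suff -> : \det (colmx (inc int) g) = 0 by rewrite expr0n.
move: ncov; rewrite negb_forall => /existsP[v0]; rewrite negb_exists => /forallP nv0.
(* the indicator of the component of [v0] kills every column *)
apply/eqP/det0P; exists (\row_i (conn (edges_of S) v0 i)%:R).
  by apply/eqP => /rowP/(_ v0); rewrite !mxE conn_refl.
apply/rowP => j; rewrite !mxE; under eq_bigr do rewrite !mxE.
have gjS : g j \in S by exact: enum_valP.
case: (g j) gjS => [e|u] gjS /=.
  under eq_bigr do rewrite mulrBr.
  have pick v : \sum_i (conn (edges_of S) v0 i)%:R * (i == v)%:R = (conn (edges_of S) v0 v)%:R :> int.
    by rewrite (bigD1 v) //= eqxx mulr1 big1 ?addr0 // => i /negPf ->; rewrite mulr0.
  rewrite sumrB !pick; have eF : e \in edges_of S by rewrite inE.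
  have -> : conn (edges_of S) v0 (s e) = conn (edges_of S) v0 (t e).
    apply/idP/idP => /conn_trans; apply; last rewrite conn_sym; exact: conn_edge.
  by rewrite subrr.
rewrite (bigD1 u) //= eqxx mulr1 big1 ?addr0 => [|i /negPf ->]; last by rewrite mulr0.
by have := nv0 u; rewrite inE gjS /= => /negPf ->.
Qed.

End FiniteGraph.

(** * Spanning forests and the weighted Laplacian *)
Section SpanningForests.
Variables (N : nat) (E : finType) (s t : E -> 'I_N) (sgn : E -> int).
Implicit Types (F : {set E}) (K D : {set 'I_N}) (u v r : 'I_N) (e : E).
Notation conn := (conn s t).
Notation cover := (cover s t).

(** Components are handled through a canonical representative [rt v] of the
    component of [v]; [roots] is the set of representatives. *)
Definition rt : 'I_N -> 'I_N := fingraph.root (adj s t setT).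
Definition roots : {set 'I_N} := [set v | rt v == v].
Definition cls r : {set 'I_N} := [set v | rt v == r].

Lemma conn_rt v : conn setT v (rt v).
Proof. exact: connect_root. Qed.

Lemma rtP u v : reflect (rt u = rt v) (conn setT u v).
Proof. exact: (fingraph.rootP (sym_connect_sym (@adj_sym _ _ s t setT))). Qed.

Lemma rt_id v : rt (rt v) = rt v.
Proof. by apply/esym/rtP; exact: conn_rt. Qed.

Lemma rt_roots v : rt v \in roots. Proof. by rewrite inE rt_id. Qed.

Lemma rt_conn F u v : conn F u v -> rt u = rt v.
Proof. by move=> uv; apply/rtP; apply: connS uv; exact: subsetT. Qed.

(** Spanning within each component, as the graph need not be connected. *)
Definition spanning F := [forall v, conn F v (rt v)].
Definition forest F := [forall e in F, ~~ conn (F :\ e) (s e) (t e)].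

Lemma forestP F : reflect (forall e, e \in F -> ~~ conn (F :\ e) (s e) (t e)) (forest F).
Proof. exact: forall_inP. Qed.

Lemma spanningP F : reflect (forall u v, rt u = rt v -> conn F u v) (spanning F).
Proof.
apply: (iffP forallP) => [h u v uv|h v]; last by apply: h; rewrite rt_id.
by apply: conn_trans (h u) _; rewrite uv conn_sym.
Qed.

Lemma spanning_cover F : spanning F -> cover F roots.
Proof.
move=> /spanningP sF; apply/coverP => v; exists (rt v); first exact: rt_roots.
by apply: sF; rewrite rt_id.
Qed.

(** A linear relation between the columns of a forest and of one root per
    component is trivial: pairing it with the indicator of the part cut off by
    removing an edge [e], on the side away from the root, isolates the
    coefficient of [e]. *)
Lemma forest_card_le F : spanning F -> forest F -> (#|F| + #|roots| <= N)%N.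
Proof.
move=> /spanningP sF /forestP fF; rewrite -card_join leqNgt; apply/negP => lt_N.
set S := join F roots in lt_N.
pose x (j : 'I_#|S|) : E + 'I_N := enum_val j.
pose M : 'M[rat]_(#|S|, N) := \matrix_(j, i) inc s t rat i (x j).
have ker0 : kermx M != 0.
  rewrite -mxrank_eq0 mxrank_ker -lt0n subn_gt0.
  by rewrite (leq_ltn_trans (rank_leq_col _)).
pose lam := nz_row (kermx M).
have lamM : lam *m M = 0 by apply/sub_kermxP; exact: nz_row_sub.
have pairing (chi : 'I_N -> rat) : \sum_j lam 0 j * (\sum_i inc s t rat i (x j) * chi i) = 0.
  have h : (lam *m (M *m \col_i chi i)) 0 0 = 0 by rewrite mulmxA lamM mul0mx mxE.
  rewrite -[RHS]h mxE; apply: eq_bigr => j _; congr (_ * _).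
  by rewrite mxE; apply: eq_bigr => i _; rewrite !mxE.
have pick (chi : 'I_N -> rat) v : \sum_i (i == v)%:R * chi i = chi v.
  by rewrite (bigD1 v) //= eqxx mul1r big1 ?addr0 // => i /negPf ->; rewrite mul0r.
have pickE (chi : 'I_N -> rat) e : \sum_i inc s t rat i (inl e) * chi i = chi (s e) - chi (t e).
  under eq_bigr do rewrite /= mulrBl.
  by rewrite sumrB !pick.
have lamE j e : x j = inl e -> lam 0 j = 0.
  move=> xj; have eF : e \in F by have := enum_valP j; rewrite -/(x j) xj inE.
  have [w [wst nw]] : exists w, [/\ w \in [:: s e; t e] & ~~ conn (F :\ e) w (rt w)].
    have [sr|] := boolP (conn (F :\ e) (s e) (rt (s e))); last by exists (s e); rewrite !inE eqxx.
    exists (t e); rewrite !inE eqxx orbT; split=> //.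
    apply: contra (fF e eF) => tr; apply: conn_trans sr _.
    by rewrite conn_sym (rt_conn (conn_edge s t eF)).
  pose chi v : rat := (conn (F :\ e) w v)%:R.
  have := pairing chi; rewrite (bigD1 j) //= [X in _ + X]big1 ?addr0 => [|k kj].
    rewrite xj pickE /chi => /eqP; rewrite mulf_eq0 => /orP[/eqP //|].
    have nst := fF e eF; move: wst nw; rewrite !inE => /orP[]/eqP-> _.
      by rewrite conn_refl (negPf nst).
    by rewrite conn_refl conn_sym (negPf nst).
  case xk: (x k) => [e'|u].
    rewrite pickE /chi; suff -> : conn (F :\ e) w (s e') = conn (F :\ e) w (t e').
      by rewrite subrr mulr0.
    have e'F : e' \in F :\ e.
      have := enum_valP k; rewrite -/(x k) xk !inE => ->; rewrite andbT.
      by apply: contraNneq kj => ee; rewrite ee -xj in xk; rewrite (enum_val_inj xk).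
    by apply/idP/idP => /conn_trans; apply; last rewrite conn_sym; exact: conn_edge.
  rewrite /= pick /chi; have [wu|] := boolP (conn _ _ _); last by rewrite mulr0.
  have := enum_valP k; rewrite -/(x k) xk !inE => /eqP ur.
  by case/negP: nw; rewrite (rt_conn wu) ur.
have lam0 : lam = 0.
  apply/rowP => j; rewrite mxE.
  case xj: (x j) => [e|u]; first exact: lamE xj.
  have := pairing (fun v => (v == u)%:R); rewrite (bigD1 j) //= [X in _ + X]big1 ?addr0 => [|k kj].
    by rewrite xj /= pick eqxx mulr1.
  case xk: (x k) => [e'|u']; first by rewrite (lamE _ _ xk) mul0r.
  rewrite /= pick; case: eqP => [uu|_]; last by rewrite mulr0.
  by case/eqP: kj; apply: enum_val_inj; rewrite -/(x k) -/(x j) xk xj uu.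
by move: ker0; rewrite -nz_row_eq0 -/lam lam0 eqxx.
Qed.

(** Independence of the columns bounds the number of edges of a forest from
    above, and [cover_card] bounds that of any spanning subgraph from below. In
    the presence of a cycle the lower bound is strict, as an edge can be removed. *)
Lemma forest_card F : spanning F -> forest F = (#|F| + #|roots| == N)%N.
Proof.
move=> sF; apply/idP/eqP => [fF|cF].
  by apply/eqP; rewrite eqn_leq forest_card_le // (cover_card (spanning_cover sF)).
apply/forestP => e eF; apply/negP => ste.
have sF' : spanning (F :\ e).
  by apply/spanningP => u v /(spanningP _ sF) uv; exact: conn_del.
have := cover_card (spanning_cover sF').
rewrite [X in (X <= _)%N](_ : N = (#|F :\ e| + #|roots|).+1)%N ?ltnn //.
by rewrite -{1}cF (cardsD1 e F) eF add1n.
Qed.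

Definition transversal D K := [&& K \subset D, #|K| == #|roots| & rt @: K == roots].

Lemma cover_roots F K : cover F K -> rt @: K = roots.
Proof.
move=> /coverP cov; apply/eqP; rewrite eqEsubset; apply/andP; split; apply/subsetP => r.
  by move=> /imsetP[v _ ->]; exact: rt_roots.
rewrite inE => /eqP rr; have [u uK /rt_conn ru] := cov r.
by apply/imsetP; exists u; rewrite // -ru rr.
Qed.

Lemma cover_card_roots F K : cover F K -> (#|roots| <= #|K|)%N.
Proof. by move=> /cover_roots <-; exact: leq_imset_card. Qed.

Lemma card_transversal D :
  #|[set K | transversal D K]| = (\prod_(r in roots) #|D :&: cls r|)%N.
Proof.
pose fam r : pred 'I_N := if r \in roots then [pred v in D :&: cls r] else pred1 r.
have -> : (\prod_(r in roots) #|D :&: cls r| = #|family fam|)%N.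
  rewrite card_family foldrE big_map big_enum /= [RHS](bigID (mem roots)) /=.
  rewrite [X in (_ = _ * X)%N]big1 ?muln1 => [|r rR]; last by rewrite /fam (negPf rR) card1.
  by apply: eq_bigr => r rR; apply: eq_card => v; rewrite /fam rR.
have famP (g : {ffun 'I_N -> 'I_N}) r : g \in family fam -> r \in roots ->
    g r \in D /\ rt (g r) = r.
  by move=> /familyP/(_ r); rewrite /fam => + rR; rewrite rR !inE => /andP[gD /eqP].
have -> : [set K | transversal D K] = (fun g : {ffun 'I_N -> 'I_N} => g @: roots) @: family fam.
  apply/setP => K; rewrite inE; apply/idP/imsetP => [/and3P[KD cK /eqP rK]|[g gf ->]].
    have rinj : {in K &, injective rt} by apply/imset_injP; rewrite rK eq_sym.
    pose g : {ffun 'I_N -> 'I_N} := [ffun r => if r \in roots then odflt r [pick v in K | rt v == r] else r].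
    have gP r : r \in roots -> g r \in K /\ rt (g r) = r.
      move=> rR; rewrite ffunE rR; case: pickP => [v /andP[vK /eqP]//|nv].
      by move: rR; rewrite -rK => /imsetP[v vK rv]; have := nv v; rewrite vK rv eqxx.
    exists g.
      apply/familyP => r; rewrite /fam; case: ifPn => rR.
        by have [gK gr] := gP r rR; rewrite !inE (subsetP KD) // gr eqxx.
      by rewrite ffunE (negPf rR) inE.
    apply/setP => v; apply/idP/imsetP => [vK|[r rR ->]]; last by have [] := gP r rR.
    exists (rt v); first exact: rt_roots.
    by have [gK gr] := gP _ (rt_roots v); apply: rinj.
  have ginj : {in roots &, injective g}.
    by move=> r r' rR rR' gg; have [_ <-] := famP _ _ gf rR; rewrite gg; have [_] := famP _ _ gf rR'.
  apply/and3P; split.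
  - by apply/subsetP => _ /imsetP[r rR ->]; have [] := famP _ _ gf rR.
  - by rewrite card_in_imset.
  - rewrite -imset_comp; apply/eqP/setP => r; apply/imsetP/idP => [[r' rR ->]|rR].
      by rewrite /=; have [_ ->] := famP _ _ gf rR.
    by exists r => //=; have [_ ->] := famP _ _ gf rR.
rewrite card_in_imset // => g g' gf gf' gg'; apply/ffunP => r.
have [rR|rR] := boolP (r \in roots); last first.
  have /familyP/(_ r) := gf; have /familyP/(_ r) := gf'.
  by rewrite /fam (negPf rR) !inE => /eqP -> /eqP ->.
have : g r \in g' @: roots by rewrite -gg' imset_f.
move=> /imsetP[r' rR' gr]; have [_ r1] := famP _ _ gf rR; have [_ r2] := famP _ _ gf' rR'.
by rewrite gr -r1 gr r2.
Qed.

(** Among the pairs [F], [K] that contribute to the determinant, those with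
    [#|K|] minimal are the pairs of a maximal spanning forest and a set of
    marked vertices, one in each component. *)
Lemma cover_transversal D F K : (#|F| + #|K| == N)%N && cover F K && (K \subset D) && (#|K| == #|roots|)
  = (spanning F && forest F) && transversal D K.
Proof.
apply/idP/idP => [/andP[/andP[/andP[/eqP cN cov] KD] /eqP cK]|].
  have rK := cover_roots cov.
  have rinj : {in K &, injective rt} by apply/imset_injP; rewrite rK eq_sym cK.
  have sF : spanning F.
    have /coverP covP := cov.
    apply/forallP => v; have [u uK vu] := covP v.
    have [u' uK' vu'] := covP (rt v).
    apply: (conn_trans vu); rewrite conn_sym.
    suff -> : u = u' by [].
    by apply: rinj => //; rewrite -(rt_conn vu) -(rt_conn vu') rt_id.
  have fF : forest F by rewrite forest_card //; apply/eqP; rewrite -[RHS]cN; congr addn.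
  by rewrite sF fF /transversal KD cK rK !eqxx.
move=> /andP[/andP[sF]]; rewrite forest_card // => /eqP cN /and3P[-> /eqP cK /eqP rK].
rewrite cK cN !eqxx !andbT /=; apply/coverP => v.
have : rt v \in rt @: K by rewrite rK rt_roots.
move=> /imsetP[u uK ru]; exists u => //; exact: (spanningP _ sF).
Qed.

Definition laplacian i j : int := \sum_e sgn e * inc s t int i (inl e) * inc s t int j (inl e).

Definition forest_sum : int := \sum_(F | spanning F && forest F) \prod_(e in F) sgn e.

(** The matrix-tree theorem with the vertices of [D] marked. The Laplacian plus
    marks is a weighted Gram matrix of the incidence matrix extended by a column
    for each mark, so Cauchy-Binet applies; the determinants of the minors are
    given by [minor_sqr_inc], and the power of ['X] is the number of marks used. *)
Theorem det_laplacian D : exists2 Q : {poly int},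
  \det (\matrix_(i, j) ((laplacian i j)%:P + ((i == j) && (i \in D))%:R *: 'X)) =
    'X^#|roots| * Q
  & Q.[0] = (\prod_(r in roots) #|D :&: cls r|)%N%:Z * forest_sum.
Proof.
pose w (x : E + 'I_N) : {poly int} :=
  match x with inl e => (sgn e)%:P | inr u => (u \in D)%:R *: 'X end.
have -> : \matrix_(i, j) ((laplacian i j)%:P + ((i == j) && (i \in D))%:R *: 'X) =
    \matrix_(i, j) \sum_x w x * inc s t {poly int} i x * inc s t {poly int} j x.
  apply/matrixP => i j; rewrite !mxE big_sumType /=; congr (_ + _).
    rewrite /laplacian rmorph_sum; apply: eq_bigr => e _ /=.
    by rewrite !rmorphM /= !rmorphB /= !rmorph_nat.
  rewrite (bigD1 i) //= eqxx mulr1 big1 ?addr0 => [|k ki]; last first.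
    by rewrite [i == k]eq_sym (negPf ki) mulr0 mul0r.
  by rewrite [j == i]eq_sym; case: (i == j); rewrite /= ?mulr1 ?mulr0 ?scale0r.
rewrite cauchy_binet.
have wS (F : {set E}) (K : {set 'I_N}) : \prod_(x in join F K) w x =
    if K \subset D then (\prod_(e in F) sgn e)%:P * 'X^#|K| else 0.
  rewrite prod_join /= -rmorph_prod; case: ifPn => KD.
    congr (_ * _); rewrite -prodr_const.
    by apply: eq_bigr => u uK; rewrite (subsetP KD) // scale1r.
  have [u uK uD] := subsetPn KD.
  by rewrite [X in _ * X](bigD1 u) //= (negPf uD) scale0r mul0r mulr0.
pose good (FK : {set E} * {set 'I_N}) :=
  (#|FK.1| + #|FK.2| == N)%N && cover FK.1 FK.2 && (FK.2 \subset D).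
exists (\sum_(FK | good FK) (\prod_(e in FK.1) sgn e)%:P * 'X^(#|FK.2| - #|roots|)).
  rewrite mulr_sumr (reindex_onto (fun FK => join FK.1 FK.2) (fun S => (edges_of S, marks_of S))) /=; last first.
    by move=> S _; rewrite join_of.
  rewrite [RHS]big_mkcond [LHS]big_mkcond /=; apply: eq_bigr => -[F K] _ /=.
  rewrite edges_of_join marks_of_join eqxx andbT card_join /good /=.
  case: eqP => //= cN; rewrite minor_sqr_inc ?card_join // edges_of_join marks_of_join wS.
  have [cov|] := boolP (cover F K); last by rewrite mulr0.
  rewrite mulr1 /=; case: ifP => //= KD.
  by rewrite mulrCA -exprD subnKC // (cover_card_roots cov).
rewrite horner_sum.
transitivity (\sum_(FK : {set E} * {set 'I_N} | (spanning FK.1 && forest FK.1) && transversal D FK.2)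
    \prod_(e in FK.1) sgn e).
  rewrite [LHS]big_mkcond [RHS]big_mkcond /=; apply: eq_bigr => -[F K] _ /=.
  rewrite -cover_transversal /good /=; case: ifP => //= /andP[/andP[_ cov] _].
  rewrite hornerM hornerC hornerXn expr0n subn_eq0.
  have cle := cover_card_roots cov.
  by rewrite eqn_leq cle andbT; case: ifP => _; rewrite ?mulr1 ?mulr0.
rewrite -(pair_big (fun F => spanning F && forest F) (transversal D) (fun F K => \prod_(e in F) sgn e)) /=.
rewrite -card_transversal /forest_sum mulr_sumr; apply: eq_bigr => F _.
rewrite sumr_const -natz mulr_natl; congr (_ *+ _).
by apply: eq_card => K; rewrite !inE.
Qed.

End SpanningForests.

(** * Block-circulant determinants *)
Lemma det_sylvester (R : comUnitRingType) m n (X : 'M[R]_(m, n)) (Y : 'M[R]_(n, m)) :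
  \det (1%:M + X *m Y) = \det (1%:M + Y *m X).
Proof.
have e1 : block_mx 1%:M (- X) Y 1%:M *m block_mx 1%:M X 0 1%:M =
    block_mx 1%:M 0 Y (1%:M + Y *m X).
  by rewrite mulmx_block !mul1mx !mulmx1 !mulmx0 !addr0 subrr addrC.
have e2 : block_mx 1%:M (- X) Y 1%:M *m block_mx 1%:M 0 (- Y) 1%:M =
    block_mx (1%:M + X *m Y) (- X) 0 1%:M.
  by rewrite mulmx_block !mul1mx !mulmx1 !mulmx0 !add0r mulNmx mulmxN opprK subrr.
have d1 := congr1 determinant e1; have d2 := congr1 determinant e2.
rewrite det_mulmx det_ublock det_lblock !det1 !mul1r mulr1 in d1.
rewrite det_mulmx det_lblock det_ublock !det1 !mulr1 in d2.
by rewrite -d1 -d2.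
Qed.

(** The matrix is the product of matrices [1 + G j], one for each block;
    Sylvester's identity reduces the determinant of each to the size of the
    block. *)
Lemma det_block_diag (R : comUnitRingType) (I J : finType) (n := #|I|)
    (B : J -> I -> I -> R) :
  \det (\matrix_(u < #|{: I * J}|, v < #|{: I * J}|)
      (((enum_val u).2 == (enum_val v).2)%:R *
        B (enum_val u).2 (enum_val u).1 (enum_val v).1)) =
  \prod_(j : J) \det (\matrix_(i < n, k < n) B j (enum_val i) (enum_val k)).
Proof.
set N := #|{: I * J}|.
pose Bm j : 'M[R]_n := \matrix_(i, k) B j (enum_val i) (enum_val k).
pose U j : 'M[R]_(N, n) := \matrix_(u, i) ((enum_val u == (enum_val i, j))%:R).
have UU j k : (U j)^T *m U k = ((j == k)%:R)%:M.
  apply/matrixP => i l; rewrite !mxE.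
  rewrite (reindex_onto (enum_rank : I * J -> 'I_N) enum_val) => [|? _]; last by rewrite enum_valK.
  rewrite (bigD1 (enum_val i, j)) ?enum_rankK ?eqxx //= big1 => [|p /andP[_ pi]]; last first.
    by rewrite !mxE enum_rankK (negPf pi) mul0r.
  rewrite addr0 !mxE enum_rankK eqxx mul1r xpair_eqE (inj_eq enum_val_inj).
  by case: (i == l); case: (j == k).
pose G j : 'M[R]_N := U j *m ((Bm j - 1%:M) *m (U j)^T).
have detG j : \det (1%:M + G j) = \det (Bm j).
  by rewrite /G det_sylvester -mulmxA UU eqxx mulmx1 addrC subrK.
have GG j k : j != k -> G j *m G k = 0.
  move=> jk; rewrite /G -!mulmxA (mulmxA (U j)^T) UU (negPf jk).
  by rewrite mulr0n raddf0 mul0mx !mulmx0.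
have det_sum (s : seq J) : uniq s -> \det (1%:M + \sum_(j <- s) G j) = \prod_(j <- s) \det (Bm j).
  elim: s => [|j s IHs] /=; first by rewrite !big_nil addr0 det1.
  move=> /andP[js us]; rewrite !big_cons -IHs // -detG -det_mulmx; congr (\det _).
  rewrite mulmxDl mul1mx mulmxDr mulmx1 mulmx_sumr [X in _ + (_ + X)]big1_seq ?addr0.
    by rewrite [in RHS]addrAC addrA.
  by move=> k /= ks; rewrite GG //; apply: contraNneq js => ->.
have := det_sum (index_enum J) (index_enum_uniq J); rewrite -/Bm => <-.
congr (\det _); apply/matrixP => u v; rewrite !mxE summxE.
case Eu: (enum_val u) => [i j]; case Ev: (enum_val v) => [k l] /=.
have GE m : G m u v = (j == m)%:R * (l == m)%:R * (B m i k - (i == k)%:R).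
  rewrite mxE (bigD1 (enum_rank i)) //= big1 ?addr0 => [|p pi]; last first.
    rewrite !mxE Eu xpair_eqE; case: (i =P enum_val p) => [ip|]; last by rewrite mul0r.
    by case/eqP: pi; rewrite ip enum_valK.
  rewrite !mxE Eu enum_rankK xpair_eqE eqxx /= -mulrA; congr (_ * _).
  rewrite (bigD1 (enum_rank k)) //= big1 ?addr0 => [|p pk]; last first.
    rewrite !mxE Ev xpair_eqE; case: (k =P enum_val p) => [ip|]; last by rewrite /= mulr0n mulr0.
    by case/eqP: pk; rewrite ip enum_valK.
  rewrite !mxE Ev !enum_rankK xpair_eqE eqxx /= mulrC; congr (_ * (_ - _%:R)).
  by rewrite (inj_eq enum_rank_inj).
under eq_bigr do rewrite GE.
have -> : (u == v) = (i == k) && (j == l).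
  by rewrite -(inj_eq enum_val_inj) Eu Ev xpair_eqE.
rewrite (bigD1 j) //= eqxx mul1r big1 ?addr0 => [|p /negPf pj]; last first.
  by rewrite eq_sym pj !mul0r.
rewrite [l == j]eq_sym; case: (j == l); rewrite ?mul1r ?mul0r ?andbT ?andbF ?addr0 //.
by rewrite addrC subrK.
Qed.

(** Matrices indexed by pairs are handled through [enum_val]; this collapses a
    sum over the index in which the first component is imposed. *)
Lemma sum_pair_delta (R : comNzRingType) (I K : finType) (N := #|{: I * K}|) (i : I) (F : 'I_N -> R) :
  \sum_(u < N) ((enum_val u).1 == i)%:R * F u = \sum_(a : K) F (enum_rank (i, a)).
Proof.
rewrite (reindex_onto (enum_rank : I * K -> 'I_N) enum_val) => [|u _]; last by rewrite enum_valK.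
under eq_bigl do rewrite enum_rankK eqxx.
rewrite (eq_bigr (fun p : I * K => (p.1 == i)%:R * F (enum_rank (p.1, p.2)))); last first.
  by case=> k a _; rewrite enum_rankK.
rewrite -(pair_bigA _ (fun k a => (k == i)%:R * F (enum_rank (k, a)))) /=.
rewrite (bigD1 i) //= [X in _ + X]big1 ?addr0.
  by apply: eq_bigr => a _; rewrite eqxx mul1r.
by move=> k /negPf ki; rewrite big1 // => a _; rewrite ki mul0r.
Qed.

Section BlockCirculant.
Variables (I : finType) (r' : nat).
Let r := r'.+1.
Let N := #|{: I * 'I_r}|.
Variables (R : idomainType) (w : R).
Hypothesis w_prim : r.-primitive_root w.
Hypothesis r_neq0 : r%:R != 0 :> R.

Lemma root_expD (a b : 'I_r) z : w ^+ (z * (a + b)%R) = w ^+ (z * a) * w ^+ (z * b).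
Proof.
rewrite -exprD -mulnDr [LHS]exprM [RHS]exprM.
have wz : (w ^+ z) ^+ r = 1 by rewrite exprAC (prim_expr_order w_prim) expr1n.
by rewrite -(expr_mod (a + b)%N wz).
Qed.

Lemma root_sum (d : 'I_r) : \sum_(z < r) w ^+ (z * d) = (d == 0)%:R * r%:R.
Proof.
have [->|d0] := eqVneq d 0.
  rewrite mul1r (eq_bigr (fun=> 1)) => [|z _]; last by rewrite muln0.
  by rewrite sumr_const card_ord.
apply/eqP; rewrite mul0r; apply/eqP/(@mulfI _ (w ^+ d - 1)).
  rewrite subr_eq0 -(expr0 w) (eq_prim_root_expr w_prim) mod0n modn_small //.
under eq_bigr do rewrite mulnC exprM.
by rewrite -subrX1 exprAC (prim_expr_order w_prim) expr1n subrr mulr0.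
Qed.

(** The discrete Fourier transform in the cyclic coordinate makes a
    block-circulant matrix block-diagonal. *)
Lemma det_block_circulant (A : I -> I -> 'I_r -> R) :
  \det (\matrix_(u < N, v < N)
      A (enum_val u).1 (enum_val v).1 ((enum_val v).2 - (enum_val u).2)) =
  \prod_(z < r) \det (\matrix_(i < #|I|, k < #|I|)
      \sum_(d : 'I_r) A (enum_val i) (enum_val k) d * w ^+ (z * d)).
Proof.
pose B (z : 'I_r) i k := \sum_(d : 'I_r) A i k d * w ^+ (z * d).
pose W : 'M[R]_N := \matrix_(u < N, v < N)
  (((enum_val u).1 == (enum_val v).1)%:R * w ^+ ((enum_val v).2 * (enum_val u).2)).
pose Wb : 'M[R]_N := \matrix_(u < N, v < N)
  (((enum_val u).1 == (enum_val v).1)%:R * w ^+ ((enum_val u).2 * (- (enum_val v).2)%R)).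
have WWb : W *m Wb = (r%:R)%:M.
  apply/matrixP => u v; rewrite !mxE.
  under eq_bigr => x _ do rewrite !mxE [(enum_val u).1 == _]eq_sym -mulrA.
  rewrite sum_pair_delta.
  under eq_bigr => z _ do rewrite enum_rankK mulrCA -root_expD.
  rewrite -(mulr_sumr _ _ _ ((enum_val u).1 == (enum_val v).1)%:R) root_sum subr_eq0 mulrA -natrM mulnb -xpair_eqE -!surjective_pairing.
  by rewrite (inj_eq enum_val_inj) mulr_natl.
have detW : \det W != 0.
  have /eqP := congr1 determinant WWb; rewrite det_mulmx det_scalar => dW.
  by apply: contraTneq dW => ->; rewrite mul0r eq_sym expf_neq0.
rewrite -(det_block_diag B); apply: (mulIf detW); rewrite [RHS]mulrC -!det_mulmx.
congr (\det _); apply/matrixP => u v; rewrite !mxE.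
under eq_bigr => x _ do rewrite !mxE mulrCA.
under [RHS]eq_bigr => x _ do rewrite !mxE [(enum_val u).1 == _]eq_sym -mulrA.
rewrite !sum_pair_delta.
under eq_bigr => c _ do rewrite enum_rankK.
under [RHS]eq_bigr => c _ do rewrite enum_rankK mulrCA.
rewrite (reindex_inj (addrI (enum_val u).2)) /=.
under eq_bigr => d _ do rewrite addrC addKr root_expD mulrCA.
rewrite -mulr_sumr [RHS](bigD1 (enum_val v).2) //= eqxx mul1r [X in _ = _ + X]big1 ?addr0 //.
by move=> z /negPf zv; rewrite zv mul0r.
Qed.

End BlockCirculant.

(** * Cyclic covers of a finite graph *)
Section Cover.
Variables (I J : finType) (es et : J -> I) (eb : J -> nat) (sg : J -> int) (D0 : {set I}).

(** A common bound for the shifts, used to clear the negative powers of the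
    Fourier variable. *)
Definition max_shift : nat := \sum_j eb j.

(** The Fourier symbol of the Laplacian with the vertices of [D0] marked,
    multiplied by [x ^+ max_shift]. *)
Definition symbol (R : comNzRingType) (x y : R) i k : R :=
  \sum_j (sg j)%:~R * ((i == es j)%:R * x ^+ max_shift - (i == et j)%:R * x ^+ (max_shift - eb j))
    * ((k == es j)%:R - (k == et j)%:R * x ^+ eb j)
  + ((i == k) && (i \in D0))%:R * (x ^+ max_shift * y).

Definition symbol_det (R : comNzRingType) (x y : R) : R :=
  \det (\matrix_(i < #|I|, k < #|I|) symbol x y (enum_val i) (enum_val k)).

Lemma rmorph_symbol_det (R S : comNzRingType) (f : {rmorphism R -> S}) x y :
  f (symbol_det x y) = symbol_det (f x) (f y).
Proof.
rewrite /symbol_det -det_map_mx; congr (\det _); apply/matrixP => i k; rewrite !mxE /symbol.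
rewrite rmorphD !rmorphM !rmorph_nat rmorphXn rmorph_sum; congr (_ + _).
by apply: eq_bigr => j _; rewrite !(rmorphM, rmorphB, rmorph_int, rmorph_nat, rmorphXn).
Qed.

Lemma eb_le j : (eb j <= max_shift)%N.
Proof. by rewrite /max_shift (bigD1 j) //= leq_addr. Qed.

Section Level.
Variable r' : nat.
Let r := r'.+1.
Let N := #|{: I * 'I_r}|.

Definition cover_s (x : J * 'I_r) : 'I_N := enum_rank (es x.1, x.2).
Definition cover_t (x : J * 'I_r) : 'I_N := enum_rank (et x.1, x.2 + inZp (eb x.1)).
Definition cover_sg (x : J * 'I_r) : int := sg x.1.

(** The block of the Laplacian at distance [d] in the cyclic coordinate. *)
Let C i k (d : 'I_r) : int := \sum_j sg j *
  ((i == es j)%:R * (((k, d) == (es j, 0))%:R - ((k, d) == (et j, inZp (eb j)))%:R)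
 - (i == et j)%:R * (((k, d) == (es j, - inZp (eb j)))%:R - ((k, d) == (et j, 0))%:R)).

Let sum_at (b : 'I_r) (F : 'I_r -> int) : \sum_a (a == b)%:R * F a = F b.
Proof.
rewrite (bigD1 b) //= eqxx mul1r big1 ?addr0 // => a /negPf ab.
by rewrite ab mul0r.
Qed.

Lemma cover_laplacian u v : laplacian cover_s cover_t cover_sg u v =
  C (enum_val u).1 (enum_val v).1 ((enum_val v).2 - (enum_val u).2).
Proof.
case Eu: (enum_val u) => [i a]; case Ev: (enum_val v) => [k c] /=.
rewrite /laplacian /inc /cover_s /cover_t /cover_sg.
have eqr (w : 'I_N) p : (w == enum_rank p) = (enum_val w == p).
  by rewrite -(inj_eq enum_val_inj) enum_rankK.
pose D i' a' j (x : 'I_r) : int :=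
  ((i', a') == (es j, x))%:R - ((i', a') == (et j, x + inZp (eb j)))%:R.
transitivity (\sum_(p : J * 'I_r) sg p.1 * (D i a p.1 p.2 * D k c p.1 p.2)).
  by apply: eq_bigr => p _; rewrite !eqr Eu Ev -mulrA.
rewrite -(pair_bigA _ (fun j x => sg j * (D i a j x * D k c j x))) /=.
apply: eq_bigr => j _; rewrite /D.
rewrite -mulr_sumr; congr (_ * _); set b := inZp _ : 'I_r.
pose F x : int := ((k, c) == (es j, x))%:R - ((k, c) == (et j, x + b))%:R.
rewrite (eq_bigr (fun x => (i == es j)%:R * ((x == a)%:R * F x)
    - (i == et j)%:R * ((x == a - b)%:R * F x))) => [|x _]; last first.
  rewrite mulrBl -/(F x); congr (_ - _); rewrite mulrA; congr (_ * _).
    by rewrite xpair_eqE -mulnb natrM [x == a]eq_sym.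
  by rewrite xpair_eqE -mulnb natrM [_ == a - b]eq_sym subr_eq.
rewrite sumrB -!mulr_sumr !sum_at /F subrK !xpair_eqE !subr_eq !add0r.
by rewrite [- b + a]addrC [b + a]addrC.
Qed.

Section Spectrum.
Variables (R : idomainType) (w : R).
Hypothesis w_prim : r.-primitive_root w.
Hypothesis r_neq0 : r%:R != 0 :> R.

Lemma cover_symbol z (y : R) i k : (w ^+ z) ^+ max_shift *
  (\sum_(d : 'I_r) ((C i k d)%:~R + ((i == k) && (d == 0) && (i \in D0))%:R * y) * w ^+ (z * d)) =
  symbol (w ^+ z) y i k.
Proof.
have sum_at' (b : 'I_r) (F : 'I_r -> R) : \sum_a (a == b)%:R * F a = F b.
  rewrite (bigD1 b) //= eqxx mul1r big1 ?addr0 // => a /negPf ab.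
  by rewrite ab mul0r.
have wz : (w ^+ z) ^+ r = 1 by rewrite exprAC (prim_expr_order w_prim) expr1n.
under eq_bigr do rewrite mulrDl.
rewrite big_split /= mulrDr /symbol; congr (_ + _); last first.
  rewrite (eq_bigr (fun d : 'I_r => (d == 0)%:R * (((i == k) && (i \in D0))%:R * y * w ^+ (z * d)))).
    by rewrite sum_at' muln0 mulr1 mulrCA.
  by move=> d _; rewrite andbAC -mulnb natrM [X in X * y]mulrC !mulrA.
rewrite mulr_sumr; under eq_bigr do rewrite raddf_sum mulr_suml mulr_sumr.
rewrite exchange_big /=; apply: eq_bigr => j _; set b := inZp _ : 'I_r.
rewrite (eq_bigr (fun d : 'I_r => (sg j)%:~R * ((w ^+ z) ^+ max_shift *
   ((i == es j)%:R * ((k == es j)%:R * ((d == 0)%:R * w ^+ (z * d)) - (k == et j)%:R * ((d == b)%:R * w ^+ (z * d)))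
  - (i == et j)%:R * ((k == es j)%:R * ((d == - b)%:R * w ^+ (z * d)) - (k == et j)%:R * ((d == 0)%:R * w ^+ (z * d))))))).
  rewrite -!mulr_sumr sumrB -!mulr_sumr !sumrB -!mulr_sumr !sum_at' muln0 expr0.
  rewrite -mulrA; congr (_ * _).
  have -> : w ^+ (z * b) = (w ^+ z) ^+ eb j by rewrite exprM expr_mod.
  have e1 : (w ^+ z) ^+ max_shift = (w ^+ z) ^+ (max_shift - eb j) * (w ^+ z) ^+ eb j.
    by rewrite -exprD subnK // eb_le.
  have e2 : (w ^+ z) ^+ eb j * w ^+ (z * (- b)%R) = 1.
    have -> : (w ^+ z) ^+ eb j = w ^+ (z * b) by rewrite [RHS]exprM expr_mod.
    by rewrite -root_expD // subrr muln0.
  rewrite e1; move: e2; set p := _ ^+ (_ - _); set q := _ ^+ eb j; set q' := w ^+ _ => e2.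
  have -> : p * q * ((i == es j)%:R * ((k == es j)%:R * 1 - (k == et j)%:R * q) -
     (i == et j)%:R * ((k == es j)%:R * q' - (k == et j)%:R * 1)) =
     p * q * ((i == es j)%:R * ((k == es j)%:R - (k == et j)%:R * q)) -
     p * (i == et j)%:R * ((k == es j)%:R * (q * q') - (k == et j)%:R * q) by ring.
  by rewrite e2; ring.
move=> d _; rewrite rmorphM -!mulrA mulrCA; congr (_ * (_ * _)).
rewrite rmorphB !rmorphM !rmorphB !rmorph_nat !xpair_eqE -!mulnb !natrM; ring.
Qed.

(** The Laplacian of a cyclic cover is block-circulant, so its determinant is
    the product of the determinants of the symbol at the roots of unity. *)
Lemma cover_det (y : R) :
  (\prod_(z < r) (w ^+ z) ^+ max_shift) ^+ #|I| *
  \det (\matrix_(u, v) ((laplacian cover_s cover_t cover_sg u v)%:~R +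
     ((u == v) && ((enum_val u).1 \in D0))%:R * y)) =
  \prod_(z < r) symbol_det (w ^+ z) y.
Proof.
pose A i k d : R := (C i k d)%:~R + ((i == k) && (d == 0) && (i \in D0))%:R * y.
rewrite (_ : (\matrix_(_, _) _) = \matrix_(u < N, v < N)
   A (enum_val u).1 (enum_val v).1 ((enum_val v).2 - (enum_val u).2)); last first.
  apply/matrixP => u v; rewrite !mxE cover_laplacian /A subr_eq0; congr (_ + _%:R * _).
  rewrite -(inj_eq enum_val_inj); case: (enum_val u) (enum_val v) => [i a] [k c] /=.
  by rewrite xpair_eqE [c == a]eq_sym.
rewrite (det_block_circulant w_prim r_neq0) -prodrXl -big_split /=; apply: eq_bigr => z _.
rewrite -detZ; congr (\det _); apply/matrixP => i k; rewrite !mxE.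
exact: cover_symbol.
Qed.

End Spectrum.
End Level.
End Cover.

Section Weight.
Variables (n : nat) (J : finType) (es et : J -> 'I_n) (eb : J -> nat) (r' : nat).
Let r := r'.+1.
Let N := #|{: 'I_n * 'I_r}|.
Hypothesis r_prime : prime r.
Notation cs := (cover_s es (r' := r')).
Notation ct := (cover_t et eb (r' := r')).
Notation up := (conn cs ct setT).
Notation down := (conn es et setT).
Notation pt i a := (enum_rank (i, a) : 'I_N).

Lemma cover_proj u v : up u v -> down (enum_val u).1 (enum_val v).1.
Proof.
move=> uv; apply: (conn_ind _ uv (Q := fun v => down (enum_val u).1 (enum_val v).1)); last exact: conn_refl.
move=> e _; rewrite /cover_s /cover_t !enum_rankK /=.
have st : down (es e.1) (et e.1) by apply: conn_edge; rewrite inE.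
by split=> /conn_trans; apply; rewrite // conn_sym.
Qed.

Lemma cover_shift d u v : up u v ->
  up (pt (enum_val u).1 ((enum_val u).2 + d)) (pt (enum_val v).1 ((enum_val v).2 + d)).
Proof.
move=> uv; apply: (conn_ind _ uv (Q := fun v => up _ (pt (enum_val v).1 ((enum_val v).2 + d))));
  last exact: conn_refl.
move=> e _; rewrite /= /cover_s /cover_t !enum_rankK /=.
have st : up (pt (es e.1) (e.2 + d)) (pt (et e.1) (e.2 + inZp (eb e.1) + d)).
  rewrite addrAC; exact: (@conn_edge _ _ cs ct setT (e.1, e.2 + d) (in_setT _)).
by split=> /conn_trans; apply; rewrite // conn_sym.
Qed.

Lemma cover_lift i k a : down i k -> exists c, up (pt i a) (pt k c).
Proof.
move=> ik; apply: (conn_ind _ ik (Q := fun k => exists c, up (pt i a) (pt k c))); last first.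
  by exists a; exact: conn_refl.
move=> e _; split=> -[c ic].
  exists (c + inZp (eb e)); apply: conn_trans ic _.
  exact: (@conn_edge _ _ cs ct setT (e, c) (in_setT _)).
exists (c - inZp (eb e)); apply: conn_trans ic _; rewrite conn_sym.
have := @conn_edge _ _ cs ct setT (e, c - inZp (eb e)) (in_setT _).
by rewrite /cover_t /= subrK.
Qed.

Definition marks : {set 'I_N} := [set v | (enum_val v).1 \in roots es et].

(** In a class of the cover, the marked vertices form a coset of a subgroup of
    the cyclic group of prime order acting on the fibres. *)
Lemma marks_class q : q \in roots cs ct ->
  #|marks :&: cls cs ct q| = 1%N \/ #|marks :&: cls cs ct q| = r.
Proof.
rewrite inE => /eqP rq.
case Eq: (enum_val q) => [i a]; have qE : q = pt i a by rewrite -Eq enum_valK.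
have [c] := cover_lift a (conn_rt es et i); rewrite -qE; set i0 := rt es et i => qc.
pose S : {set 'I_r} := [set x | up (pt i0 c) (pt i0 (c + x))].
have gS : group_set S.
  apply/group_setP; split=> [|x y]; rewrite !inE; first by rewrite addr0 conn_refl.
  move=> cx cy; have := cover_shift x cy; rewrite !enum_rankK /= => /(conn_trans cx).
  by rewrite -addrA [y + x]addrC.
have -> : marks :&: cls cs ct q = [set pt i0 (c + x) | x in S].
  apply/setP => v; rewrite !inE; apply/andP/imsetP => [[/eqP iv /eqP qv]|[x]].
    have cv : up (pt i0 c) v.
      apply: (@conn_trans _ _ _ _ _ q); first by rewrite conn_sym.
      by apply/rtP; rewrite rq qv.
    have /rtP := cover_proj cv; rewrite enum_rankK /= iv /i0 rt_id -/i0 => vi.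
    have vE : v = pt i0 (c + ((enum_val v).2 - c)).
      by rewrite addrC subrK vi -surjective_pairing enum_valK.
    by exists ((enum_val v).2 - c) => //; rewrite inE -vE.
  rewrite inE => cx ->; rewrite enum_rankK /= rt_id eqxx; split=> //.
  by have /rtP <- := conn_trans qc cx; rewrite rq.
rewrite card_imset; last by move=> x y /enum_rank_inj[] xy; apply: (addrI c); apply: val_inj.
have : (#|S| %| r)%N.
  by have := cardSg (subsetT (Group gS)); rewrite cardsT card_ord.
move=> Sr; have [->|S1] := eqVneq #|S| 1%N; [by left|right].
exact/(prime_nt_dvdP r_prime S1).
Qed.

(** There are as many marked vertices as [r] times a constant, so at most [n]
    classes can contain a whole fibre. *)
Lemma marks_weight : (0 < \prod_(q in roots cs ct) #|marks :&: cls cs ct q| <= r ^ n)%N.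
Proof.
have r_gt1 := prime_gt1 r_prime; have r_gt0 := ltnW r_gt1.
apply/andP; split.
  by apply: prodn_cond_gt0 => q /marks_class[] ->.
rewrite (bigID (fun q => #|marks :&: cls cs ct q| == r)) /= [X in (_ * X)%N]big1 ?muln1; last first.
  by move=> q /andP[/marks_class[->//|->]]; rewrite eqxx.
rewrite (eq_bigr (fun=> r)) => [|q /andP[_ /eqP]//].
rewrite prod_nat_const leq_exp2l // -(leq_pmul2r r_gt0).
have nr : (n * r)%N = N by rewrite /N card_prod !card_ord.
rewrite nr; apply: (@leq_trans #|marks|); last by rewrite -[leqRHS]card_ord max_card.
rewrite -[leqRHS]sum1_card (partition_big (rt cs ct) (mem (roots cs ct))) /=; last first.
  by move=> v _; exact: rt_roots.
rewrite (bigID (fun q => #|marks :&: cls cs ct q| == r)) /=.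
rewrite (leq_trans _ (leq_addr _ _)) // -sum_nat_const leq_sum // => q /andP[_ /eqP {1}<-].
rewrite -sum1_card (eq_bigl (fun v => (v \in marks) && (rt cs ct v == q))) //.
by move=> v; rewrite !inE.
Qed.

End Weight.

(** * Liouville's inequality *)
Section Liouville.
Variables (F : numFieldType) (a : F).
Implicit Types f Q : {poly int}.

Definition pint (p : {poly int}) : {poly F} := map_poly intr p.

(** An annihilator of least degree, in place of the minimal polynomial of [a],
    keeps integer coefficients. *)
Lemma minimal_annihilator f : f != 0 -> root (pint f) a ->
  exists2 g : {poly int}, g != 0 /\ root (pint g) a &
    forall u : {poly int}, (size u < size g)%N -> root (pint u) a -> u = 0.
Proof.
move=> f0 fa.
pose Pr n := `[< exists g : {poly int}, [/\ g != 0, root (pint g) a & size g = n] >].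
have ex : exists n, Pr n by exists (size f); apply/asboolP; exists f.
have := ex_minnP ex; case=> n /asboolP[g [g0 ga sg]] nmin.
exists g => // u; rewrite sg => lt_un ua; apply/eqP/negPn/negP => u0.
have /nmin : Pr (size u) by apply/asboolP; exists u.
by rewrite leqNgt lt_un.
Qed.

Lemma int_norm_ge1 (z : int) : z != 0 -> 1 <= `|z%:~R : F|.
Proof. by move=> z0; rewrite -intr_norm ler1z -gtz0_ge1 normr_gt0. Qed.

Lemma absz_sum (I : finType) (P : pred I) (G : I -> int) :
  (absz (\sum_(i | P i) G i)%R <= \sum_(i | P i) absz (G i))%N.
Proof. by elim/big_rec2: _ => [|i x y _ le_xy] //; lia. Qed.

Lemma det_entry_le m (A : 'M[int]_m) (M : nat) :
  (forall i j, (absz (A i j) <= M)%N) -> (absz (\det A) <= m`! * M ^ m)%N.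
Proof.
move=> AM.
rewrite /determinant (leq_trans (@absz_sum _ _ _)) //.
rewrite -card_Sn -sum_nat_const; apply: leq_sum => s _.
rewrite abszMsign (big_morph absz abszM (erefl : absz 1 = 1%N)).
rewrite -[X in (_ <= _ ^ X)%N]card_ord -prod_nat_const.
exact: leq_prod.
Qed.

Lemma mulmx_entry_le m (A B : 'M[int]_m) (M N : nat) :
  (forall i j, (absz (A i j) <= M)%N) -> (forall i j, (absz (B i j) <= N)%N) ->
  forall i j, (absz ((A *m B)%R i j) <= m * M * N)%N.
Proof.
move=> AM BN i j; rewrite mxE (leq_trans (@absz_sum _ _ _)) //.
rewrite -mulnA -[X in (X * _)%N]card_ord -sum_nat_const; apply: leq_sum => k _.
by rewrite abszM leq_mul.
Qed.

(** Both the degree and the length of [Q] grow in the application, hence the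
    explicit dependence on them. *)
Definition liouville_bound (d c : nat) : Prop :=
  forall (Q : {poly int}) (e B : nat),
    (size Q <= e.+1)%N -> (\sum_(k < e.+1) absz (Q`_k)%R <= B)%N ->
    (0 < B)%N -> (pint Q).[a] != 0 ->
    1 <= `|(pint Q).[a]| * ((c ^ e.+1 * B) ^ d)%:R.

(** Let [g] be a minimal integer polynomial with root [a]. Multiplication by
    [a] is, up to the leading coefficient of [g], the companion matrix [K] of
    [g], so the value of [Q] at [a] is an eigenvalue of the integer matrix [N]
    obtained from [Q] and [K]. The minimality of [g] makes [N] nonsingular; then
    [\det N] is a nonzero integer, and the adjugate of [N], whose entries are at
    most [n`! * (c ^ e * B) ^ n], writes it as a multiple of the value. *)
Lemma liouville f : f != 0 -> root (pint f) a -> `|a| <= 1 ->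
  exists d c : nat, (0 < c)%N /\ liouville_bound d c.
Proof.
move=> f0 fa a1; have {f f0 fa} [g [g0 ga] gmin] := minimal_annihilator f0 fa.
have size_pint (p : {poly int}) : size (pint p) = size p.
  by rewrite size_map_inj_poly ?rmorph0 //; exact: intr_inj.
have coef_pint (p : {poly int}) i : (pint p)`_i = (p`_i)%:~R.
  by rewrite coef_map.
have [n sg] : exists n, size g = n.+2.
  have := root_size_gt1 _ ga; rewrite -size_poly_eq0 size_pint size_poly_eq0 => /(_ g0).
  by case: (size g) => [|[|n]] // _; exists n.
pose lc := g`_n.+1.
have lc0 : lc != 0 by have := g0; rewrite -lead_coef_eq0 lead_coefE sg.
pose K : 'M[int]_n.+1 := \matrix_(i, j)
  if i == n :> nat then - g`_j else if j == i.+1 :> nat then lc else 0.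
pose v : 'cV[F]_n.+1 := \col_i a ^+ i.
pose toF (A : 'M[int]_n.+1) : 'M[F]_n.+1 := map_mx intr A.
have Kv : toF K *m v = (lc%:~R * a) *: v.
  apply/colP => i; rewrite !mxE.
  have [i_n|i_n] := eqVneq (i : nat) n.
    under eq_bigr do rewrite !mxE i_n eqxx rmorphN mulNr.
    rewrite sumrN i_n -mulrA -exprS; apply/eqP; rewrite eqr_oppLR -addr_eq0.
    move: ga; rewrite rootE horner_coef size_pint sg big_ord_recr /= coef_pint.
    by under eq_bigr do rewrite coef_pint.
  have i1 : (i.+1 < n.+1)%N by have := ltn_ord i; lia.
  rewrite (bigD1 (Ordinal i1)) //= !mxE (negPf i_n) /= eqxx exprS mulrA.
  rewrite big1 ?addr0 // => j /negPf ji; rewrite !mxE (negPf i_n).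
  by rewrite -val_eqE /= in ji; rewrite ji mul0r.
pose kap := (1 + \sum_(i < n.+2) absz (g`_i)%R)%N.
have g_kap i : (i < n.+2)%N -> (absz (g`_i)%R <= kap)%N.
  move=> i_n; rewrite /kap (bigD1 (Ordinal i_n)) //=; lia.
have K_kap i j : (absz (K i j) <= kap)%N.
  rewrite mxE; case: ifP => _; first by rewrite abszN g_kap // ltnW // ltnS.
  by case: ifP => _ //; rewrite g_kap.
pose c := ((n.+1 * kap) + n`! * n.+1)%N.
have c0 : (0 < c)%N by rewrite /c /kap mulSn; lia.
have cK k : forall i j, (absz ((K ^+ k)%R i j) <= c ^ k)%N.
  elim: k => [|k IHk] i j.
    by rewrite expr0 mxE; case: eqP.
  rewrite exprS -[_ * _]/(K *m _) expnS.
  apply: leq_trans (mulmx_entry_le K_kap IHk i j) _.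
  by rewrite leq_mul // leq_addr.
exists n.+1, c; split=> [|Q e B sQ QB B0 Qa]; first exact: c0.
pose N : 'M[int]_n.+1 := \sum_(k < e.+1) (Q`_k * lc ^+ (e - k)) *: K ^+ k.
have Nv : toF N *m v = (lc%:~R ^+ e * (pint Q).[a]) *: v.
  have Kkv k : toF (K ^+ k) *m v = (lc%:~R * a) ^+ k *: v.
    elim: k => [|k IHk]; first by rewrite /toF map_mx1 mul1mx scale1r.
    rewrite exprSr -[_ * _]/(_ *m K) /toF map_mxM -mulmxA -/(toF K) Kv.
    by rewrite -scalemxAr IHk scalerA -exprS.
  rewrite /toF map_mx_sum mulmx_suml (@horner_coef_wide _ e.+1) ?size_pint //.
  rewrite mulr_sumr scaler_suml; apply: eq_bigr => k _.
  rewrite map_mxZ -scalemxAl -/(toF _) Kkv scalerA coef_pint; congr (_ *: _).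
  rewrite rmorphM rmorphXn /= exprMn.
  have <- : lc%:~R ^+ (e - k) * lc%:~R ^+ k = lc%:~R ^+ e :> F.
    by rewrite -exprD subnK // -ltnS.
  ring.
have detN : \det N != 0.
  apply/negP => /det0P[u u0 uN].
  pose U : {poly int} := \poly_(i < n.+1) u 0 (inord i).
  have Ua : (pint U).[a] = (map_mx intr u *m v) 0 0.
    rewrite (@horner_coef_wide _ n.+1) ?size_pint ?size_poly // !mxE.
    by apply: eq_bigr => i _; rewrite coef_pint coef_poly ltn_ord !mxE inord_val.
  have U0 : U = 0.
    apply: gmin; first by rewrite sg ltnS size_poly.
    have := congr1 (fun w => (w *m v) 0 0) (congr1 (map_mx (intr : int -> F)) uN).
    rewrite map_mxM /= -mulmxA -/(toF N) Nv -scalemxAr mxE -Ua map_mx0 mul0mx mxE.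
    move=> /eqP; rewrite rootE !mulf_eq0 expf_eq0 (negPf Qa) intr_eq0 (negPf lc0).
    by rewrite andbF.
  case/eqP: u0; apply/rowP => i; rewrite mxE.
  by have := congr1 (fun p : {poly int} => p`_i) U0; rewrite coef_poly ltn_ord inord_val coef0.
have N_le i j : (absz (N i j) <= c ^ e * B)%N.
  rewrite /N summxE (leq_trans (@absz_sum _ _ _)) //.
  rewrite (leq_trans _ (leq_mul (leqnn (c ^ e)) QB)) // big_distrr /=.
  apply: leq_sum => k _; rewrite mxE !abszM -mulnA mulnC leq_mul //.
  have <- : (c ^ (e - k) * c ^ k = c ^ e)%N by rewrite -expnD subnK // -ltnS.
  rewrite leq_mul // abszX; case: (e - k)%N => // i'; rewrite leq_exp2r //.
  by rewrite (leq_trans (g_kap _ _)) // /c mulSn -addnA leq_addr.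
have adjN i j : (absz ((\adj N) i j) <= n`! * (c ^ e * B) ^ n)%N.
  rewrite mxE /cofactor abszMsign; apply: det_entry_le => i' j'; rewrite !mxE.
  exact: N_le.
have key : (\det N)%:~R = lc%:~R ^+ e * (pint Q).[a] * \sum_j ((\adj N) ord0 j)%:~R * a ^+ j.
  have := congr1 (fun A => ((map_mx (intr : int -> F) A) *m v) ord0 ord0) (mul_adj_mx N).
  rewrite map_mxM -mulmxA -/(toF N) Nv -scalemxAr mxE.
  rewrite map_scalar_mx mul_scalar_mx !mxE expr0 mulr1 => <-.
  by congr (_ * _); apply: eq_bigr => j _; rewrite !mxE.
have := int_norm_ge1 detN; rewrite key !normrM normrX => /le_trans; apply.
set s := \sum_j _.
rewrite mulrAC mulrC ler_wpM2l //.
have s_le : `|s| <= (n.+1 * (n`! * (c ^ e * B) ^ n))%:R.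
  rewrite (le_trans (ler_norm_sum _ _ _)) //.
  rewrite -[X in (X * _)%N]card_ord -sum_nat_const natr_sum; apply: ler_sum => j _.
  rewrite normrM -intr_norm -pmulrn -[leRHS]mulr1 ler_pM //; last first.
    by rewrite normrX exprn_ile1.
  by rewrite ler_nat adjN.
have lc_le : `|lc%:~R : F| ^+ e <= (c ^ e)%:R.
  rewrite natrX lerXn2r ?nnegrE // -intr_norm -pmulrn ler_nat.
  by rewrite (leq_trans (g_kap _ _)) // /c mulSn -addnA leq_addr.
rewrite (le_trans (ler_pM _ _ lc_le s_le)) ?exprn_ge0 // -natrM ler_nat.
have fc : (n`! * n.+1 <= c)%N by rewrite /c leq_addl.
set M := (c ^ e * B)%N.
have -> : (c ^ e * (n.+1 * (n`! * M ^ n)) = (n`! * n.+1) * (c ^ e * M ^ n))%N by ring.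
rewrite (expnS c e) -(mulnA c) (expnMn c) -/M.
rewrite leq_mul //.
  by rewrite (leq_trans fc) // expnS leq_pmulr // expn_gt0 c0.
by rewrite [leqRHS]expnS leq_mul // leq_pmulr.
Qed.
End Liouville.

(** * A zero estimate for exponential polynomials *)
Section ZeroEstimate.
Variables (F : numFieldType) (a : F) (k n J L R S : nat) (P : 'I_L -> {poly F}).
Hypothesis a_neq0 : a != 0.
Hypothesis a_inj : forall i j, a ^+ i = a ^+ j -> i = j.
Hypothesis size_P : forall l, (size (P l) <= J)%N.
Hypothesis point_inj : forall r r' s s', (r < R)%N -> (r' < R)%N ->
  (s < S)%N -> (s' < S)%N ->
  (r * k + s * n = r' * k + s' * n)%N -> r = r' /\ s = s'.
Hypothesis vanish : forall r s, (r < R)%N -> (s < S)%N ->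
  \sum_l (P l).[(r * k + s * n)%:R] * a ^+ (l * r) = 0.

Let I := [set l | P l != 0].
Let m := #|I|.
Let e (t : 'I_m) : 'I_L := enum_val t.
(** Shifting [r] by [i] gives one equation for each [i]. The determinant of this
    system, as a polynomial in [x], has leading coefficient a Vandermonde
    determinant in the powers of [a], which is nonzero, while it vanishes at
    each grid point with [r + i < R]; there are more of these than its degree. *)
Let entry (i t : 'I_m) : {poly F} :=
  a ^+ (e t * i) *: (P (e t) \Po ('X + ((i * k)%:R)%:P)).
Let A : 'M[{poly F}]_m := \matrix_(i, t) entry i t.

Let Pe t : P (e t) != 0.
Proof. by have := enum_valP t; rewrite inE. Qed.

Let size_entry i t : size (entry i t) = size (P (e t)).
Proof.
rewrite /entry size_scale ?expf_neq0 // size_comp_poly2 //.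
by rewrite size_XaddC.
Qed.

Let lead_entry i t :
  lead_coef (entry i t) = a ^+ (e t * i) * lead_coef (P (e t)).
Proof.
by rewrite /entry lead_coefZ lead_coef_comp ?size_XaddC // lead_coefXaddC expr1n mulr1.
Qed.

Let D := (\sum_t size (P (e t)))%N.

Let size_term (s : 'S_m) : size (\prod_i entry i (s i)) = (D.+1 - m)%N.
Proof.
rewrite size_prod => [|i _]; last first.
  by rewrite -size_poly_gt0 size_entry size_poly_gt0.
rewrite /= cardT size_enum_ord; congr (_.+1 - _)%N.
under eq_bigr do rewrite size_entry.
by rewrite /D [RHS](reindex_inj (@perm_inj _ s)).
Qed.

Let mD : (m <= D)%N.
Proof.
rewrite -[m]card_ord -sum1_card; apply: leq_sum => t _.
by rewrite size_poly_gt0.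
Qed.

Let det_term (s : 'S_m) : \prod_i A i (s i) = \prod_i entry i (s i).
Proof. by apply: eq_bigr => i _; rewrite mxE. Qed.

Let size_det : (size (\det A) <= D.+1 - m)%N.
Proof.
rewrite /determinant (leq_trans (size_sum _ _ _)) //.
apply/bigmax_leqP => s _.
by rewrite mulr_sign det_term; case: ifP => _; rewrite ?size_polyN size_term.
Qed.

Let coef_det : (\det A)`_(D - m) != 0.
Proof.
have -> : (\det A)`_(D - m) =
  \det (Vandermonde m (\row_t a ^+ e t)) * (\prod_t lead_coef (P (e t))).
  rewrite /determinant coef_sum mulr_suml; apply: eq_bigr => s _.
  have cE : (\prod_i entry i (s i))`_(D - m) =
     \prod_i (Vandermonde m (\row_t a ^+ e t) i (s i)) *
        \prod_t lead_coef (P (e t)).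
    have := lead_coefE (\prod_i entry i (s i)); rewrite size_term subSn //=.
    move=> <-; rewrite lead_coef_prod.
    under eq_bigr do rewrite lead_entry.
    rewrite big_split /=; congr (_ * _).
      by apply: eq_bigr => i _; rewrite !mxE exprM.
    by rewrite [RHS](reindex_inj (@perm_inj _ s)).
  by rewrite det_term !mulr_sign; case: ifP => _; rewrite ?coefN cE ?mulNr.
rewrite mulf_neq0 //; last by apply/prodf_neq0 => t _; rewrite lead_coef_eq0.
rewrite det_Vandermonde; apply/prodf_neq0 => i _; apply/prodf_neq0 => j ij.
rewrite !mxE subr_eq0; apply/eqP => /a_inj/val_inj/enum_val_inj ji.
by rewrite ji ltnn in ij.
Qed.

Lemma zero_estimate : (L <= R)%N -> (L * J <= (R - L) * S)%N ->
  forall l, P l = 0.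
Proof.
move=> LR LJ l0; apply/eqP/negPn/negP => Pl0.
have m_gt0 : (0 < m)%N by apply/card_gt0P; exists l0; rewrite inE.
have mL : (m <= L)%N by rewrite -[L]card_ord max_card.
pose xs := [seq ((rs.1 * k + rs.2 * n)%:R : F)
   | rs <- [seq (r, s) | r <- iota 0 (R - L), s <- iota 0 S]].
have lt_iota r M : (r \in iota 0 M) = (r < M)%N by rewrite mem_iota.
have uxs : uniq xs.
  rewrite map_inj_in_uniq; last first.
    move=> _ _ /allpairsP[[r s] [/= rR sS ->]] /allpairsP[[r' s'] [/= rR' sS' ->]] /=.
    rewrite !lt_iota in rR sS rR' sS'.
    move=> /eqP; rewrite eqr_nat => /eqP/point_inj[] //.
    - exact: leq_trans rR (leq_subr _ _).
    - exact: leq_trans rR' (leq_subr _ _).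
    - by move=> -> ->.
  by rewrite allpairs_uniq ?iota_uniq // => -[? ?] [? ?] _ _ /= [-> ->].
have size_xs : size xs = ((R - L) * S)%N by rewrite size_map size_allpairs !size_iota.
have detA : \det A != 0 by apply: contraNneq coef_det => ->; rewrite coef0.
have roots : all (root (\det A)) xs.
  apply/allP => _ /mapP[_ /allpairsP[[r s] [/= rR sS ->]] ->] /=.
  rewrite !lt_iota in rR sS.
  rewrite rootE -/(horner_eval _ _) -det_map_mx -det_tr; apply/det0P.
  exists (\row_t a ^+ (e t * r)).
    apply/eqP => /rowP/(_ (Ordinal m_gt0)); rewrite !mxE => /eqP.
    by rewrite (negPf (expf_neq0 _ a_neq0)).
  apply/rowP => i; rewrite !mxE.
  have rR' : (r + i < R)%N.
    by have := ltn_ord i; move: rR; rewrite ltn_subRL => h1 h2; lia.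
  rewrite -[RHS](vanish rR' sS) [RHS](bigID (mem I)) /= [X in _ = _ + X]big1 ?addr0; last first.
    by move=> l; rewrite inE negbK => /eqP ->; rewrite horner0 mul0r.
  rewrite [RHS]big_enum_val /=; apply: eq_bigr => t _; rewrite !mxE /entry.
  rewrite /horner_eval hornerZ horner_comp hornerD hornerX hornerC -natrD -/(e t).
  rewrite mulrA -exprD -mulnDr mulrC; congr (_.[_ %:R] * _).
  by rewrite mulnDl addnAC.
have := max_poly_roots detA roots uxs; rewrite size_xs => lt1.
have := leq_trans (leq_trans lt1 size_det) _ => /(_ (L * J)%N).
suff /[swap]/[apply] : (D.+1 - m <= L * J)%N by rewrite ltnNge LJ.
have Dle : (D <= m * J)%N.
  rewrite -[X in (X * _)%N]card_ord -sum_nat_const.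
  exact: leq_sum.
have := leq_mul mL (leqnn J); lia.
Qed.
End ZeroEstimate.

From mathcomp Require Import all_classical all_reals all_analysis.
From mathcomp Require Import measurable_realfun.

Import numFieldNormedType.Exports.

Local Open Scope classical_set_scope.
Local Open Scope ring_scope.
Local Open Scope complex_scope.

(** * Moduli and points of the unit circle *)
Section ComplexModulus.
Variable R : realType.
Implicit Types (x y z : R[i]) (s t : R).

Definition nc z : R := Normc.normc z.
Arguments nc : simpl never.

Lemma nc_ge0 z : 0 <= nc z.
Proof. by case: z => a b; rewrite /nc /= sqrtr_ge0. Qed.

Lemma nc0 : nc 0 = 0. Proof. exact: Normc.normc0. Qed.
Lemma nc1 : nc 1 = 1. Proof. exact: Normc.normc1. Qed.

Lemma nc_eq0 z : (nc z == 0) = (z == 0).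
Proof. by apply/eqP/eqP => [/Normc.eq0_normc //|->]; exact: nc0. Qed.

Lemma nc_gt0 z : (0 < nc z) = (z != 0).
Proof. by rewrite lt_def nc_ge0 andbT nc_eq0. Qed.

Lemma ncM y z : nc (y * z) = nc y * nc z. Proof. exact: Normc.normcM. Qed.
Lemma ncV z : nc z^-1 = (nc z)^-1. Proof. exact: Normc.normcV. Qed.
Lemma ncN z : nc (- z) = nc z. Proof. exact: normcN. Qed.
Lemma ncD y z : nc (y + z) <= nc y + nc z. Proof. exact: le_normcD. Qed.
Lemma ncBC y z : nc (y - z) = nc (z - y). Proof. by rewrite -ncN opprB. Qed.
Lemma ncB y z : nc (y - z) <= nc y + nc z.
Proof. by rewrite -[nc z]ncN ncD. Qed.

Lemma ncB_ge y z : nc y - nc z <= nc (y - z).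
Proof. by rewrite lerBlDr (le_trans _ (ncD _ _)) // subrK. Qed.

Lemma ncX z n : nc (z ^+ n) = nc z ^+ n.
Proof. by elim: n => [|n IHn]; rewrite ?nc1 // !exprS ncM IHn. Qed.

Lemma nc_prod I (r : seq I) (P : pred I) (F : I -> R[i]) :
  nc (\prod_(i <- r | P i) F i) = \prod_(i <- r | P i) nc (F i).
Proof. exact: (big_morph nc ncM nc1). Qed.

Lemma nc_sum I (r : seq I) (P : pred I) (F : I -> R[i]) :
  nc (\sum_(i <- r | P i) F i) <= \sum_(i <- r | P i) nc (F i).
Proof.
elim/big_rec2: _ => [|i y x _ le_xy]; first by rewrite nc0.
by rewrite (le_trans (ncD _ _)) // lerD2l.
Qed.

Lemma nc_real t : nc t%:C = `|t|.
Proof. by rewrite /nc /= expr0n addr0 sqrtr_sqr. Qed.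

Lemma nc_int (n : int) : nc n%:~R = `|n%:~R|.
Proof. by rewrite -(rmorph_int (real_complex R)) nc_real. Qed.

Lemma nc_nat (n : nat) : nc n%:R = n%:R.
Proof. by rewrite -(rmorph_nat (real_complex R)) nc_real ger0_norm. Qed.

Lemma nc_ReIm z : nc z <= `|complex.Re z| + `|complex.Im z|.
Proof.
case: z => a b /=; have -> : (a +i* b) = a%:C + b%:C * 'i.
  by rewrite /=; simpc.
have nci : nc 'i = 1 by rewrite /nc /= expr0n expr1n add0r sqrtr1.
by rewrite (le_trans (ncD _ _)) // ncM !nc_real nci mulr1.
Qed.

Definition cis t : R[i] := Complex (cos t) (sin t).

Lemma cis0 : cis 0 = 1. Proof. by rewrite /cis cos0 sin0. Qed.

Lemma nc_cis t : nc (cis t) = 1.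
Proof. by rewrite /nc /= cos2Dsin2 sqrtr1. Qed.

Lemma cis_neq0 t : cis t != 0. Proof. by rewrite -nc_gt0 nc_cis ltr01. Qed.

Lemma cisD s t : cis (s + t) = cis s * cis t.
Proof. by rewrite /cis cosD sinD; simpc; congr Complex; rewrite addrC. Qed.

Lemma cisX t n : cis t ^+ n = cis (n%:R * t).
Proof.
elim: n => [|n IHn]; first by rewrite mul0r cis0.
by rewrite exprS IHn -cisD -natr1 mulrDl mul1r addrC.
Qed.

Lemma cis2pi : cis (2 * pi) = 1.
Proof. by rewrite mulr_natl /cis cos2pi sin2pi. Qed.

Lemma cis_unit z : nc z = 1 -> exists2 t, 0 <= t <= 2 * pi & z = cis t.
Proof.
case: z => a b /= /(congr1 (fun u => u ^+ 2)); rewrite /nc /= expr1n.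
rewrite sqr_sqrtr ?addr_ge0 ?sqr_ge0 // => ab1.
have a1 : -1 <= a <= 1.
  by rewrite -ler_norml -(@ler_pXn2r _ 2) ?nnegrE ?expr1n //
     real_normK ?num_real // -ab1 lerDl sqr_ge0.
have [/andP[p0 p1] ca] := acos_def a1.
have sE : sin (acos a) ^+ 2 = b ^+ 2 by rewrite sin2cos2 ca -ab1 addrC addKr.
move: sE => /eqP; rewrite eqf_sqr => /orP[] /eqP sb.
  by exists (acos a); rewrite /cis ?ca ?sb // p0 (le_trans p1) // ler_peMl ?pi_ge0 ?ler1n.
exists (2 * pi - acos a).
  rewrite subr_ge0 lerBlDr lerDl p0 andbT (le_trans p1) //.
  by rewrite ler_peMl ?pi_ge0 ?ler1n.
rewrite cisD cis2pi mul1r /cis cosN sinN ca sb opprK //.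
Qed.

End ComplexModulus.
Arguments nc {R} z : simpl never.
Arguments cis {R} t : simpl never.

(** * Auxiliary functions with small integer coefficients *)
Section Pigeonhole.
Variables (R : realType) (I T : finType).

(** Cut the ranges of the [#|T|] linear forms into [g] cells each. Two of the
    [H ^ #|I|] vectors with entries below [H] fall into the same cell, and
    their difference makes all forms small. *)
Lemma small_integer_forms (H g : nat) (B : R) (phi : T -> I -> R) :
  0 < B -> (0 < g)%N -> (g ^ #|T| < H ^ #|I|)%N ->
  (forall t i, `|phi t i| <= B) ->
  exists p : I -> int, [/\ exists i, p i != 0, forall i, (absz (p i) < H)%N &
    forall t, `|\sum_i (p i)%:~R * phi t i| <= 2 * #|I|%:R * H%:R * B / g%:R].
Proof.
move=> B0 g0 gH phiB.
have [I0|I_gt0] := posnP #|I|.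
  by move: gH; rewrite I0 expn0 ltnNge expn_gt0 g0.
have H0 : (0 < H)%N by case: H gH => //; rewrite exp0n.
pose Y : R := #|I|%:R * H%:R * B.
have Y0 : 0 < Y by rewrite !mulr_gt0 // ltr0n.
pose value (x : {ffun I -> 'I_H}) t : R := \sum_i (x i)%:R * phi t i.
have value_lt x t : `|value x t| < Y.
  rewrite (le_lt_trans (ler_norm_sum _ _ _)) //.
  have [i0 _] : exists i, i \in I by apply/card_gt0P.
  have -> : Y = \sum_(i in I) H%:R * B by rewrite sumr_const /Y -mulrA mulr_natl.
  apply: ltr_sum => [|i _]; first by apply/hasP; exists i0; rewrite ?mem_index_enum.
  rewrite normrM normr_nat (le_lt_trans (ler_wpM2l _ (phiB t i))) //.
  by rewrite ltr_pM2r // ltr_nat.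
pose cell_r x t : R := (value x t + Y) * g%:R / (2 * Y).
have cell_ge0 x t : 0 <= cell_r x t.
  have vY : 0 <= value x t + Y by have := value_lt x t; rewrite ltr_norml; lra.
  by rewrite /cell_r divr_ge0 ?mulr_ge0 // ltW.
have cell_lt x t : (Num.truncn (cell_r x t) < g)%N.
  rewrite truncn_lt_nat // /cell_r ltr_pdivrMr ?(mulr_gt0 _ Y0) //.
  rewrite mulrC ltr_pM2l ?ltr0n //.
  by have := value_lt x t; rewrite ltr_norml; lra.
pose cell x : {ffun T -> 'I_g} := [ffun t => Ordinal (cell_lt x t)].
have /injectivePn[x [y] xy cxy] : ~~ injectiveb cell.
  apply/negP => /injectiveP/leq_card; rewrite !card_ffun !card_ord.
  by rewrite leqNgt gH.
exists (fun i => (x i)%:Z - (y i)%:Z); split.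
- have [i xyi] : exists i, x i != y i.
    by apply/existsP; rewrite -negb_forall; apply: contraNN xy => /forallP xy;
      apply/eqP/ffunP => i; apply/eqP.
  by exists i; rewrite subr_eq0 eqz_nat.
- by move=> i; have := ltn_ord (x i); have := ltn_ord (y i); lia.
move=> t.
have -> : \sum_i ((x i)%:Z - (y i)%:Z)%:~R * phi t i = value x t - value y t.
  by rewrite /value -sumrB; apply: eq_bigr => i _; rewrite rmorphB mulrBl.
have ctt : Num.truncn (cell_r x t) = Num.truncn (cell_r y t).
  by have /ffunP/(_ t) := cxy; rewrite !ffunE => -[].
have : `|cell_r x t - cell_r y t| <= 1.
  have /andP[x1 x2] := truncn_itv (cell_ge0 x t).
  have /andP[y1 y2] := truncn_itv (cell_ge0 y t).
  by rewrite ctt -natr1 in x1 x2; rewrite -natr1 in y2; rewrite ler_norml; lra.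
have -> : cell_r x t - cell_r y t = (value x t - value y t) * (g%:R / (2 * Y)).
  by rewrite /cell_r; ring.
have c0 : 0 < g%:R / (2 * Y) by rewrite divr_gt0 ?ltr0n // (mulr_gt0 _ Y0).
rewrite normrM (gtr0_norm c0) -ler_pdivlMr // => /le_trans; apply.
by rewrite invf_div mul1r /Y !mulrA.
Qed.

End Pigeonhole.

Section TrigTaylor.
Variable R : realType.
Implicit Types (t c u : R) (b : bool).

(** Sine and cosine are treated together, [b] selecting the cosine. *)
Definition trig b t : R := if b then cos t else sin t.
Definition trig_coeff b t (m : nat) : R :=
  if b then cos_coeff t m else sin_coeff t m.

Lemma trig_coeffM b c u m : trig_coeff b (c * u) m = trig_coeff b c m * u ^+ m.
Proof.
by case: b; rewrite /trig_coeff /cos_coeff /sin_coeff /= exprMn; ring.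
Qed.

Lemma trig_coeff_le b t m : `|trig_coeff b t m| <= `|t| ^+ m / m`!%:R.
Proof.
have tm0 : 0 <= `|t| ^+ m / m`!%:R by rewrite divr_ge0 ?exprn_ge0.
case: b; rewrite /trig_coeff /cos_coeff /sin_coeff /= !normrM normfV !normr_nat.
  rewrite !normrX normrN normr1 expr1n mulr1.
  by case: odd; rewrite ?mul0r ?mul1r.
rewrite !normrX normrN normr1 expr1n mulr1.
by case: odd; rewrite ?mul0r ?mul1r.
Qed.

Lemma expR_series_ge t N : 0 <= t -> \sum_(0 <= m < N) t ^+ m / m`!%:R <= expR t.
Proof.
move=> t0; rewrite /expR.
have nd : nondecreasing_seq (series (exp_coeff t)).
  apply/nondecreasing_seqP => n.
  by rewrite !seriesEnat /= big_nat_recr //= lerDl exp_coeff_ge0.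
exact: (nondecreasing_cvgn_le nd (is_cvg_series_exp_coeff t) N).
Qed.

(** The tail is bounded by that of the exponential series, where a factor
    [2 ^ M] is gained by evaluating at [2 * `|t|]. *)
Lemma trig_taylor b t M :
  `|trig b t - \sum_(0 <= m < M) trig_coeff b t m| <= expR (2 * `|t|) / 2 ^+ M.
Proof.
have cvgT : series (trig_coeff b t) @ \oo --> trig b t.
  case: b; rewrite /trig /trig_coeff ?cos.unlock ?sin.unlock.
    exact: is_cvg_series_cos_coeff.
  exact: is_cvg_series_sin_coeff.
have : (fun N => `|series (trig_coeff b t) N - series (trig_coeff b t) M|) @ \oo
    --> `|trig b t - series (trig_coeff b t) M|.
  by apply: cvg_norm; apply: cvgB => //; exact: cvg_cst.
move=> /cvgr_to_le; apply; exists M => // N /= MN.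
rewrite !seriesEnat /= (@big_cat_nat _ _ _ M) //= addrAC subrr add0r.
rewrite (le_trans (ler_norm_sum _ _ _)) //.
have : \sum_(M <= m < N) (2 * `|t|) ^+ m / m`!%:R <= expR (2 * `|t|).
  apply: le_trans (expR_series_ge N _) => //.
  by rewrite [leRHS](@big_cat_nat _ _ _ M) //= lerDr sumr_ge0.
move=> le1; rewrite ler_pdivlMr ?exprn_gt0 // (le_trans _ le1) //.
rewrite mulr_suml big_nat [leRHS]big_nat ler_sum // => m /andP[Mm _].
rewrite (le_trans (ler_wpM2r _ (trig_coeff_le _ _ _))) ?exprn_ge0 //.
rewrite exprMn mulrC mulrA ler_wpM2r ?invr_ge0 // ler_wpM2r ?exprn_ge0 //.
by rewrite ler_weXn2l // ler1n.
Qed.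

End TrigTaylor.

Section AuxiliaryFunction.
Variable R : realType.

Lemma expR_term_le (t : R) m : 0 <= t -> t ^+ m / m`!%:R <= expR t.
Proof.
move=> t0; apply: le_trans (expR_series_ge m.+1 t0).
rewrite big_nat_recr //= lerDr sumr_ge0 // => i _.
by rewrite divr_ge0 ?exprn_ge0.
Qed.

(** The first term of the last factor comes from the pigeonhole principle,
    the second one from truncating the Taylor series. *)
Definition aux_bound (n U J L Q0 H g : nat) : R :=
  (J * L * H)%:R * ((n * U) ^ J)%:R * expR (4 * pi * (L * U)%:R) *
  ((2 * Q0)%:R / g%:R + (2 ^+ (Q0 - J))^-1).

(** The Taylor coefficients of the functions [(n u) ^ j * trig (2 pi l u)] of
    order below [Q0] are linear forms in the coefficients [p]; making these
    forms small makes the combination small on the whole interval. *)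
Lemma aux_function (n U J L Q0 H g : nat) :
  (0 < n)%N -> (0 < U)%N -> (J <= Q0)%N -> (0 < g)%N ->
  (g ^ (Q0 * 2) < H ^ (J * L))%N ->
  exists p : 'I_J * 'I_L -> int,
    [/\ exists i, p i != 0, forall i, (absz (p i) < H)%N &
     forall b (u : R), 0 <= u <= U%:R ->
      `|\sum_i (p i)%:~R * ((n%:R * u) ^+ i.1 * trig b (2 * pi * i.2%:R * u))|
       <= aux_bound n U J L Q0 H g].
Proof.
move=> n0 U0 JQ g0 gH.
have pi0 : 0 <= pi :> R := pi_ge0 R.
have UR0 : 0 < U%:R :> R by rewrite ltr0n.
have nR0 : 0 < n%:R :> R by rewrite ltr0n.
pose E : R := expR (4 * pi * (L * U)%:R).
pose B : R := ((n * U) ^ J)%:R * E.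
pose phi (t : 'I_Q0 * bool) (i : 'I_J * 'I_L) : R :=
  if (i.1 <= t.1)%N then
    n%:R ^+ i.1 * trig_coeff t.2 (2 * pi * i.2%:R) (t.1 - i.1) * U%:R ^+ t.1
  else 0.
have nU_ge1 : 1 <= (n * U)%:R :> R by rewrite ler1n muln_gt0 n0.
have B0 : 0 < B by rewrite mulr_gt0 ?expR_gt0 // ltr0n expn_gt0 muln_gt0 n0 U0.
have arg_le (l : 'I_L) (u : R) : 0 <= u <= U%:R ->
    `|2 * pi * l%:R * u| <= 2 * pi * (L * U)%:R.
  move=> /andP[u0 uU]; rewrite ger0_norm ?mulr_ge0 // -!mulrA.
  rewrite ler_wpM2l // ler_wpM2l // natrM ler_pM // ler_nat.
  exact/ltnW.
have phiB t i : `|phi t i| <= B.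
  rewrite /phi; case: ifP => [it|_]; last by rewrite normr0 ltW.
  have -> : U%:R ^+ t.1 = U%:R ^+ (t.1 - i.1) * U%:R ^+ i.1 :> R.
    by rewrite -exprD subnK.
  set tc := trig_coeff _ _ _.
  have -> : n%:R ^+ i.1 * tc * (U%:R ^+ (t.1 - i.1) * U%:R ^+ i.1)
      = (n * U)%:R ^+ i.1 * (tc * U%:R ^+ (t.1 - i.1)) by rewrite natrM exprMn; ring.
  rewrite normrM ger0_norm ?exprn_ge0 // /B natrX.
  apply: ler_pM; rewrite ?exprn_ge0 //; first by rewrite ler_weXn2l // ltnW.
  rewrite -trig_coeffM (le_trans (trig_coeff_le _ _ _)) //.
  rewrite (le_trans (expR_term_le _ _)) // ler_expR.
  have UU : 0 <= (U%:R : R) <= U%:R by rewrite ler0n lexx.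
  rewrite (le_trans (arg_le _ _ UU)) //.
  by rewrite ler_wpM2r // ler_wpM2r // ler_nat.
have [|p [p0 pH pphi]] := @small_integer_forms R _ _ H g B phi B0 g0 _ phiB.
  by rewrite !card_prod !card_ord card_bool.
exists p; split=> // b u /andP[u0 uU].
have expand (i : 'I_J * 'I_L) :
    (n%:R * u) ^+ i.1 * \sum_(0 <= m < Q0 - i.1) trig_coeff b (2 * pi * i.2%:R * u) m
    = \sum_(q < Q0) (u / U%:R) ^+ q * phi (q, b) i.
  pose G q := (u / U%:R) ^+ q * (if (i.1 <= q)%N then
    n%:R ^+ i.1 * trig_coeff b (2 * pi * i.2%:R) (q - i.1) * U%:R ^+ q else 0).
  rewrite -[RHS](big_mkord xpredT G).
  have iQ : (i.1 <= Q0)%N by rewrite (leq_trans _ JQ) // ltnW.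
  rewrite [RHS](@big_cat_nat _ _ _ i.1) //= [X in _ = X + _]big_nat.
  rewrite [X in _ = X + _]big1 ?add0r => [|q /andP[_ qi]]; last first.
    by rewrite /G leqNgt qi mulr0.
  rewrite -[X in \sum_(X <= _ < Q0) G _]add0n big_addn mulr_sumr; apply: eq_bigr => m _.
  rewrite /G leq_addl addnK trig_coeffM !exprMn exprVn.
  have U1 : U%:R ^+ (m + i.1) != 0 :> R by rewrite expf_neq0 // gt_eqF.
  by rewrite (exprD u); move: U1; set V := U%:R ^+ _ => U1; field.
pose err (i : 'I_J * 'I_L) := trig b (2 * pi * i.2%:R * u) -
  \sum_(0 <= m < Q0 - i.1) trig_coeff b (2 * pi * i.2%:R * u) m.
have -> : \sum_i (p i)%:~R * ((n%:R * u) ^+ i.1 * trig b (2 * pi * i.2%:R * u)) =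
   \sum_(q < Q0) (u / U%:R) ^+ q * (\sum_i (p i)%:~R * phi (q, b) i) +
   \sum_i (p i)%:~R * ((n%:R * u) ^+ i.1 * err i).
  under [X in X + _]eq_bigr do rewrite mulr_sumr.
  rewrite exchange_big -big_split /=; apply: eq_bigr => i _.
  under eq_bigr do rewrite mulrCA.
  by rewrite -mulr_sumr -expand /err; ring.
rewrite (le_trans (ler_normD _ _)) // /aux_bound mulrDr lerD //.
  rewrite (le_trans (ler_norm_sum _ _ _)) //.
  have -> : (J * L * H)%:R * ((n * U) ^ J)%:R * expR (4 * pi * (L * U)%:R) *
     ((2 * Q0)%:R / g%:R) = \sum_(q < Q0) 2 * (J * L)%:R * H%:R * B / g%:R.
    rewrite sumr_const card_ord -mulr_natl /B /E !natrM.
    have gR : g%:R != 0 :> R by rewrite pnatr_eq0 -lt0n.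
    by field.
  apply: ler_sum => q _; rewrite normrM.
  have := pphi (q, b); rewrite card_prod !card_ord => h.
  rewrite (le_trans _ h) // ler_piMl // normrX exprn_ile1 //.
  rewrite ger0_norm ?divr_ge0 // ?ler_pdivrMr ?mul1r //.
rewrite (le_trans (ler_norm_sum _ _ _)) //.
have -> : (J * L * H)%:R * ((n * U) ^ J)%:R * expR (4 * pi * (L * U)%:R) *
     (2 ^+ (Q0 - J))^-1 =
     \sum_(i : 'I_J * 'I_L) H%:R * (((n * U) ^ J)%:R * (E / 2 ^+ (Q0 - J))).
  by rewrite sumr_const card_prod !card_ord -mulr_natl /E !natrM; ring.
apply: ler_sum => i _; rewrite normrM ler_pM //.
  by rewrite -intr_norm -pmulrn ler_nat ltnW.
rewrite normrM ler_pM //.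
  rewrite normrX ger0_norm ?mulr_ge0 // natrX.
  apply: (@le_trans _ _ ((n * U)%:R ^+ i.1)).
    by rewrite natrM lerXn2r ?nnegrE ?mulr_ge0 // ler_wpM2l.
  by rewrite ler_weXn2l // ltnW.
rewrite (le_trans (trig_taylor _ _ _)) // ler_pM ?expR_ge0 ?invr_ge0 ?exprn_ge0 //.
  have := arg_le i.2 u; rewrite u0 uU ler_expR => /(_ isT); lra.
rewrite lef_pV2 ?posrE ?exprn_gt0 // ler_weXn2l ?ler1n //.
by rewrite leq_sub2l // ltnW.
Qed.

End AuxiliaryFunction.

(** * Algebraic numbers close to roots of unity *)
Lemma grid_inj k n u u' v v' : coprime k n -> (u <= u')%N -> (u' < n)%N ->
  (u * k + v * n = u' * k + v' * n)%N -> u = u'.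
Proof.
move=> copkn uu u'n uv.
have : (n %| (u' - u) * k)%N.
  have : (n %| (u' - u) * k + v' * n)%N.
    suff -> : ((u' - u) * k + v' * n = v * n)%N by rewrite dvdn_mull.
    by have := leq_mul uu (leqnn k); rewrite mulnBl; lia.
  by rewrite dvdn_addl // dvdn_mull.
rewrite Gauss_dvdl 1?coprime_sym // => /dvdn_leq; lia.
Qed.

Section ApproximationByRootsOfUnity.
Variable R : realType.
Implicit Types (a w x : R[i]).

Lemma norm_nc a : `|a| = (nc a)%:C.
Proof. by rewrite normc_def; case: a. Qed.

(** Powers are Lipschitz on the unit circle, with the exponent as constant. *)
Lemma expB_nc_le a w m : nc a = 1 -> nc w = 1 ->
  nc (a ^+ m - w ^+ m) <= m%:R * nc (a - w).
Proof.
move=> a1 w1; rewrite subrXX ncM mulrC ler_wpM2r ?nc_ge0 //.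
rewrite (le_trans (nc_sum _ _ _)) //.
under eq_bigr do rewrite ncM !ncX a1 w1 !expr1n mulr1.
by rewrite sumr_const card_ord.
Qed.

Section Evaluation.
Variables (J L : nat) (p : 'I_J * 'I_L -> int).

(** The polynomial whose value at [exp (2 i pi k / n)] is the value of the
    auxiliary function at [X / n], when [X = r * k + s * n]. *)
Definition grid_poly (X r : nat) : {poly int} :=
  \sum_i (p i * X%:Z ^+ i.1) *: 'X^(i.2 * r).

Lemma horner_grid_poly X r x :
  (pint _ (grid_poly X r)).[x] =
  \sum_i (p i)%:~R * (X%:R ^+ i.1 * x ^+ (i.2 * r)).
Proof.
rewrite /pint rmorph_sum horner_sum; apply: eq_bigr => i _.
rewrite /= map_polyZ hornerZ map_polyXn hornerXn rmorphM rmorphXn /=.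
by rewrite -pmulrn mulrA.
Qed.

Lemma size_grid_poly X r Rm : (r <= Rm)%N -> (size (grid_poly X r) <= (L * Rm).+1)%N.
Proof.
move=> rR; rewrite (leq_trans (size_sum _ _ _)) //; apply/bigmax_leqP => i _.
rewrite (leq_trans (size_scale_leq _ _)) // size_polyXn ltnS.
by rewrite leq_mul // ltnW.
Qed.

Lemma l1norm_grid_poly X r e H M : (0 < M)%N -> (X <= M)%N ->
  (forall i, (absz (p i) < H)%N) ->
  (\sum_(k < e) absz ((grid_poly X r)`_k)%R <= J * L * H * M ^ J)%N.
Proof.
move=> M0 XM pH.
have -> : (J * L * H * M ^ J = \sum_(i : 'I_J * 'I_L) H * M ^ J)%N.
  by rewrite sum_nat_const card_prod !card_ord; ring.
apply: (@leq_trans (\sum_(k < e) \sum_i absz (((p i * X%:Z ^+ i.1) *: 'X^(i.2 * r) : {poly int})`_k)%R)%N).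
  by apply: leq_sum => k _; rewrite coef_sum absz_sum.
rewrite exchange_big; apply: leq_sum => i _ /=.
apply: (@leq_trans (absz (p i * X%:Z ^+ i.1)%R)).
  have [ie|ie] := ltnP (i.2 * r) e; last first.
    rewrite big1 // => k _; rewrite coefZ coefXn.
    have /negPf-> : (k : nat) != (i.2 * r)%N by rewrite neq_ltn (leq_trans _ ie).
    by rewrite mulr0.
  rewrite (bigD1 (Ordinal ie)) //= coefZ coefXn eqxx mulr1 big1 ?addn0 //.
  move=> k /negPf; rewrite -val_eqE /= => kN.
  by rewrite coefZ coefXn kN mulr0.
rewrite abszM abszX absz_nat; apply: leq_mul; first exact: ltnW.
apply: (@leq_trans (M ^ i.1)%N); last by rewrite leq_pexp2l // ltnW.
by case: (i.1 : nat) => // m; rewrite leq_exp2r.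
Qed.
End Evaluation.

(** Let [h] be such that all the quantities below are at most [2 ^ h]. If [a]
    were within [2 ^ - (h * (4 d + 6))] of the root of unity [w], the auxiliary
    function would have values at most [2 ^ - (h * (4 d + 2))], up to a constant,
    at the grid points; its values with [w] replaced by [a] would then be below
    the bound of Liouville, which is [2 ^ - (4 d h)], and hence zero. The zero
    estimate makes all coefficients vanish. *)
Lemma root_of_unity_far (a : R[i]) (d c n k L Rm S J h : nat) :
  nc a = 1 -> (forall i j, a ^+ i = a ^+ j -> i = j) ->
  (0 < c)%N ->
  liouville_bound a d c ->
  (0 < h)%N -> (0 < L)%N -> (0 < J)%N ->
  (k <= n)%N -> coprime k n -> (L <= Rm <= n)%N ->
  (L * J <= (Rm - L) * S)%N ->
  (c ^ (L * Rm).+1 <= 2 ^ h)%N -> (J * L <= 2 ^ h)%N -> (L * Rm <= 2 ^ h)%N ->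
  ((n * (Rm + S)) ^ J <= 2 ^ h)%N ->
  expR (4 * pi * (L * (Rm + S))%:R) <= 2 ^+ h :> R ->
  (4 * (h * (4 * d + 8)) <= 2 ^ h)%N -> (J <= h)%N ->
  (2 * h * (4 * d + 7) * (4 * d + 8) < J * L)%N ->
  (2 ^+ (h * (4 * d + 6)))^-1 < nc (a - cis (2 * pi * k%:R / n%:R)).
Proof.
move=> a1 ainj c0 liou h0 L0 J0 kn copkn /andP[LR Rn] LJ cH JLH LRH nUH eH QH Jh gH.
rewrite ltNge; apply/negP => close.
pose U := (Rm + S)%N.
pose Q0 := (h * (4 * d + 8))%N.
pose H := (2 ^ h)%N.
pose g := (2 ^ (h * (4 * d + 7)))%N.
set w := cis _ in close.
have w1 : nc w = 1 by rewrite nc_cis.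
have n0 : (0 < n)%N by rewrite (leq_trans _ Rn) // (leq_trans _ LR).
have R0 : (0 < Rm)%N by rewrite (leq_trans L0).
have U0 : (0 < U)%N by rewrite addn_gt0 R0.
have JQ : (J <= Q0)%N by rewrite (leq_trans Jh) // leq_pmulr // addnC.
have g0 : (0 < g)%N by rewrite expn_gt0.
have cells : (g ^ (Q0 * 2) < H ^ (J * L))%N.
  rewrite /g /H -!expnM ltn_exp2l // /Q0.
  have -> : (h * (4 * d + 7) * (h * (4 * d + 8) * 2) =
     h * (2 * h * (4 * d + 7) * (4 * d + 8)))%N by ring.
  by rewrite ltn_pmul2l.
have [p [[i0 pi0] pH small]] := @aux_function R n U J L Q0 H g n0 U0 JQ g0 cells.
have n0R : n%:R != 0 :> R by rewrite pnatr_eq0 -lt0n.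
have nU0 : (0 < n * U)%N by rewrite muln_gt0 n0.
pose B := (J * L * H * (n * U) ^ J)%N.
have B0 : (0 < B)%N by rewrite !muln_gt0 J0 L0 !expn_gt0 nU0.
pose Theta : R := 2 ^+ h.
have T0 : 0 < Theta by rewrite exprn_gt0.
have T2 : 2 <= Theta by rewrite /Theta -{1}[2]expr1 ler_weXn2l // ler1n.
have BT : B%:R <= Theta ^+ 3.
  rewrite /Theta -!natrX ler_nat -/H.
  have -> : (H ^ 3 = H * H * H)%N by ring.
  by rewrite /B leq_mul // leq_mul.
have vanish r s : (r < Rm)%N -> (s < S)%N ->
    (pint _ (grid_poly p (r * k + s * n) r)).[a] = 0.
  move=> rR sS; set X := (r * k + s * n)%N.
  have XnU : (X <= n * U)%N.
    rewrite /X /U mulnDr leq_add //.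
      by rewrite mulnC leq_mul // ltnW.
    by rewrite mulnC leq_mul // ltnW.
  apply/eqP/negPn/negP => A0.
  have sizeQ := @size_grid_poly J L p X r Rm (ltnW rR).
  have l1Q := @l1norm_grid_poly J L p X r (L * Rm).+1 H (n * U) nU0 XnU pH.
  have := liou _ _ _ sizeQ l1Q B0 A0.
  rewrite norm_nc -(rmorph_nat (real_complex R)) -rmorphM /= -(rmorph1 (real_complex R)) lecR.
  apply/negP; rewrite -ltNge.
  have liou_le : ((c ^ (L * Rm).+1 * B) ^ d)%:R <= Theta ^+ (4 * d) :> R.
    have T4 : 0 <= Theta ^+ 4 by rewrite exprn_ge0 // ltW.
    rewrite natrX exprM lerXn2r ?nnegrE //.
    rewrite natrM (exprS _ 3) ler_pM // /Theta -natrX ler_nat.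
    exact: cH.
  apply: le_lt_trans (ler_wpM2l (nc_ge0 _) liou_le) _.
  (* [X / n] differs from [r * k / n] by an integer, so that the exponentials
     at [X / n] are powers of [w ^+ r] *)
  have valw : nc (pint _ (grid_poly p X r)).[w] <= 2 * aux_bound R n U J L Q0 H g.
    pose u : R := X%:R / n%:R.
    have u_int : 0 <= u <= U%:R.
      by rewrite /u divr_ge0 //= ler_pdivrMr ?ltr0n // -natrM ler_nat mulnC.
    have wE l : w ^+ (l * r) = cis (2 * pi * l%:R * u).
      rewrite /w cisX.
      have -> : 2 * pi * l%:R * u = (l * r)%:R * (2 * pi * k%:R / n%:R) + (l * s)%:R * (2 * pi).
        by rewrite /u /X natrD !natrM; field.
      by rewrite cisD -[X in _ = _ * X]cisX cis2pi expr1n mulr1.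
    have := small true u u_int; have := small false u u_int.
    rewrite /trig.
    have nu : n%:R * u = X%:R by rewrite /u mulrC divfK.
    rewrite nu => sF sT.
    rewrite horner_grid_poly (le_trans (nc_ReIm _)) // mulr_natl mulr2n.
    have term (i : 'I_J * 'I_L) : (p i)%:~R * (X%:R ^+ i.1 * w ^+ (i.2 * r)) =
       Complex ((p i)%:~R * (X%:R ^+ i.1 * cos (2 * pi * i.2%:R * u)))
               ((p i)%:~R * (X%:R ^+ i.1 * sin (2 * pi * i.2%:R * u))).
      rewrite wE -(rmorph_int (real_complex R)) -(rmorph_nat (real_complex R)).
      by rewrite -rmorphXn /cis /=; simpc.
    under eq_bigr do rewrite term.
    have sumE (I : finType) (F G : I -> R) :
        \sum_i Complex (F i) (G i) = Complex (\sum_i F i) (\sum_i G i).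
      by elim/big_rec3: _ => // i y1 y2 y3 _ ->; simpc.
    by rewrite sumE /= lerD.
  have diff : nc ((pint _ (grid_poly p X r)).[a] - (pint _ (grid_poly p X r)).[w])
      <= Theta ^+ 4 * nc (a - w).
    rewrite !horner_grid_poly -sumrB (le_trans (nc_sum _ _ _)) //.
    apply: (@le_trans _ _ (\sum_(i : 'I_J * 'I_L) (H * (n * U) ^ J)%:R * ((L * Rm)%:R * nc (a - w)))).
      apply: ler_sum => i _; rewrite -!mulrBr !ncM nc_int -intr_norm -pmulrn mulrA.
      rewrite ncX nc_nat natrM; apply: ler_pM; rewrite ?mulr_ge0 ?nc_ge0 ?exprn_ge0 //.
        apply: ler_pM; rewrite ?exprn_ge0 // ?ler_nat ?(ltnW (pH i)) //.
        rewrite -natrX ler_nat (@leq_trans ((n * U) ^ i.1)%N) //.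
          by case: (i.1 : nat) => // m; rewrite leq_exp2r.
        by rewrite leq_pexp2l // ltnW.
      rewrite (le_trans (expB_nc_le _ a1 w1)) // ler_wpM2r ?nc_ge0 // ler_nat.
      by rewrite leq_mul // ltnW.
    rewrite sumr_const card_prod !card_ord -[leLHS]mulr_natl.
    have -> : (J * L)%:R * ((H * (n * U) ^ J)%:R * ((L * Rm)%:R * nc (a - w)))
       = B%:R * (L * Rm)%:R * nc (a - w) by rewrite /B !natrM; ring.
    rewrite ler_wpM2r ?nc_ge0 // (exprSr _ 3) ler_pM //.
    by rewrite /Theta -natrX ler_nat.
  have auxT : 2 * aux_bound R n U J L Q0 H g <= 2 * (Theta ^+ (4 * d + 2))^-1.
    rewrite ler_wpM2l // /aux_bound -natrM -/B.
    have T6 : (Theta ^+ (4 * d + 2))^-1 = Theta ^+ 4 * (Theta ^+ (4 * d + 6))^-1.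
      have T60 : Theta ^+ (4 * d + 2) != 0 by rewrite expf_neq0 // gt_eqF.
      rewrite (_ : 4 * d + 6 = 4 + (4 * d + 2))%N; last by ring.
      by rewrite (exprD _ 4) invfM mulrA divff ?mul1r // expf_neq0 // gt_eqF.
    rewrite T6; set V := (Theta ^+ (4 * d + 6))^-1.
    have V0 : 0 <= V by rewrite invr_ge0 exprn_ge0 // ltW.
    have TV : (Theta ^+ (4 * d + 7))^-1 * Theta = V.
      have T60 : Theta ^+ (4 * d + 6) != 0 by rewrite expf_neq0 // gt_eqF.
      rewrite (_ : 4 * d + 7 = (4 * d + 6).+1)%N; last by rewrite addnS.
      by rewrite exprSr invfM -mulrA mulVf ?mulr1 // gt_eqF.
    have W0 : 0 <= (Theta ^+ (4 * d + 7))^-1 by rewrite invr_ge0 exprn_ge0 // ltW.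
    apply: ler_pM.
    - by rewrite mulr_ge0 // expR_ge0.
    - by rewrite addr_ge0 ?divr_ge0 // invr_ge0 exprn_ge0.
    - by rewrite (exprSr _ 3) ler_pM // expR_ge0.
    have t1 : (2 * Q0)%:R / g%:R <= V / 2.
      have -> : g%:R = Theta ^+ (4 * d + 7) :> R by rewrite /g natrX exprM.
      have : (2 * Q0)%:R <= Theta / 2.
        rewrite ler_pdivlMr // -(natrM _ _ 2) /Theta -natrX ler_nat.
        by rewrite mulnC mulnA; exact: QH.
      move=> /(ler_wpM2r W0) /le_trans; apply.
      by rewrite -TV mulrAC (mulrC Theta).
    have t2 : (2 ^+ (Q0 - J))^-1 <= (Theta ^+ (4 * d + 7))^-1.
      rewrite lef_pV2 ?posrE ?exprn_gt0 // /Theta -exprM ler_weXn2l ?ler1n //.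
      rewrite leq_subRL // /Q0.
      by rewrite (_ : h * (4 * d + 8) = h + h * (4 * d + 7))%N ?leq_add2r //; ring.
    have t3 : (Theta ^+ (4 * d + 7))^-1 <= V / 2.
      rewrite -TV ler_pdivlMr // ler_wpM2l //.
    by rewrite (splitr V) lerD // (le_trans t2).
  have close' : nc (a - w) <= (Theta ^+ (4 * d + 6))^-1 by rewrite /Theta -exprM.
  set E := nc _.
  have Ele : E <= 3 * (Theta ^+ (4 * d + 2))^-1.
    have T6 : Theta ^+ 4 * (Theta ^+ (4 * d + 6))^-1 = (Theta ^+ (4 * d + 2))^-1.
      rewrite (_ : 4 * d + 6 = 4 + (4 * d + 2))%N; last by ring.
      by rewrite (exprD _ 4) invfM mulrA divff ?mul1r // expf_neq0 // gt_eqF.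
    have := ler_wpM2l (exprn_ge0 4 (ltW T0)) close'; rewrite T6 => le4.
    have := ncD ((pint _ (grid_poly p X r)).[a] - (pint _ (grid_poly p X r)).[w])
      (pint _ (grid_poly p X r)).[w].
    rewrite subrK -/E; lra.
  have := ler_wpM2r (exprn_ge0 (4 * d) (ltW T0)) Ele => /le_lt_trans; apply.
  have -> : 3 * (Theta ^+ (4 * d + 2))^-1 * Theta ^+ (4 * d) = 3 / Theta ^+ 2.
    have Td : Theta ^+ (4 * d) != 0 by rewrite expf_neq0 // gt_eqF.
    by rewrite exprD invfM; field; rewrite Td gt_eqF.
  rewrite ltr_pdivrMr ?exprn_gt0 // mul1r.
  have : 2 * 2 <= Theta * Theta by rewrite ler_pM.
  by rewrite expr2; lra.
pose P (l : 'I_L) : {poly R[i]} := \sum_(j < J) (p (j, l))%:~R *: 'X^j.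
have coefP l (j : 'I_J) : (P l)`_j = (p (j, l))%:~R.
  rewrite /P coef_sum (bigD1 j) //= coefZ coefXn eqxx mulr1 big1 ?addr0 // => j' /negPf jj.
  by rewrite coefZ coefXn (eq_sym (j : nat)) val_eqE jj mulr0.
have P0 : P i0.2 = 0.
  apply: (@zero_estimate _ a k n J L Rm S P) => //.
  - by rewrite -nc_gt0 a1.
  - move=> l; rewrite /P (leq_trans (size_sum _ _ _)) //; apply/bigmax_leqP => j _.
    by rewrite (leq_trans (size_scale_leq _ _)) // size_polyXn.
  - move=> r r' s s' rR rR' sS sS' E.
    have rr : r = r'.
      case/orP: (leq_total r r') => le_rr; 
        first exact: (@grid_inj k n r r' s s' copkn le_rr (leq_trans rR' Rn) E).
      exact/esym/(@grid_inj k n r' r s' s copkn le_rr (leq_trans rR Rn) (esym E)).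
    split=> //; move: E; rewrite rr => /addnI/eqP.
    by rewrite eqn_pmul2r // => /eqP.
  - move=> r s rR sS; rewrite -[RHS](vanish r s rR sS) horner_grid_poly.
    set x := _%:R; have PE l : (P l).[x] = \sum_j (p (j, l))%:~R * x ^+ j.
      rewrite /P horner_sum; apply: eq_bigr => j _.
      by rewrite hornerZ hornerXn.
    under eq_bigr do rewrite PE mulr_suml.
    rewrite exchange_big pair_bigA; apply: eq_bigr => -[j l] _ /=.
    by rewrite mulrA.
case/eqP: pi0; apply/eqP; rewrite -(intr_eq0 R[i]).
have := coefP i0.2 i0.1; rewrite P0 coef0 -surjective_pairing => <-.
by rewrite eqxx.
Qed.
End ApproximationByRootsOfUnity.

Lemma poly_le_exp2 e A : exists L0, forall L, (L0 <= L)%N -> (A * L.+1 ^ e <= 2 ^ L)%N.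
Proof.
elim: e A => [|e IHe] A.
  exists A => L AL; rewrite expn0 muln1 (leq_trans AL) // ltnW // ltn_expl //.
have [m0 hm0] := IHe (A * 2 ^ e.+1)%N.
exists (m0.*2) => L; rewrite -geq_half_double => mL.
set m := L./2 in mL *.
have L1 : (L.+1 <= 2 * m.+1)%N by rewrite /m; lia.
apply: (@leq_trans (A * (2 * m.+1) ^ e.+1)); first by rewrite leq_mul // leq_exp2r.
have -> : (A * (2 * m.+1) ^ e.+1 = (A * 2 ^ e.+1 * m.+1 ^ e) * m.+1)%N.
  by rewrite expnMn (expnS m.+1); ring.
apply: (@leq_trans (2 ^ m * 2 ^ m)); first by rewrite leq_mul ?hm0 // ltn_expl.
by rewrite -expnD leq_exp2l // /m; lia.
Qed.

Lemma nat_root4 n : exists L, (L ^ 4 <= n < L.+1 ^ 4)%N.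
Proof.
elim: n => [|n [L /andP[L1 L2]]]; first by exists 0%N.
have [h|h] := ltnP n.+1 (L.+1 ^ 4).
  by exists L; rewrite h leqW.
exists L.+1; rewrite h /=.
by rewrite (leq_ltn_trans L2) // ltn_exp2r.
Qed.

Section Gelfond.
Variable R : realType.
Implicit Types (a : R[i]) (eps : R).

Lemma nat_ge (x : R) : exists m : nat, x <= m%:R.
Proof. by exists (Num.truncn x).+1; rewrite ltW // truncnS_gt. Qed.

Lemma expR_le_exp2 (x : R) : exists m : nat, expR x <= 2 ^+ m.
Proof.
have [m hm] := nat_ge (expR x); exists m; rewrite (le_trans hm) //.
by rewrite -natrX ler_nat ltnW // ltn_expl.
Qed.

Lemma exp2_le_expR m : 2 ^+ m <= expR m%:R :> R.
Proof.
rewrite -[m%:R]mulr1 mulrC expRM_natr.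
by rewrite lerXn2r ?nnegrE ?expR_ge0 // (le_trans _ (expR_ge1Dx 1)).
Qed.

(** The parameters are multiples of powers of [L], with [L ^ 4] of the order of [n]: the
    auxiliary function has [L] exponentials, degree [J] of order [L], and the
    grid has [rho ^ 2] points with [rho] of order [L]. Then [h] is of order
    [L ^ 2], which is small compared to [n]. *)
Lemma algebraic_far_from_roots_of_unity a (f : {poly int}) eps :
  nc a = 1 -> (forall i j, a ^+ i = a ^+ j -> i = j) ->
  f != 0 -> root (pint R[i] f) a -> 0 < eps ->
  exists n0, forall n k, (n0 <= n)%N -> (k <= n)%N -> coprime k n ->
    expR (- (eps * n%:R)) < nc (a - cis (2 * pi * k%:R / n%:R)).
Proof.
move=> a1 ainj f0 fa eps0.
have na1 : `|a| <= 1 by rewrite norm_nc a1 lecR.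
have [d [c [c0 liou]]] := liouville f0 fa na1.
have [kap kapE] := expR_le_exp2 (4 * pi).
pose C3 := (2 * kap + 2 * c + 1)%N.
pose D := ((4 * d + 7) * (4 * d + 8))%N.
pose C2 := (2 * C3 * D + 1)%N.
pose C5 := (C3 * C2.+1 * (4 * d + 6))%N.
have [l1 hl1] := poly_le_exp2 2 (C2 * C2.+1).
have [l2 hl2] := poly_le_exp2 (5 * C2) ((2 * C2.+1) ^ C2).
have [l3 hl3] := poly_le_exp2 2 (4 * (C3 * C2.+1 * (4 * d + 8))).
have [l4 hl4] := nat_ge (C5%:R / eps).
pose L0 := (l1 + l2 + l3 + l4 + C2 + 1)%N.
exists (L0 ^ 4)%N => n k L0n kn copkn.
have [L /andP[Ln nL]] := nat_root4 n.
have L0L : (L0 <= L)%N.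
  by rewrite -ltnS -(@ltn_exp2r _ _ 4) // (leq_ltn_trans L0n).
have [L1 L2 L3 L4 LC2] : [/\ l1 <= L, l2 <= L, l3 <= L, l4 <= L & C2 < L]%N.
  by rewrite /L0 in L0L; split; lia.
have Lpos : (0 < L)%N by apply: leq_trans LC2.
pose rho := (C2.+1 * L)%N.
pose J := (C2 * rho)%N.
pose h := (C3 * L * rho)%N.
have C30 : (0 < C3)%N by rewrite /C3 addn1.
have C20 : (0 < C2)%N by rewrite /C2 addn1.
have rho0 : (0 < rho)%N by rewrite muln_gt0.
have Lrho_h : (L * rho <= h)%N by rewrite /h -mulnA leq_pmull.
have L_h : (L <= h)%N by rewrite (leq_trans _ Lrho_h) // leq_pmulr.
have two_h m : (m <= h)%N -> (2 ^ m <= 2 ^ h)%N by move=> mh; rewrite leq_exp2l.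
have JLh : (J * L <= 2 ^ h)%N.
  apply: leq_trans (two_h _ L_h); apply: leq_trans (hl1 _ L1).
  rewrite /J /rho (_ : C2 * (C2.+1 * L) * L = C2 * C2.+1 * L ^ 2)%N; last by ring.
  by rewrite leq_mul // leq_exp2r.
have main : (2 ^+ (h * (4 * d + 6)))^-1 < nc (a - cis (2 * pi * k%:R / n%:R)).
  apply: (@root_of_unity_far R a d c n k L rho rho J h) => //.
  - exact: leq_trans L_h.
  - by rewrite muln_gt0 C20.
  - apply/andP; split; first by rewrite leq_pmull.
    rewrite (leq_trans _ Ln) // /rho (expnS L 3) mulnC leq_mul //.
    by rewrite (leq_trans LC2) // -{1}(expn1 L) leq_pexp2l.
  - rewrite /J /rho (_ : C2.+1 * L - L = C2 * L)%N; last by rewrite mulSn addnC addnK.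
    by rewrite mulnA (mulnC L).
  - apply: (@leq_trans (2 ^ (c * (L * rho).+1))%N).
      by rewrite expnM leq_exp2r // ltnW // ltn_expl.
    apply: two_h; rewrite /h -mulnA.
    have Lr0 : (0 < L * rho)%N by rewrite muln_gt0 Lpos.
    apply: (@leq_trans (c * 2 * (L * rho))).
      by rewrite -mulnA leq_mul // mulSn mul1n -add1n leq_add2r.
    by rewrite leq_mul // /C3; lia.
  - apply: leq_trans JLh; rewrite mulnC leq_mul //.
    by rewrite /J leq_pmull.
  - apply: (@leq_trans ((2 ^ L) ^ rho)%N).
      rewrite /J expnM leq_exp2r //; apply: leq_trans (hl2 _ L2).
      rewrite expnM -expnMn leq_exp2r //.
      apply: (@leq_trans (L.+1 ^ 4 * (2 * C2.+1 * L.+1)))%N.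
        rewrite leq_mul ?(ltnW nL) // /rho addnn -mul2n -mulnA.
        by rewrite leq_mul // leq_mul.
      by rewrite (expnSr L.+1 4) mulnCA mulnC.
    by rewrite -expnM two_h.
  - rewrite expRM_natr.
    apply: (@le_trans _ _ ((2 ^+ kap) ^+ (L * (rho + rho)))).
      by rewrite lerXn2r ?nnegrE ?expR_ge0 ?exprn_ge0.
    rewrite -exprM ler_weXn2l ?ler1n // /h -mulnA.
    have -> : (kap * (L * (rho + rho)) = 2 * kap * (L * rho))%N by ring.
    by rewrite leq_mul // /C3; lia.
  - apply: leq_trans (two_h _ L_h); apply: leq_trans (hl3 _ L3).
    rewrite /h /rho (_ : 4 * (C3 * L * (C2.+1 * L) * (4 * d + 8)) =
      4 * (C3 * C2.+1 * (4 * d + 8)) * L ^ 2)%N; last by ring.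
    by rewrite leq_mul // leq_exp2r.
  - rewrite /J /h leq_mul // (leq_trans (ltnW LC2)) // leq_pmull //.
  - rewrite /h /J (_ : 2 * (C3 * L * rho) * (4 * d + 7) * (4 * d + 8) =
      2 * C3 * D * (L * rho))%N; last by rewrite /D; ring.
    by rewrite -(mulnA C2) (mulnC rho) ltn_pmul2r ?muln_gt0 ?Lpos // /C2 addn1.
apply: le_lt_trans main.
rewrite expRN lef_pV2 ?posrE ?expR_gt0 ?exprn_gt0 //.
rewrite (le_trans (exp2_le_expR _)) // ler_expR.
have -> : (h * (4 * d + 6) = C5 * L ^ 2)%N by rewrite /h /C5 /rho; ring.
have C5L : C5%:R <= eps * L%:R.
  rewrite mulrC -ler_pdivrMr // (le_trans hl4) // ler_nat //.
rewrite natrM (le_trans (ler_wpM2r _ C5L)) // -mulrA ler_wpM2l ?(ltW eps0) //.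
rewrite -natrM ler_nat (leq_trans _ Ln) // -expnS leq_pexp2l //.
Qed.

Lemma positive_lower_bound (I : finType) (F : I -> R) :
  (forall i, 0 < F i) -> exists2 m, 0 < m & forall i, m <= F i.
Proof.
move=> F0; have S0 : 0 < 1 + \sum_i (F i)^-1.
  by rewrite ltr_pwDl // sumr_ge0 // => i _; rewrite invr_ge0 ltW.
exists (1 + \sum_i (F i)^-1)^-1; first by rewrite invr_gt0.
move=> i; rewrite -[leRHS]invrK lef_pV2 ?posrE ?invr_gt0 //.
rewrite (bigD1 i) //= addrCA lerDl addr_ge0 // sumr_ge0 // => j _.
by rewrite invr_ge0 ltW.
Qed.

Lemma nc_cisB1 (s : R) : nc (cis s - 1) ^+ 2 = 2 - 2 * cos s.
Proof.
rewrite /nc /cis /= sqr_sqrtr ?addr_ge0 ?sqr_ge0 // oppr0 addr0.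
rewrite sin2cos2; ring.
Qed.

(** If [eta] is the argument of [a ^+ n] in [-pi, pi], then [eta / n] is the
    argument of [a] relative to the closest [n]-th root of unity. *)
Lemma closest_root_of_unity a n : nc a = 1 -> (0 < n)%N ->
  exists2 k : nat, (k <= n)%N & nc (a - cis (2 * pi * k%:R / n%:R)) <= nc (a ^+ n - 1).
Proof.
move=> a1 n0; have [t /andP[t0 t1] ->] := cis_unit a1.
have n0R : 0 < n%:R :> R by rewrite ltr0n.
have pi0 : 0 < pi :> R := pi_gt0 R.
pose q : R := n%:R * t / (2 * pi).
have q0 : 0 <= q by rewrite /q divr_ge0 ?mulr_ge0 // ltW.
have qn : q <= n%:R.
  by rewrite /q ler_pdivrMr ?mulr_gt0 // ler_wpM2l // ltW.
pose k := Num.truncn (q + 2^-1).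
have /andP[k1 k2] : k%:R <= q + 2^-1 < k.+1%:R by apply: truncn_itv; lra.
have kn : (k <= n)%N.
  rewrite -ltnS -(ltr_nat R) -natr1; lra.
exists k => //.
pose eta : R := 2 * pi * (q - k%:R).
have etaE : n%:R * t = eta + k%:R * (2 * pi).
  have pi2 : 2 * pi != 0 :> R by rewrite mulf_neq0 // lt0r_neq0.
  by rewrite /eta mulrBr /q [2 * pi * (_ / _)]mulrC divfK //; ring.
have eta_le : `|eta| <= pi.
  rewrite /eta normrM gtr0_norm ?mulr_gt0 //.
  have : `|q - k%:R| <= 2^-1 by rewrite -[k.+1%:R]natr1 in k2; rewrite ler_norml; lra.
  move=> /(ler_wpM2l (ltW pi0)); lra.
clearbody eta; have -> : cis t ^+ n = cis eta.
  by rewrite cisX etaE cisD -cisX cis2pi expr1n mulr1.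
have -> : nc (cis t - cis (2 * pi * k%:R / n%:R)) = nc (cis (eta / n%:R) - 1).
  have -> : t = eta / n%:R + 2 * pi * k%:R / n%:R.
    apply: (mulfI (lt0r_neq0 n0R)); rewrite etaE; field; exact: lt0r_neq0.
  set s := 2 * pi * _ / _.
  by rewrite cisD -[X in _ - X]mul1r -mulrBl ncM nc_cis mulr1.
rewrite -(@ler_pXn2r _ 2) ?nnegrE ?nc_ge0 // !nc_cisB1 lerD2l lerN2 ler_wpM2l //.
have cos_norm (x : R) : cos x = cos `|x| by case: (ger0P x); rewrite ?cosN.
rewrite (cos_norm eta) (cos_norm (eta / n%:R)) normrM normfV normr_nat.
have en : `|eta| / n%:R <= `|eta|.
  by rewrite ler_pdivrMr // ler_peMr // ler1n.
rewrite leNgt ltr_cos -?leNgt // in_itv /= ?normr_ge0 ?eta_le //.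
by rewrite divr_ge0 //= (le_trans en).
Qed.

(** If [a ^+ n] is close to [1], then [a] is close to an [n]-th root of unity.
    In lowest terms this root has order [n'], a divisor of [n]: large [n'] are
    excluded by the previous estimate, and the finitely many small ones because
    [a] is not a root of unity. *)
Theorem gelfond a (f : {poly int}) eps :
  nc a = 1 -> (forall n, (0 < n)%N -> a ^+ n != 1) ->
  f != 0 -> root (pint R[i] f) a -> 0 < eps ->
  exists n0, forall n, (n0 <= n)%N -> expR (- (eps * n%:R)) <= nc (a ^+ n - 1).
Proof.
move=> a1 anu f0 fa eps0.
have a0 : a != 0 by rewrite -nc_gt0 a1.
have ainj i j : a ^+ i = a ^+ j -> i = j.
  wlog ij : i j / (i <= j)%N => [wl|] aij.
    case/orP: (leq_total i j) => [/wl/(_ aij)//|ji].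
    exact/esym/(wl _ _ ji (esym aij)).
  move: aij; rewrite -(subnK ij) exprD => /eqP; rewrite eq_sym -subr_eq0 -{2}[a ^+ i]mul1r -mulrBl.
  rewrite mulf_eq0 (negPf (expf_neq0 _ a0)) orbF subr_eq0 => aij.
  have [->//|ji0] := posnP (j - i); by rewrite (negPf (anu _ ji0)) in aij.
have [n0 far] := algebraic_far_from_roots_of_unity a1 ainj f0 fa eps0.
pose F (i : 'I_n0 * 'I_n0.+1) : R :=
  if i.1 == 0 :> nat then 1 else nc (a - cis (2 * pi * i.2%:R / i.1%:R)).
have F0 i : 0 < F i.
  rewrite /F; case: eqP => // /eqP; rewrite -lt0n => i0.
  rewrite nc_gt0 subr_eq0; apply/eqP => aE; have := anu _ i0.
  rewrite aE cisX; have -> : i.1%:R * (2 * pi * i.2%:R / i.1%:R) = i.2%:R * (2 * pi) :> R.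
    by field; rewrite pnatr_eq0 -lt0n.
  by rewrite -cisX cis2pi expr1n eqxx.
have [m m0 mF] := positive_lower_bound F0.
have [n1 hn1] := nat_ge (m^-1 / eps).
exists (n0 + n1).+1 => n nn.
have n_gt0 : (0 < n)%N by lia.
have [k kn] := closest_root_of_unity a1 n_gt0; apply: le_trans.
pose g := gcdn k n; have g0 : (0 < g)%N by rewrite gcdn_gt0 n_gt0 orbT.
have [gk gn] : (g %| k)%N /\ (g %| n)%N by rewrite dvdn_gcdl dvdn_gcdr.
have gR : g%:R != 0 :> R by rewrite pnatr_eq0 -lt0n.
have n'0 : (0 < n %/ g)%N by rewrite divn_gt0 // dvdn_leq.
have -> : 2 * pi * k%:R / n%:R = 2 * pi * (k %/ g)%:R / (n %/ g)%:R :> R.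
  have kE : k%:R = (k %/ g)%:R * g%:R :> R by rewrite -natrM divnK.
  have nE : n%:R = (n %/ g)%:R * g%:R :> R by rewrite -natrM divnK.
  have n'R : (n %/ g)%:R != 0 :> R by rewrite pnatr_eq0 -lt0n.
  by rewrite kE nE; field; rewrite gR n'R.
have kg : (k %/ g <= n %/ g)%N by rewrite leq_div2r.
have cop : coprime (k %/ g) (n %/ g).
  by rewrite /coprime -(eqn_pmul2r g0) mul1n muln_gcdl !divnK.
have [n'n0|n'n0] := leqP n0 (n %/ g).
  apply: ltW; apply: le_lt_trans (far _ _ n'n0 kg cop).
  by rewrite ler_expR lerN2 ler_wpM2l ?(ltW eps0) // ler_nat leq_div.
have kg0 : (k %/ g < n0.+1)%N by rewrite ltnS (leq_trans kg) // ltnW.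
have := mF (Ordinal n'n0, Ordinal kg0); rewrite /F /= gt_eqF //; apply: le_trans.
rewrite expRN -[leRHS]invrK lef_pV2 ?posrE ?invr_gt0 ?expR_gt0 //.
apply: (@le_trans _ _ (eps * n%:R)); last first.
  by rewrite (le_trans _ (expR_ge1Dx _)) // lerDr.
rewrite mulrC -ler_pdivrMr // (le_trans hn1) // ler_nat; lia.
Qed.

End Gelfond.

(** * Jensen's formula *)

Section Jensen.
Variable R : realType.
Implicit Types (a b : R[i]) (t : R).
Notation mu := (@lebesgue_measure R).

Definition circle_dist a t : R := nc (cis (2 * pi * t) - a).
Definition log_dist a t : R := ln (circle_dist a t).

Lemma continuous_circle_dist a : continuous (circle_dist a).
Proof.
move=> t; rewrite /circle_dist.
have -> : (fun t => nc (cis (2 * pi * t) - a)) =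
  fun t => Num.sqrt ((cos (2 * pi * t) - complex.Re a) ^+ 2 + (sin (2 * pi * t) - complex.Im a) ^+ 2).
  by apply/funext => s; case: a.
have c2 : (fun s : R => 2 * pi * s) x @[x --> t] --> 2 * pi * t.
  by apply: cvgM; [exact: cvg_cst|exact: cvg_id].
have ccos : cos (2 * pi * x) @[x --> t] --> cos (2 * pi * t).
  by apply: continuous_cvg c2; exact: continuous_cos.
have csin : sin (2 * pi * x) @[x --> t] --> sin (2 * pi * t).
  by apply: continuous_cvg c2; exact: continuous_sin.
apply: (@continuous_cvg _ _ _ _ _ _ (@Num.sqrt R)); first exact: sqrt_continuous.
apply: cvgD; apply: (@continuous_cvg _ _ _ _ _ _ (fun x : R => x ^+ 2)).
- exact: exprn_continuous.
- by apply: cvgB => //; exact: cvg_cst.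
- exact: exprn_continuous.
- by apply: cvgB => //; exact: cvg_cst.
Qed.

Lemma measurable_log_dist a (D : set R) : measurable D -> measurable_fun D (log_dist a).
Proof.
move=> mD; apply: measurable_funTS; apply: measurableT_comp.
  exact: measurable_realfun.measurable_ln.
exact: (measurable_realfun.continuous_measurable_fun (@continuous_circle_dist a)).
Qed.

Lemma circle_dist_gt0 a t : nc a != 1 -> 0 < circle_dist a t.
Proof.
move=> a1; rewrite /circle_dist nc_gt0 subr_eq0; apply: contraNneq a1 => <-.
by rewrite nc_cis.
Qed.

Lemma continuous_log_dist a : nc a != 1 -> continuous (log_dist a).
Proof.
move=> a1 t; apply: (@continuous_cvg _ _ _ _ _ _ (@ln R)).
  exact/continuous_ln/circle_dist_gt0.
exact: continuous_circle_dist.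
Qed.

Lemma integrable_continuous (G : R -> R) (x y : R) : continuous G ->
  mu.-integrable `[x, y] (EFin \o G).
Proof.
move=> cG; apply: continuous_compact_integrable; first exact: segment_compact.
exact: continuous_subspaceT.
Qed.

Lemma Rintegral_affine (G : R -> R) (c d x y : R) : continuous G ->
  0 < c -> x <= y ->
  \int[mu]_(t in `[c * x + d, c * y + d]) G t = c * \int[mu]_(t in `[x, y]) G (c * t + d).
Proof.
move=> cG c0 xy.
pose F := fun t : R => c * t + d.
have cF : continuous F.
  by move=> t; apply: cvgD; [apply: cvgM; [exact: cvg_cst|exact: cvg_id]|exact: cvg_cst].
have dF t : derivable F t 1 by apply: derivableD => //; apply: derivableM.
have derF : (F^`())%classic = cst c.
  apply/funext => t; rewrite derive1E deriveD // ?deriveM //.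
  by rewrite derive_id !derive_cst scaler0 !addr0 /GRing.scale /= mulr1.
have := @integration_by_substitution_increasing R F G x y xy.
rewrite /Rintegral -/(F x) -/(F y) => -> //.
- rewrite derF.
  have -> : (fun t => (((G \o F) * cst c) t)%:E) = (fun t => (c%:E * ((G \o F) t)%:E)%E).
    by apply/funext => t; rewrite fctE -EFinM /= mulrC.
  have iGF : mu.-integrable `[x, y] (EFin \o (G \o F)).
    by apply: integrable_continuous => t; apply: continuous_comp; [exact: cF|exact: cG].
  rewrite integralZl // fineM //; exact: integrable_fin_num.
- by move=> s t _ _ st; rewrite ltrD2r ltr_pM2l.
- by rewrite derF => t _; exact: cvg_cst.
- by rewrite derF; exact: is_cvg_cst.
- by rewrite derF; exact: is_cvg_cst.
- split => //; [exact/cvg_at_right_filter/cF|exact/cvg_at_left_filter/cF].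
- exact: continuous_subspaceT.
Qed.

End Jensen.

Section Jensen.
Variable R : realType.
Implicit Types (a b : R[i]) (t : R).
Notation mu := (@lebesgue_measure R).

Definition log_mean a : R := \int[mu]_(t in `[0, 1]) log_dist a t.

(** [z ^ 2 - a ^ 2] is the product of [z - a] and [z + a], and the second factor
    takes on the circle the same values as the first, a half turn later. *)
Lemma log_mean_sqr a : 1 < nc a -> log_mean (a ^+ 2) = 2 * log_mean a.
Proof.
move=> a1.
have ca : continuous (log_dist a) by apply: continuous_log_dist; rewrite gt_eqF.
have c0 : 0 < 2^-1 :> R by rewrite invr_gt0.
have half_cont (d : R) : continuous (fun t : R => log_dist a (2^-1 * t + d)).
  move=> t; apply: (@continuous_comp _ _ _ (fun t => 2^-1 * t + d)); last exact: ca.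
  by apply: cvgD; [apply: cvgM; [exact: cvg_cst|exact: cvg_id]|exact: cvg_cst].
have split2 t : log_dist (a ^+ 2) t =
    log_dist a (2^-1 * t + 0) + log_dist a (2^-1 * t + 2^-1).
  rewrite /log_dist -lnM ?posrE ?circle_dist_gt0 ?gt_eqF //; congr ln.
  rewrite /circle_dist -ncM addr0.
  have -> : 2 * pi * t = 2%:R * (2 * pi * (2^-1 * t)) :> R by field.
  rewrite -cisX (mulrDr (2 * pi)) cisD.
  have -> : 2 * pi / 2 = pi :> R by field.
  have -> : cis (pi : R) = -1 by rewrite /cis cospi sinpi; simpc.
  by rewrite mulrN1 -opprD mulrN ncN subr_sqr.
rewrite /log_mean; under eq_Rintegral do rewrite split2.
rewrite RintegralD //=; first last.
- exact: integrable_continuous.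
- exact: integrable_continuous.
have h1 := Rintegral_affine 0 ca c0 ler01.
have h2 := Rintegral_affine 2^-1 ca c0 ler01.
have h3 : 2^-1 + 2^-1 = 1 :> R by field.
rewrite mulr0 mulr1 !addr0 in h1; rewrite mulr0 mulr1 add0r h3 in h2.
have ia : mu.-integrable `[0, 1] (EFin \o log_dist a) by exact: integrable_continuous.
have := @Rintegral_itvB R _ _ _ 2^-1 ia.
rewrite !bnd_simp => /(_ (ltW c0)); rewrite invf_le1 // ler1n => /(_ isT).
rewrite (@Rintegral_itv_obnd_cbnd R 2^-1 (BRight 1)); last first.
  apply: (integrableS _ _ _ (integrable_continuous 2^-1 1 ca)) => //.
  exact: subset_itv_oc_cc.
rewrite /log_mean h1 h2; lra.
Qed.

Lemma log_mean_big b : 2 <= nc b -> `|log_mean b - ln (nc b)| <= ln 2.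
Proof.
move=> b2; have b0 : 0 < nc b by rewrite (lt_le_trans _ b2).
have cb : continuous (log_dist b).
  by apply: continuous_log_dist; rewrite gt_eqF // (lt_le_trans _ b2) // ltr1n.
have bounds t : ln (nc b) - ln 2 <= log_dist b t <= ln (nc b) + ln 2.
  have d0 : 0 < circle_dist b t.
    by apply: circle_dist_gt0; rewrite gt_eqF // (lt_le_trans _ b2) // ltr1n.
  rewrite -ln_div ?posrE // -lnM ?posrE // !ler_ln ?posrE ?divr_gt0 ?mulr_gt0 //.
  have := ncB_ge b (cis (2 * pi * t)); rewrite nc_cis ncBC -/(circle_dist b t) => d1.
  have := ncB (cis (2 * pi * t)) b; rewrite nc_cis -/(circle_dist b t) => d2.
  by apply/andP; split; lra.
have Icst (c : R) : \int[mu]_(t in `[0, 1]) c = c.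
  by rewrite Rintegral_cst //= lebesgue_measure_itv /= lte_fin ltr01 oppr0 adde0 mulr1.
have icst (c : R) : mu.-integrable `[0, 1] (EFin \o (fun=> c)).
  by apply: integrable_continuous => t; exact: cvg_cst.
have ib : mu.-integrable `[0, 1] (EFin \o log_dist b) by exact: integrable_continuous.
rewrite ler_norml; apply/andP; split.
  rewrite lerBrDl -(Icst (ln (nc b) - ln 2)); apply: le_Rintegral => //.
  by move=> t _; have /andP[] := bounds t.
rewrite lerBlDl -(Icst (ln (nc b) + ln 2)); apply: le_Rintegral => //.
by move=> t _; have /andP[] := bounds t.
Qed.

(** By iterated squaring, [2 ^ k * log_mean a] stays within [ln 2] of
    [2 ^ k * ln (nc a)]. *)
Lemma log_mean_gt1 a : 1 < nc a -> log_mean a = ln (nc a).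
Proof.
move=> a1; have a0 : 0 < nc a by rewrite (lt_trans _ a1).
have a2k k : 1 < nc (a ^+ (2 ^ k)).
  by rewrite ncX exprn_egt1 // -lt0n expn_gt0.
have powE k : log_mean (a ^+ (2 ^ k)) = 2 ^+ k * log_mean a.
  elim: k => [|k IHk]; first by rewrite expr1 mul1r.
  by rewrite expnSr exprM log_mean_sqr // IHk exprS mulrA.
have [m hm] := nat_ge ((nc a - 1)^-1).
have big k : (m <= k)%N -> 2 <= nc (a ^+ (2 ^ k)).
  move=> mk; rewrite ncX.
  have : 1 + (nc a - 1) *+ (2 ^ k) <= nc a ^+ (2 ^ k).
    have -> : nc a ^+ (2 ^ k) = (1 + (nc a - 1)) ^+ (2 ^ k) by rewrite addrC subrK.
    have d0 : 0 <= nc a - 1 by rewrite subr_ge0 ltW.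
    elim: (2 ^ k)%N => [|n IHn]; first by rewrite addr0.
    rewrite exprS mulrS; set d := nc a - 1 in d0 IHn *.
    have := ler_wpM2l _ IHn; move=> /(_ (1 + d)); rewrite addr_ge0 // => /(_ isT).
    apply: le_trans; rewrite mulrDl mul1r mulrDr mulr1.
    have : 0 <= d * (d *+ n) by rewrite mulr_ge0 // mulrn_wge0.
    lra.
  apply: le_trans; rewrite -[2]/(1 + 1) lerD2l -mulr_natr -ler_pdivrMl ?subr_gt0 //.
  by rewrite mulr1 (le_trans hm) // ler_nat (leq_trans mk) // ltnW // ltn_expl.
apply/eqP; rewrite -subr_eq0 -normr_eq0 eq_le normr_ge0 andbT.
apply/ler_addgt0Pr => e e0; rewrite add0r.
have [m' hm'] := nat_ge (ln 2 / e).
pose k := maxn m m'.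
have := log_mean_big (big k (leq_maxl _ _)).
rewrite powE ncX lnXn // -[ln (nc a) *+ _]mulr_natl natrX -mulrBr normrM ger0_norm ?exprn_ge0 //.
move=> h; rewrite -(@ler_pM2l _ (2 ^+ k)) ?exprn_gt0 // (le_trans h) //.
rewrite -ler_pdivrMr // (le_trans hm') // -natrX ler_nat.
by rewrite (leq_trans (leq_maxr m m')) // ltnW // ltn_expl.
Qed.

End Jensen.

Section Jensen.
Variable R : realType.
Implicit Types (a b : R[i]) (t : R).
Notation mu := (@lebesgue_measure R).

Lemma nc_conj a : nc a^*%C = nc a.
Proof. by case: a => x y; rewrite /nc /= sqrrN. Qed.

Lemma conj_cis t : (cis t)^*%C = (cis t)^-1.
Proof.
apply: (mulIf (cis_neq0 t)); rewrite mulVf ?cis_neq0 //.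
apply/eqP; rewrite eq_complex /=; apply/andP; split; apply/eqP; last by ring.
by rewrite -[RHS](cos2Dsin2 t); ring.
Qed.

(** On the circle [z - a] has the same modulus as [1 - conj(a) * z], which
    reduces the claim to a point outside the circle. *)
Lemma log_mean_lt1 a : nc a < 1 -> log_mean a = 0.
Proof.
move=> a1; have [->|a0] := eqVneq a 0.
  rewrite /log_mean (@eq_Rintegral _ _ _ _ _ (fun=> 0)) ?Rintegral_cst ?mul0r //.
  by move=> t _; rewrite /log_dist /circle_dist subr0 nc_cis ln1.
have ac0 : a^*%C != 0 by rewrite -nc_gt0 nc_conj nc_gt0.
pose b := (a^*%C)^-1.
have na0 : 0 < nc a by rewrite nc_gt0.
have b1 : 1 < nc b by rewrite ncV nc_conj invf_gt1.
have E t : log_dist a t = ln (nc a) + log_dist b t.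
  rewrite /log_dist -lnM ?posrE ?circle_dist_gt0 ?gt_eqF //; congr ln.
  rewrite /circle_dist -[nc a]nc_conj -ncM -[LHS]nc_conj.
  have conjB (x y : R[i]) : (x - y)^*%C = x^*%C - y^*%C.
    by case: x y => ? ? [? ?]; apply/eqP; rewrite eq_complex /= opprD !eqxx.
  rewrite conjB conj_cis.
  have -> : (cis (2 * pi * t))^-1 - a^*%C =
     - ((cis (2 * pi * t))^-1 * (a^*%C * (cis (2 * pi * t) - b))).
    by rewrite /b mulrBr divff // mulrBr mulrCA mulVf ?cis_neq0 // !mulr1 opprB.
  by rewrite ncN [LHS]ncM ncV nc_cis invr1 mul1r.
rewrite /log_mean; under eq_Rintegral do rewrite E.
have Dm : measurable (`[0, 1]%classic : set R) by [].
rewrite RintegralD //; last 2 first.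
- by apply: integrable_continuous => t; exact: cvg_cst.
- by apply: integrable_continuous; apply: continuous_log_dist; rewrite gt_eqF.
rewrite Rintegral_cst //= lebesgue_measure_itv /= lte_fin ltr01 oppr0 adde0 mulr1.
by rewrite -/(log_mean b) log_mean_gt1 // ncV nc_conj lnV ?posrE // subrr.
Qed.

Section UnitCircle.
Variable a : R[i].
Hypothesis a1 : nc a = 1.

(** On the unit circle itself, push [a] radially to [rho k * a], outside the
    circle; the functions [h k] are nonnegative and increase to
    [ln 3 - log_dist a], so that monotone convergence applies. *)
Let rho (k : nat) : R := 1 + harmonic k.
Let h (k : nat) t : R := ln 3 - log_dist ((rho k)%:C * a) t.

Let rho_gt1 k : 1 < rho k.
Proof. by rewrite /rho ltrDl /= invr_gt0. Qed.

Let rho_le2 k : rho k <= 2.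
Proof. by rewrite /rho -[2]/(1 + 1) lerD2l /= invf_le1 // ler1n. Qed.

Let nc_rho k : nc ((rho k)%:C * a) = rho k.
Proof. by rewrite ncM nc_real a1 mulr1 gtr0_norm // (lt_trans _ (rho_gt1 k)). Qed.

Let rho_ne1 k : nc ((rho k)%:C * a) != 1.
Proof. by rewrite nc_rho gt_eqF. Qed.

Let circle_distE k t : circle_dist ((rho k)%:C * a) t =
  Num.sqrt (harmonic k ^+ 2 + rho k * circle_dist a t ^+ 2).
Proof.
have E (r : R) : circle_dist (r%:C * a) t ^+ 2 = (r - 1) ^+ 2 + r * circle_dist a t ^+ 2.
  have sq (x y : R) : nc (Complex x y) ^+ 2 = x ^+ 2 + y ^+ 2.
    by rewrite sqr_sqrtr // addr_ge0 ?sqr_ge0.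
  case: a a1 => x y /(congr1 (fun u => u ^+ 2)); rewrite sq expr1n => xy.
  rewrite /circle_dist /cis /=; simpc; rewrite !sq.
  have := cos2Dsin2 (2 * pi * t); set c := cos _; set s := sin _ => cs.
  rewrite [RHS](_ : _ = 1 + r ^+ 2 - 2 * r * (c * x + s * y) +
     r * ((c ^+ 2 + s ^+ 2 - 1) + (x ^+ 2 + y ^+ 2 - 1))); last by ring.
  rewrite [LHS](_ : _ = (c ^+ 2 + s ^+ 2) + r ^+ 2 * (x ^+ 2 + y ^+ 2)
      - 2 * r * (c * x + s * y)); last by ring.
  by rewrite cs xy; ring.
rewrite -[LHS]ger0_norm ?nc_ge0 // -sqrtr_sqr E; congr (Num.sqrt (_ ^+ 2 + _)).
by rewrite /rho addrC addKr.
Qed.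

Let h_ge0 k t : 0 <= h k t.
Proof.
rewrite /h subr_ge0 ler_ln ?posrE ?circle_dist_gt0 //.
rewrite /circle_dist (le_trans (ncB _ _)) // nc_cis nc_rho.
by have := rho_le2 k; lra.
Qed.

Let h_nd t : {homo (h ^~ t) : m n / (m <= n)%N >-> m <= n}.
Proof.
move=> m n mn; rewrite /h lerD2l lerN2 ler_ln ?posrE ?circle_dist_gt0 //.
rewrite !circle_distE ler_wsqrtr //.
have hmn : harmonic n <= harmonic m :> R by rewrite /= lef_pV2 ?posrE // ler_nat.
have h0 : 0 <= harmonic n :> R by rewrite /= invr_ge0.
rewrite lerD // ?lerXn2r ?nnegrE //; first exact: le_trans hmn.
by rewrite ler_wpM2r ?sqr_ge0 // /rho lerD2l.
Qed.

Let harmonic_cvg0 : @harmonic R @ \oo --> 0.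
Proof. exact: cvg_harmonic. Qed.

Let h_cvg t : circle_dist a t != 0 -> h^~ t @ \oo --> ln 3 - log_dist a t.
Proof.
move=> d0; apply: cvgB; first exact: cvg_cst.
have d_gt0 : 0 < circle_dist a t by rewrite lt_def d0 nc_ge0.
apply: (@continuous_cvg _ _ _ _ _ _ (@ln R)); first exact: continuous_ln.
rewrite (_ : (fun k => _) = fun k =>
  Num.sqrt (harmonic k ^+ 2 + rho k * circle_dist a t ^+ 2)); last first.
  by apply/funext => k; exact: circle_distE.
rewrite -[X in _ --> X]ger0_norm ?nc_ge0 // -sqrtr_sqr.
apply: (@continuous_cvg _ _ _ _ _ _ (@Num.sqrt R)); first exact: sqrt_continuous.
rewrite -[X in _ --> X]add0r; apply: cvgD.
  rewrite [X in _ --> X](_ : 0 = 0 ^+ 2); last by rewrite expr0n.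
  apply: (@continuous_cvg _ _ _ _ _ _ (fun x : R => x ^+ 2)) => //.
  exact: exprn_continuous.
rewrite -[X in _ --> X]mul1r; apply: cvgM; last exact: cvg_cst.
rewrite -[X in _ --> X]addr0; apply: cvgD => //; exact: cvg_cst.
Qed.

Let D : set (measurableTypeR R) := `[0, 1]%classic.
Let mD : measurable D. Proof. exact: measurable_itv. Qed.

Let integral_h k : (\int[mu]_(t in D) (h k t)%:E = (ln 3 - ln (rho k))%:E)%E.
Proof.
have ih : mu.-integrable D (EFin \o (h k)).
  apply: integrable_continuous => t; apply: cvgB; first exact: cvg_cst.
  exact: continuous_log_dist.
rewrite -[LHS]fineK ?integrable_fin_num //; congr EFin.
rewrite -/(Rintegral _ _ _) RintegralB //.
- rewrite Rintegral_cst //= lebesgue_measure_itv /= lte_fin ltr01 oppr0 adde0 mulr1.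
  by rewrite -/(log_mean _) log_mean_gt1 nc_rho.
- by apply: integrable_continuous => t; exact: cvg_cst.
- by apply: integrable_continuous; exact: continuous_log_dist.
Qed.

Let hlim t : \bar R := limn (fun k => (h k t)%:E).

Let hE_nd t : nondecreasing_seq (fun k => (h k t)%:E).
Proof. by move=> m n mn; rewrite lee_fin h_nd. Qed.

Let hE_cvg t : (fun k => (h k t)%:E) @ \oo --> hlim t.
Proof. exact: ereal_nondecreasing_is_cvgn (hE_nd t). Qed.

Let m_h k : measurable_fun D (fun t => (h k t)%:E : \bar R).
Proof.
apply/measurable_EFinP; apply: measurable_funB; first exact: measurable_cst.
exact: measurable_log_dist.
Qed.

Let m_hlim : measurable_fun D hlim.
Proof.
apply: (@emeasurable_fun_cvg _ _ _ D (fun k t => (h k t)%:E) hlim m_h) => t _.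
exact: hE_cvg.
Qed.

Let h_le t k : ((h k t)%:E <= hlim t)%E.
Proof.
apply: lime_ge; first exact: ereal_nondecreasing_is_cvgn (hE_nd t).
by exists k => // n /= kn; exact: hE_nd.
Qed.

Let integral_hlim : (\int[mu]_(t in D) hlim t = (ln 3)%:E)%E.
Proof.
have h0 k t : D t -> (0 <= (h k t)%:E)%E by rewrite lee_fin h_ge0.
have cv := @cvg_monotone_convergence _ _ _ mu D mD (fun k t => (h k t)%:E) m_h
  h0 (fun t _ => hE_nd t).
have eqf : (fun k => \int[mu]_(t in D) (h k t)%:E)%E = (fun k => (ln 3 - ln (rho k))%:E).
  by apply/funext => k; exact: integral_h.
rewrite eqf in cv; apply: (cvg_unique _ cv) => //.
apply: cvg_EFin; first exact: nearW.
rewrite -[X in _ --> X]subr0; apply: cvgB; first exact: cvg_cst.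
rewrite -ln1; apply: (@continuous_cvg _ _ _ _ _ _ (@ln R)); first exact: continuous_ln.
rewrite -[X in _ --> X]addr0; apply: cvgD => //; exact: cvg_cst.
Qed.

Let hlim_ge0 t : (0 <= hlim t)%E.
Proof. by rewrite (le_trans _ (h_le t 0)) // lee_fin. Qed.

(** At a zero of the distance the limit of the [h k] is infinite, while its
    integral is finite. *)
Lemma circle_dist_ae_neq0 : {ae mu, forall t : measurableTypeR R, D t -> circle_dist a t != 0}.
Proof.
have ihlim : mu.-integrable D hlim.
  apply/integrableP; split => //.
  under eq_integral do rewrite gee0_abs //.
  by rewrite integral_hlim ltry.
move: (integrable_ae mD ihlim); apply: filterS => t /[apply] fin; apply/eqP => d0.
have := h_le t; move: fin; rewrite /h; case: (hlim t) => // x _ hx.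
have [m hm] := nat_ge (expR (x - ln 3)).
have := hx m; rewrite lee_fin /h /log_dist circle_distE d0 expr0n mulr0 addr0.
rewrite sqrtr_sqr ger0_norm /= ?invr_ge0 // lnV ?posrE // opprK => /=.
apply/negP; rewrite -ltNge -ltrBlDl -[ltLHS]expRK ltr_ln ?posrE ?expR_gt0 //.
by rewrite (le_lt_trans hm) // ltr_nat.
Qed.

Let ae_hlim : ae_eq mu D hlim (EFin \o (fun t => ln 3 - log_dist a t)).
Proof.
move: circle_dist_ae_neq0; apply: filterS => t /[apply] d0.
apply: cvg_lim => //; apply: cvg_EFin; first exact: nearW.
exact: h_cvg.
Qed.

Let lim_ge0 t : 0 <= ln 3 - log_dist a t.
Proof.
rewrite subr_ge0 /log_dist; have [->|d0] := eqVneq (circle_dist a t) 0.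
  by rewrite ln0 // ln_ge0 // ler1n.
have d_gt0 : 0 < circle_dist a t by rewrite lt_def d0 nc_ge0.
rewrite ler_ln ?posrE //.
by rewrite /circle_dist (le_trans (ncB _ _)) // nc_cis a1; lra.
Qed.

Let integral_lim : (\int[mu]_(t in D) (ln 3 - log_dist a t)%:E = (ln 3)%:E)%E.
Proof.
rewrite -integral_hlim; apply: ge0_ae_eq_integral => //.
- apply/measurable_EFinP; apply: measurable_funB; first exact: measurable_cst.
  exact: measurable_log_dist.
- by move=> t _; rewrite lee_fin.
- exact: ae_eq_sym.
Qed.

Let integrable_lim : mu.-integrable D (EFin \o (fun t => ln 3 - log_dist a t)).
Proof.
apply/integrableP; split.
  apply/measurable_EFinP; apply: measurable_funB; first exact: measurable_cst.
  exact: measurable_log_dist.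
under eq_integral do rewrite /= ger0_norm //.
by rewrite integral_lim ltry.
Qed.

Lemma integrable_log_dist_unit : mu.-integrable D (EFin \o log_dist a).
Proof.
have i3 : mu.-integrable D (EFin \o (fun=> ln 3)).
  by apply: integrable_continuous => t; exact: cvg_cst.
have := integrableB mD i3 integrable_lim; apply: eq_integrable => // t _.
by rewrite /= -EFinB subKr.
Qed.

Lemma log_mean_unit : log_mean a = 0.
Proof.
have i3 : mu.-integrable D (EFin \o (fun=> ln 3)).
  by apply: integrable_continuous => t; exact: cvg_cst.
have : \int[mu]_(t in D) (ln 3 - log_dist a t) = ln 3.
  by rewrite /Rintegral integral_lim.
rewrite RintegralB //; last exact: integrable_log_dist_unit.
rewrite Rintegral_cst //= lebesgue_measure_itv /= lte_fin ltr01 oppr0 adde0 mulr1.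
rewrite -/(log_mean a); lra.
Qed.

End UnitCircle.

End Jensen.

Section MahlerMeasure.
Variable R : realType.
Notation mu := (@lebesgue_measure R).
Notation D := (`[0, 1]%classic : set (measurableTypeR R)).

Lemma integrable_log_dist (a : R[i]) : mu.-integrable D (EFin \o log_dist a).
Proof.
have [a1|a1] := eqVneq (nc a) 1; first exact: integrable_log_dist_unit.
by apply: integrable_continuous; exact: continuous_log_dist.
Qed.

Lemma jensen (a : R[i]) : log_mean a = ln (Num.max 1 (nc a)).
Proof.
have [a1|a1] := ltP 1 (nc a); first by rewrite log_mean_gt1.
by rewrite ln1; case: (ltgtP (nc a) 1) a1 => // [/log_mean_lt1|/log_mean_unit].
Qed.

Lemma circle_dist_ae (a : R[i]) :
  {ae mu, forall t : measurableTypeR R, D t -> circle_dist a t != 0}.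
Proof.
have [a1|a1] := eqVneq (nc a) 1; first exact: circle_dist_ae_neq0.
by apply: aeW => t _; rewrite gt_eqF // circle_dist_gt0.
Qed.

Lemma log_dist_prod (s : seq R[i]) (c : R[i]) : c != 0 ->
  \int[mu]_(t in D) ln (nc (c *: \prod_(a <- s) ('X - a%:P)).[cis (2 * pi * t)]) =
  ln (nc c * \prod_(a <- s) Num.max 1 (nc a)).
Proof.
move=> c0; have c_gt0 : 0 < nc c by rewrite nc_gt0.
have mD : measurable D by exact: measurable_itv.
have evalE t : nc (c *: \prod_(a <- s) ('X - a%:P)).[cis (2 * pi * t)] =
    nc c * \prod_(a <- s) circle_dist a t.
  rewrite hornerZ ncM horner_prod nc_prod; congr (_ * _).
  by apply: eq_bigr => a _; rewrite hornerXsubC.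
have mprod : measurable_fun D (fun t => ln (nc c * \prod_(a <- s) circle_dist a t)).
  apply: measurable_funTS; apply: measurableT_comp; first exact: measurable_ln.
  apply: continuous_measurable_fun => t; apply: cvgM; first exact: cvg_cst.
  elim: s {evalE} => [|a s IHs].
    under eq_fun do rewrite big_nil. by rewrite big_nil; exact: cvg_cst.
  under eq_fun do rewrite big_cons; rewrite big_cons.
  by apply: cvgM => //; exact: continuous_circle_dist.
have sumE : ({ae mu, forall t : measurableTypeR R, D t ->
    ln (nc c * \prod_(a <- s) circle_dist a t) = ln (nc c) + \sum_(a <- s) log_dist a t}).
  suff : ({ae mu, forall t : measurableTypeR R, D t ->
     0 < \prod_(a <- s) circle_dist a t /\
    ln (\prod_(a <- s) circle_dist a t) = \sum_(a <- s) log_dist a t}).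
    by apply: filterS => t /[apply] -[p0 <-]; rewrite lnM // posrE.
  elim: s {evalE mprod} => [|a s IHs].
    by apply: aeW => t _; rewrite !big_nil ln1.
  apply: filterS2 (circle_dist_ae a) IHs => t da IHs Dt; rewrite !big_cons.
  have [p0 <-] := IHs Dt; have d0 : 0 < circle_dist a t by rewrite lt_def da ?nc_ge0.
  by rewrite mulr_gt0 // lnM.
have isum (s' : seq R[i]) : mu.-integrable D (EFin \o (fun t => ln (nc c) + \sum_(a <- s') log_dist a t)) /\
   \int[mu]_(t in D) (ln (nc c) + \sum_(a <- s') log_dist a t) = ln (nc c) + \sum_(a <- s') log_mean a.
  elim: s' => [|a s' [IHi IHs]].
    split.
      by apply: integrable_continuous => t; under eq_fun do rewrite big_nil; exact: cvg_cst.
    under eq_Rintegral do rewrite big_nil addr0.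
    by rewrite big_nil addr0 Rintegral_cst //= lebesgue_measure_itv /= lte_fin ltr01 oppr0 adde0 mulr1.
  have E t : ln (nc c) + \sum_(b <- a :: s') log_dist b t =
     log_dist a t + (ln (nc c) + \sum_(b <- s') log_dist b t).
    by rewrite big_cons addrCA.
  split.
    have := integrableD mD (integrable_log_dist a) IHi.
    by apply: eq_integrable => // t _; rewrite /= E.
  under eq_Rintegral do rewrite E.
  by rewrite (RintegralD mD (integrable_log_dist a) IHi) IHs big_cons [RHS]addrCA.
under eq_Rintegral do rewrite evalE.
have -> : \int[mu]_(t in D) ln (nc c * \prod_(a <- s) circle_dist a t) =
    \int[mu]_(t in D) (ln (nc c) + \sum_(a <- s) log_dist a t).
  rewrite /Rintegral; congr fine; apply: ae_eq_integral => //.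
  - exact/measurable_EFinP.
  - by have [/integrableP[]] := isum s.
  - by apply: filterS sumE => t /[apply] ->.
rewrite (isum s).2.
elim: s {isum evalE mprod sumE} => [|a s IHs]; first by rewrite !big_nil addr0 mulr1.
have m0 (b : R[i]) : 0 < Num.max 1 (nc b) by rewrite lt_max ltr01.
rewrite !big_cons mulrCA addrCA IHs jensen -lnM ?posrE //.
by rewrite mulr_gt0 // prodr_gt0.
Qed.

(** Jensen's formula for each root, summed: the logarithm is additive wherever no
    factor vanishes, which is almost everywhere on the circle. *)
Theorem mahler_measureE (f : {poly int}) (c : R[i]) (s : seq R[i]) : c != 0 ->
  pint R[i] f = c *: \prod_(a <- s) ('X - a%:P) ->
  mahler_measure R f = nc c * \prod_(a <- s) Num.max 1 (nc a).
Proof.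
move=> c0 fE; rewrite /mahler_measure -[X in map_poly X f]/(intr) -/(pint _ _) fE.
have := log_dist_prod s c0; rewrite /nc /cis => ->.
rewrite lnK // posrE mulr_gt0 ?nc_gt0 // prodr_gt0 // => a _.
by rewrite lt_max ltr01.
Qed.

End MahlerMeasure.

(** * Exponential growth rates *)
Section Growth.
Variable R : realType.
Implicit Types (u v : nat -> R) (M N : R) (P : nat -> Prop).

(** [u r] is [M ^ r] up to a subexponential factor, along the [r] satisfying [P]. *)
Definition growth P u M := forall e : R, 0 < e -> exists n0 : nat,
  forall r, (n0 <= r)%N -> P r ->
    expR (- (e * r%:R)) * M ^+ r <= u r <= expR (e * r%:R) * M ^+ r.

Lemma growthS P P' u M : (forall r, P' r -> P r) -> growth P u M -> growth P' u M.
Proof.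
by move=> PP gu e /gu[n0 hn0]; exists n0 => r nr /PP; exact: hn0.
Qed.

Lemma eq_growth P u v M : (forall r, (0 < r)%N -> P r -> u r = v r) ->
  growth P u M -> growth P v M.
Proof.
move=> uv gu e /gu[n0 hn0]; exists n0.+1 => r nr Pr.
by rewrite -uv //; [apply: hn0 => //; exact: ltnW|exact: leq_ltn_trans nr].
Qed.

Lemma growthM P u v M N : 0 <= M -> 0 <= N ->
  growth P u M -> growth P v N -> growth P (fun r => u r * v r) (M * N).
Proof.
move=> M0 N0 gu gv e e0; have e2 : 0 < e / 2 by rewrite divr_gt0.
have [n1 h1] := gu _ e2; have [n2 h2] := gv _ e2.
exists (maxn n1 n2) => r; rewrite geq_max => /andP[/h1 {}h1 /h2 {}h2] Pr.
have /andP[u1 u2] := h1 Pr; have /andP[v1 v2] := h2 Pr.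
have split (s : R) : expR (s * e * r%:R) * (M * N) ^+ r =
    (expR (s * (e / 2) * r%:R) * M ^+ r) * (expR (s * (e / 2) * r%:R) * N ^+ r).
  have -> : s * e * r%:R = s * (e / 2) * r%:R + s * (e / 2) * r%:R by field.
  by rewrite expRD exprMn; ring.
have := split 1; rewrite !mul1r => ->.
have := split (-1); rewrite !mulN1r !mulNr => ->.
have p1 : 0 <= expR (- (e / 2 * r%:R)) * M ^+ r by rewrite mulr_ge0 ?expR_ge0 ?exprn_ge0.
have p2 : 0 <= expR (- (e / 2 * r%:R)) * N ^+ r by rewrite mulr_ge0 ?expR_ge0 ?exprn_ge0.
apply/andP; split; apply: ler_pM => //; first exact: le_trans p1 u1.
exact: le_trans p2 v1.
Qed.

Lemma growth_bounded P u m M : 0 < m -> (forall r, P r -> m <= u r <= M) -> growth P u 1.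
Proof.
move=> m0 uP e e0.
have [n1 h1] := nat_ge (m^-1 / e); have [n2 h2] := nat_ge (M / e).
exists (maxn n1 n2) => r; rewrite geq_max => /andP[nr1 nr2] Pr.
have /andP[u1 u2] := uP _ Pr; rewrite expr1n !mulr1; apply/andP; split.
  apply: le_trans u1; rewrite expRN -[leRHS]invrK lef_pV2 ?posrE ?expR_gt0 ?invr_gt0 //.
  apply: le_trans (expR_ge1Dx _); apply: (@le_trans _ _ (e * r%:R)); last by rewrite lerDr.
  by rewrite mulrC -ler_pdivrMr // (le_trans h1) // ler_nat.
apply: (le_trans u2); apply: le_trans (expR_ge1Dx _).
apply: (@le_trans _ _ (e * r%:R)); last by rewrite lerDr.
by rewrite mulrC -ler_pdivrMr // (le_trans h2) // ler_nat.
Qed.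

Lemma growth_cst P (c : R) : 0 < c -> growth P (fun=> c) 1.
Proof. by move=> c0; apply: (@growth_bounded _ _ c c) => // r _; rewrite lexx. Qed.

Lemma growth_exp P M : 0 < M -> growth P (fun r => M ^+ r) M.
Proof.
move=> M0 e e0; exists 0%N => r _ _.
have er0 : 0 <= e * r%:R by rewrite mulr_ge0 // ltW.
have Mr : 0 < M ^+ r by rewrite exprn_gt0.
have E1 : 1 <= expR (e * r%:R) by rewrite (le_trans _ (expR_ge1Dx _)) // lerDl.
by rewrite ger_pMl // ler_pMl // expRN invf_le1 ?expR_gt0 // E1.
Qed.

Lemma growth_inv P u M : 0 < M -> growth P u M -> growth P (fun r => (u r)^-1) M^-1.
Proof.
move=> M0 gu e /gu[n0 hn0]; exists n0 => r nr Pr.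
have /andP[u1 u2] := hn0 r nr Pr.
have p1 (x : R) : 0 < expR x * M ^+ r by rewrite mulr_gt0 ?expR_gt0 ?exprn_gt0.
have u0 : 0 < u r by rewrite (lt_le_trans _ u1).
have E (x : R) : expR (- x) * M^-1 ^+ r = (expR x * M ^+ r)^-1.
  by rewrite expRN exprVn invfM.
by rewrite E lef_pV2 ?posrE // u2 -[e * r%:R]opprK E lef_pV2 ?posrE ?opprK.
Qed.

Lemma growth_id P : growth P (fun r => r%:R) 1.
Proof.
move=> e e0; have [n1 h1] := nat_ge (4 / e ^+ 2).
exists n1.+1 => r nr Pr; rewrite expr1n !mulr1.
have r0 : (0 < r)%N by exact: leq_trans nr.
have rR : 0 < r%:R :> R by rewrite ltr0n.
apply/andP; split.
  apply: (@le_trans _ _ 1); last by rewrite ler1n.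
  rewrite expRN invf_le1 ?expR_gt0 //.
  by rewrite (le_trans _ (expR_ge1Dx _)) // lerDl mulr_ge0 // ltW.
have -> : e * r%:R = e * r%:R / 2 + e * r%:R / 2 by field.
rewrite expRD.
have h : e * r%:R / 2 <= expR (e * r%:R / 2).
  by rewrite (le_trans _ (expR_ge1Dx _)) // lerDr.
have h0 : 0 <= e * r%:R / 2 by rewrite divr_ge0 // mulr_ge0 // ltW.
apply: le_trans (ler_pM h0 h0 h h).
have -> : e * r%:R / 2 * (e * r%:R / 2) = r%:R * (r%:R * (e ^+ 2 / 4)) by field.
rewrite ler_pMr //.
have : 4 / e ^+ 2 <= r%:R by rewrite (le_trans h1) // ler_nat ltnW.
by rewrite ler_pdivrMr ?exprn_gt0 // mulrA ler_pdivlMr // mul1r.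
Qed.

(** Subexponential factors disappear in the [r]-th root. *)
Lemma growth_powR u M P : 0 < M -> growth P u M -> forall eta, 0 < eta ->
  exists n0 : nat, forall r, (n0 <= r)%N -> P r -> `|u r `^ r%:R^-1 - M| <= eta.
Proof.
move=> M0 gu eta eta0.
have cE : expR x @[x --> (0:R)] --> (1 : R) by rewrite -expR0; exact: continuous_expR.
have etaM : 0 < eta / M by rewrite divr_gt0.
have /nbhs_ballP[d /= d0 hd] : \forall x \near (0:R), `|1 - expR x| < eta / M.
  by move/cvgrPdist_lt : cE; apply.
have [e e0 ed] : exists2 e, 0 < e & e < d by exists (d / 2); [rewrite divr_gt0|rewrite ltr_pdivrMr // ltr_pMr // ltr1n].
have he (s : R) : `|s| <= e -> `|1 - expR s| < eta / M.
  by move=> se; apply: hd; rewrite /ball /= sub0r normrN (le_lt_trans se).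
have [n0 hn0] := gu _ e0; exists n0.+1 => r nr Pr.
have r0 : (0 < r)%N by exact: leq_trans nr.
have /andP[u1 u2] := hn0 r (ltnW nr) Pr.
have ME s : (expR (s * r%:R) * M ^+ r) `^ r%:R^-1 = expR s * M.
  rewrite powRM ?expR_ge0 ?exprn_ge0 ?ltW //.
  by rewrite -powR_mulrn ?ltW // -powRrM divff ?pnatr_eq0 -?lt0n // powRr1 ?ltW //
    -expRM mulfK ?pnatr_eq0 -?lt0n.
have p1 : 0 < expR (- (e * r%:R)) * M ^+ r by rewrite mulr_gt0 ?expR_gt0 ?exprn_gt0.
have u0 : 0 <= u r by rewrite ltW // (lt_le_trans p1).
have ri : 0 <= r%:R^-1 :> R by rewrite invr_ge0.
have l1 : expR (- e) * M <= u r `^ r%:R^-1.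
  by rewrite -ME mulNr; apply: ge0_ler_powR => //; rewrite nnegrE // ltW.
have l2 : u r `^ r%:R^-1 <= expR e * M.
  by rewrite -ME; apply: ge0_ler_powR => //; rewrite nnegrE // (le_trans u0).
have e1 : `|1 - expR e| < eta / M by apply: he; rewrite gtr0_norm.
have e2 : `|1 - expR (- e)| < eta / M by apply: he; rewrite normrN gtr0_norm.
have e1' : (expR e - 1) * M < eta.
  by rewrite -ltr_pdivlMr //; rewrite distrC in e1; exact: le_lt_trans (ler_norm _) e1.
have e2' : (1 - expR (- e)) * M < eta.
  by rewrite -ltr_pdivlMr //; exact: le_lt_trans (ler_norm _) e2.
rewrite mulrBl mul1r in e1'; rewrite mulrBl mul1r in e2'.
by rewrite ler_norml; apply/andP; split; lra.
Qed.

End Growth.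

(** * Products over roots of unity *)
Section CyclicProducts.
Variable R : realType.
Implicit Types (a : R[i]) (p : {poly R[i]}).

Definition zeta (r z : nat) : R[i] := cis (2 * pi * z%:R / r%:R).

Lemma zetaX r z : zeta r 1 ^+ z = zeta r z.
Proof. by rewrite /zeta cisX; congr cis; ring. Qed.

Lemma zeta_prim r : (0 < r)%N -> r.-primitive_root (zeta r 1).
Proof.
move=> r0; have rR : 0 < r%:R :> R by rewrite ltr0n.
have zr : zeta r 1 ^+ r = 1.
  by rewrite zetaX /zeta mulfK ?gt_eqF // cis2pi.
have [m mp mr] := @prim_order_exists _ r (zeta r 1) r0 zr.
have m0 := prim_order_gt0 mp.
have [mE|mNr] := eqVneq m r; first by rewrite mE in mp.
have lt_mr : (m < r)%N by rewrite ltn_neqAle mNr dvdn_leq.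
have := nc_cisB1 (2 * pi * m%:R / r%:R : R).
have -> : cis (2 * pi * m%:R / r%:R) = 1 :> R[i].
  by rewrite -/(zeta r m) -zetaX prim_expr_order.
have -> : 2 * pi * m%:R / r%:R = (pi * m%:R / r%:R) *+ 2 :> R by rewrite -mulr_natr; ring.
rewrite subrr nc0 expr0n mulr2n cosD -!expr2 cos2sin2 /=.
have s0 : 0 < sin (pi * m%:R / r%:R : R).
  apply: sin_gt0_pi; rewrite divr_gt0 ?mulr_gt0 ?pi_gt0 ?ltr0n //=.
  by rewrite ltr_pdivrMr // ltr_pM2l ?pi_gt0 // ltr_nat.
have := exprn_gt0 2 s0; lra.
Qed.

(** The contribution of the root [a] of a polynomial to the product of its
    values at the nontrivial [r]-th roots of unity. *)
Definition root_term a (r : nat) : R := \prod_(1 <= z < r) nc (zeta r z - a).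

Lemma root_termE a r : (0 < r)%N -> nc (1 - a) * root_term a r = nc (a ^+ r - 1).
Proof.
move=> r0; have := factor_Xn_sub_1 (zeta_prim r0).
move=> /(congr1 (fun q => nc q.[a])); rewrite hornerD hornerN hornerXn hornerC.
move=> <-; rewrite horner_prod nc_prod big_ltn //= /root_term; congr (_ * _).
  by rewrite expr0 hornerXsubC ncBC.
by apply: eq_bigr => z _; rewrite hornerXsubC zetaX ncBC.
Qed.

Lemma root_term1 r : (0 < r)%N -> root_term 1 r = r%:R.
Proof.
move=> r0; have := factor_Xn_sub_1 (zeta_prim r0).
rewrite big_ltn // expr0 -[X in _ = _ - X](expr1n _ r) subrXX /=.
have X1 : ('X - 1%:P : {poly R[i]}) != 0 by rewrite polyXsubC_eq0.
move=> /(mulfI X1)/(congr1 (fun q => nc q.[1])).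
rewrite horner_prod nc_prod /root_term => E.
transitivity (\prod_(1 <= z < r) nc ('X - (zeta r 1 ^+ z)%:P).[1]).
  by apply: eq_bigr => z _; rewrite hornerXsubC zetaX ncBC.
rewrite E horner_sum (eq_bigr (fun=> 1)) => [|i _].
  by rewrite sumr_const card_ord nc_nat.
by rewrite hornerM !hornerE !expr1n mulr1.
Qed.

(** The term is [|a ^ r - 1|] divided by the constant [|a - 1|], except that it
    is [r] for [a = 1]. Off the unit circle the growth of [|a ^ r - 1|] is
    clear; for a root of unity it takes finitely many values; the remaining
    case is Gelfond's theorem. *)
Lemma growth_root_term a (f : {poly int}) : f != 0 -> root (pint R[i] f) a ->
  growth (fun r => root_term a r != 0) (root_term a) (Num.max 1 (nc a)).
Proof.
move=> f0 fa.
have [->|a1] := eqVneq a 1.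
  rewrite nc1 maxxx; apply: eq_growth (@growth_id R _) => r r0 _.
  by rewrite root_term1.
set P := fun r => _.
have na1 : 0 < nc (1 - a) by rewrite nc_gt0 subr_eq0 eq_sym.
pose Q r := (0 < r)%N /\ a ^+ r != 1.
suff gQ : growth Q (fun r => nc (a ^+ r - 1)) (Num.max 1 (nc a)).
  apply: (@eq_growth _ _ (fun r => (nc (1 - a))^-1 * nc (a ^+ r - 1))).
    by move=> r r0 _; rewrite -root_termE // mulKf // gt_eqF.
  rewrite -[X in growth _ _ X]mul1r; apply: growthM => //.
  - by rewrite le_max ler01.
  - by apply: growth_cst; rewrite invr_gt0.
  move=> e e0; have [n0 hn0] := gQ e e0; exists n0.+1 => r nr Pr.
  apply: hn0; first exact: ltnW.
  have r0 : (0 < r)%N by exact: leq_trans nr.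
  split=> //; apply: contra_neqN (Pr) => /eqP ar.
  have := root_termE a r0; rewrite ar subrr nc0 => /eqP.
  by rewrite mulf_eq0 (gt_eqF na1) => /eqP.
have upper r : nc (a ^+ r - 1) <= nc a ^+ r + 1.
  by rewrite (le_trans (ncB _ _)) // nc1 ncX.
have [a_gt1|a_le1] := ltP 1 (nc a).
  have na0 : 0 < nc a by rewrite (lt_trans _ a_gt1).
  apply: (@eq_growth _ _ (fun r => nc a ^+ r * (nc (a ^+ r - 1) / nc a ^+ r))).
    by move=> r _ _; rewrite mulrC divfK // expf_neq0 // gt_eqF.
  rewrite -[X in growth _ _ X]mulr1; apply: growthM => //; first exact: ltW.
    exact: growth_exp.
  apply: (@growth_bounded _ _ _ (1 - (nc a)^-1) 2).
    by rewrite subr_gt0 invf_lt1.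
  move=> r [r0 _]; have ar0 : 0 < nc a ^+ r by rewrite exprn_gt0.
  have ar1 : nc a <= nc a ^+ r by rewrite -{1}[nc a]expr1 ler_weXn2l // ltW.
  rewrite ler_pdivlMr // ler_pdivrMr //; apply/andP; split.
    have := ncB_ge (a ^+ r) 1; rewrite nc1 ncX; apply: le_trans.
    rewrite mulrBl mul1r lerD2l lerN2 ler_pdivlMl ?mulr1 //.
  by rewrite (le_trans (upper r)) // mulrDl !mul1r lerD2l (le_trans (ltW a_gt1)).
have up2 r : nc (a ^+ r - 1) <= 2.
  by rewrite (le_trans (upper r)) // -[2]/(1 + 1) lerD2r exprn_ile1 // nc_ge0.
have [a_eq1|a_ne1] := eqVneq (nc a) 1; last first.
  have a_lt1 : nc a < 1 by rewrite lt_neqAle a_ne1.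
  apply: (@growth_bounded _ _ _ (1 - nc a) 2); first by rewrite subr_gt0.
  move=> r [r0 _]; rewrite up2 andbT ncBC.
  have := ncB_ge 1 (a ^+ r); rewrite nc1 ncX; apply: le_trans.
  rewrite lerD2l lerN2; case: r r0 => // r _.
  by rewrite exprS ler_piMr ?nc_ge0 // exprn_ile1 // nc_ge0.
have [[d [d0 ad]]|nru] := pselect (exists d, (0 < d)%N /\ a ^+ d = 1).
  pose F (i : 'I_d) := if a ^+ i == 1 then 1 else nc (a ^+ i - 1).
  have F0 i : 0 < F i by rewrite /F; case: ifPn => // ai; rewrite nc_gt0 subr_eq0.
  have [m m0 mF] := positive_lower_bound F0.
  apply: (@growth_bounded _ _ _ m 2) => // r [r0 ar]; rewrite up2 andbT.
  have arE : a ^+ r = a ^+ (r %% d) by rewrite -(expr_mod r ad).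
  by have := mF (Ordinal (ltn_pmod r d0)); rewrite /F /= -arE (negPf ar).
have anu n : (0 < n)%N -> a ^+ n != 1.
  by move=> n0; apply/eqP => an; apply: nru; exists n.
move=> e e0; have [n0 hn0] := gelfond a_eq1 anu f0 fa e0.
have two := @growth_cst R Q 2 (ltr0n R 2).
have [n1 hn1] := two e e0.
exists (maxn n0 n1) => r; rewrite geq_max => /andP[nr0 nr1] Qr.
rewrite expr1n !mulr1 hn0 //=.
by have := hn1 _ nr1 Qr; rewrite expr1n !mulr1 => /andP[_]; apply: le_trans.
Qed.

(** The root of unity [1] is left out: it accounts for the lowest coefficient of
    the determinant at the trivial character, which is a constant. *)
Definition cyclic_product p (r : nat) : R := \prod_(1 <= z < r) nc p.[zeta r z].

(** The product splits over the roots of [f], and the leading coefficient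
    occurs [r - 1] times. *)
Theorem growth_cyclic_product (f : {poly int}) : f != 0 ->
  growth (fun r => cyclic_product (pint _ f) r != 0) (cyclic_product (pint _ f))
    (mahler_measure R f).
Proof.
move=> f0; pose p := pint R[i] f.
have p0 : p != 0 by rewrite /p map_poly_eq0_id0 // intr_eq0 lead_coef_eq0.
have [s ps] := closed_field_poly_normal p.
set c := lead_coef p in ps.
have c0 : c != 0 by rewrite lead_coef_eq0.
rewrite (mahler_measureE c0 ps) -/p.
have cE r : (0 < r)%N -> cyclic_product p r =
    (nc c)^-1 * nc c ^+ r * \prod_(a <- s) root_term a r.
  move=> r0; have -> : (nc c)^-1 * nc c ^+ r = nc c ^+ r.-1.
    by case: r r0 => // r _; rewrite exprS mulKf // nc_eq0.
  rewrite /cyclic_product /root_term exchange_big /=.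
  under eq_bigr do rewrite ps hornerZ ncM.
  rewrite big_split /= prodr_const_nat subn1; congr (_ * _).
  apply: eq_bigr => z _; rewrite horner_prod nc_prod.
  by apply: eq_bigr => a _; rewrite hornerXsubC.
apply: (@eq_growth _ _ (fun r => (nc c)^-1 * nc c ^+ r * \prod_(a <- s) root_term a r)).
  by move=> r r0 _; rewrite cE.
have max_ge0 a : 0 <= Num.max 1 (nc a) by rewrite le_max ler01.
have nc_c : 0 < nc c by rewrite nc_gt0.
apply: growthM; rewrite ?nc_ge0 // ?prodr_ge0 //.
  rewrite -[X in growth _ _ X]mul1r; apply: growthM; rewrite ?nc_ge0 //.
    by apply: growth_cst; rewrite invr_gt0.
  exact: growth_exp.
pose P' r := (0 < r)%N /\ all (fun a => root_term a r != 0) s.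
suff gP : growth P' (fun r => \prod_(a <- s) root_term a r) (\prod_(a <- s) Num.max 1 (nc a)).
  move=> e e0; have [n0 hn0] := gP e e0; exists n0.+1 => r nr Pr.
  apply: hn0; first exact: ltnW.
  have r0 : (0 < r)%N by exact: leq_trans nr.
  split=> //; apply/allP => a sa; apply: contraNneq Pr => ra.
  by rewrite cE // (big_rem a) //= ra mul0r mulr0.
have : all (root p) s.
  apply/allP => a sa; rewrite ps rootE hornerZ horner_prod (big_rem a) //=.
  by rewrite hornerXsubC subrr mul0r mulr0.
rewrite /P'; elim: s {ps cE P'} => [|a s IHs] /=.
  move=> _; rewrite big_nil; apply: (@eq_growth _ _ (fun=> 1)); last exact: growth_cst.
  by move=> r _ _; rewrite big_nil.
move=> /andP[ra rs]; rewrite big_cons.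
apply: (@eq_growth _ _ (fun r => root_term a r * \prod_(a <- s) root_term a r)).
  by move=> r _ _; rewrite big_cons.
apply: growthM; rewrite ?prodr_ge0 //.
  by apply: growthS (growth_root_term f0 ra) => r [_ /andP[]].
by apply: growthS (IHs rs) => r [r0 /andP[_ ?]].
Qed.

End CyclicProducts.

(** * Tree complexity of a finite graph *)
Lemma fsbig_image (R : Type) (idx : R) (op : Monoid.com_law idx) (I : finType)
    (T : choiceType) (h : I -> T) (P : pred I) (A : set T) (f : T -> R) :
  {in P &, injective h} -> A = h @` [set i | P i] ->
  \big[op/idx]_(x \in A) f x = \big[op/idx]_(i | P i) f (h i).
Proof.
move=> hinj ->; rewrite (fsbigE [seq h i | i <- enum P]).
- rewrite big_map big_enum_cond; apply: eq_bigl => i; rewrite unfold_in.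
  by case Pi: (P i) => //=; apply/mem_set; exists i.
- by rewrite map_inj_in_uniq ?enum_uniq // => i j; rewrite !mem_enum; exact: hinj.
- by move=> x /= /mapP[j]; rewrite mem_enum => Pj ->; exists j.
- by move=> x [i Pi <-] /negP[]; apply: map_f; rewrite mem_enum.
Qed.

Section Presentation.
Variables (H : sgraph) (N : nat) (E : finType) (s t : E -> 'I_N).
Variables (phi : 'I_N -> vertex H) (psi : E -> edge H).
Hypothesis phi_bij : bijective phi.
Hypothesis psi_bij : bijective psi.
Hypothesis ends_psi : forall e, ends (psi e) = [set phi (s e); phi (t e)].
Implicit Types (F : {set E}) (e : E) (u v r : 'I_N).

Let phi_inj : injective phi := bij_inj phi_bij.
Let psi_inj : injective psi := bij_inj psi_bij.
Let phi_surj x : exists v, phi v = x.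
Proof. by case: phi_bij => g _ gK; exists (g x). Qed.
Let psi_surj x : exists e, psi e = x.
Proof. by case: psi_bij => g _ gK; exists (g x). Qed.

Notation conn := (conn s t).
Notation adj := (adj s t).
Definition sgn e : int := edge_sign (psi e).

Definition edge_set F : set (edge H) := psi @` [set e | e \in F].

Lemma edge_setE F e : edge_set F (psi e) <-> e \in F.
Proof. by split=> [[e' eF /psi_inj <-]|eF] //; exists e. Qed.

Lemma ends_psiE e u v : ends (psi e) = [set phi u; phi v] <->
  (s e = u /\ t e = v) \/ (s e = v /\ t e = u).
Proof.
rewrite ends_psi; split=> [|[[-> ->]//|[-> ->]]]; last by rewrite setUC.
move=> /seteqP[h1 h2].
have := h1 (phi (s e)) (or_introl erefl); have := h1 (phi (t e)) (or_intror erefl).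
have := h2 (phi u) (or_introl erefl); have := h2 (phi v) (or_intror erefl).
move=> /= [/phi_inj|/phi_inj] a [/phi_inj|/phi_inj] b [/phi_inj|/phi_inj] c [/phi_inj|/phi_inj] d;
  subst; by [left|right].
Qed.

Lemma walk_conn F u v w : walk (edge_set F) (phi u) w (phi v) -> conn F u v.
Proof.
elim: w u => [|[x y] w IHw] u /=; first by move=> /phi_inj ->; exact: conn_refl.
have [e <-] := psi_surj x; have [z <-] := phi_surj y.
move=> [/edge_setE eF /ends_psiE uz /IHw]; apply: conn_trans.
by case: uz => -[<- <-]; last rewrite conn_sym; exact: conn_edge.
Qed.

Lemma walk_path F u p : path (adj F) u p -> uniq (u :: p) ->
  exists w, [/\ walk (edge_set F) (phi u) w (phi (last u p)),
    unzip2 w = map phi p, uniq (unzip1 w) &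
    forall x, x \in unzip1 w -> exists e, [/\ psi e = x, e \in F, s e \in u :: p & t e \in u :: p]].
Proof.
elim: p u => [|z p IHp] u; first by exists [::].
move=> /= /andP[/existsP[e /andP[eF uz]] zp] /and3P[uzp zNp pu].
have [|w [wk w2 w1 we]] := IHp z zp; first by rewrite /= zNp.
have uz' : (s e = u /\ t e = z) \/ (s e = z /\ t e = u).
  by case/orP: uz => /andP[/eqP -> /eqP ->]; [left|right].
exists ((psi e, phi z) :: w); split=> /=.
- by split=> //; [exact/edge_setE|exact/ends_psiE].
- by rewrite w2.
- rewrite w1 andbT; apply: contra uzp => /we[e' [/psi_inj-> _ se te]].
  by case: uz' => -[su tu]; [rewrite -su|rewrite -tu].
- move=> x; rewrite inE => /orP[/eqP ->|/we[e' [e'x e'F se te]]].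
    exists e; rewrite eF; split=> //.
      by case: uz' => -[-> _]; rewrite !inE eqxx ?orbT.
    by case: uz' => -[_ ->]; rewrite !inE eqxx ?orbT.
  by exists e'; split=> //; rewrite inE ?se ?te orbT.
Qed.

Lemma conn_walk F u v : conn F u v <-> exists w, walk (edge_set F) (phi u) w (phi v).
Proof.
split=> [|[w]]; last exact: walk_conn.
move=> /connectP[p /shortenP[q uq q_uniq _] ->].
by have [w [wk _ _ _]] := walk_path uq q_uniq; exists w.
Qed.

Lemma edge_setT : edge_set finset.setT = setT.
Proof.
apply/seteqP; split=> // x _; have [e <-] := psi_surj x.
by apply/edge_setE; rewrite finset.in_setT.
Qed.

Notation rt := (rt s t).
Notation roots := (roots s t).
Notation cls := (cls s t).

Definition cls_set r : set (vertex H) := phi @` [set v | v \in cls r].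

Lemma cls_setE r v : cls_set r (phi v) <-> rt v = r.
Proof.
split=> [[v']|<-]; first by rewrite /= inE => /eqP <- /phi_inj ->.
by exists v; rewrite //= inE.
Qed.

Lemma componentE v : component (phi v) = cls_set (rt v).
Proof.
apply/seteqP; split=> x; have [u <-] := phi_surj x.
  move=> [w]; rewrite -edge_setT => /walk_conn/rtP vu.
  by apply/cls_setE; rewrite vu.
move=> /cls_setE uv; rewrite /component /= -edge_setT; apply/conn_walk.
by apply/rtP.
Qed.

Lemma componentsE : @components H = cls_set @` [set r | r \in roots].
Proof.
apply/seteqP; split=> C.
  by move=> [x _ <-]; have [v <-] := phi_surj x; exists (rt v); [exact: rt_roots|rewrite componentE].
by move=> [r]; rewrite /= inE => /eqP rr <-; exists (phi r); rewrite // componentE rr.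
Qed.

Lemma cls_set_inj : {in roots &, injective cls_set}.
Proof.
move=> r r'; rewrite !inE => /eqP rr /eqP rr' rE.
have : cls_set r' (phi r) by rewrite -rE; apply/cls_setE.
by move=> /cls_setE; rewrite rr.
Qed.

(** A cycle amounts to an edge whose ends remain joined after its removal. *)
Lemma forest_acyclic F : forest s t F <-> forall x w, ~ cycle_in (edge_set F) x w.
Proof.
split=> [/forestP fF x w|acyc].
  case: w => [[]//|[y z] w] [_ [/= ey xz zx]].
  have [u ux] := phi_surj x; have [v vz] := phi_surj z.
  move: ey => [e eF ey]; subst x y z => /andP[eNw w1] _.
  have zu : walk (edge_set (F :\ e)) (phi v) w (phi u).
    elim: w (phi v) zx {w1 xz} eNw => //= -[y z] w IHw v' [ey vz wk].
    rewrite inE negb_or => /andP[ye eNw]; split=> //; last exact: IHw.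
    have [e' e'y] := psi_surj y; rewrite -e'y in ye ey *.
    apply/edge_setE; rewrite !inE; move/edge_setE : ey => ->; rewrite andbT.
    by apply: contraNneq ye => ->.
  have vu := walk_conn zu; case/negP: (fF e eF).
  by case/ends_psiE: xz => -[-> ->]; rewrite // conn_sym.
apply/forestP => e eF; apply/negP; rewrite conn_sym => /connectP[p /shortenP[q uq q_uniq _]] sE.
have [w [wk w2 w1 we]] := walk_path uq q_uniq.
apply: (acyc (phi (s e)) ((psi e, phi (t e)) :: w)); split=> //=.
- split; [exact/edge_setE|exact: ends_psi|].
  have sub (a b : vertex H) : walk (edge_set (F :\ e)) a w b -> walk (edge_set F) a w b.
    elim: (w) a => //= -[y z] w' IHw a [[e' + <-] az wk']; rewrite /= !inE => /andP[_ e'F].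
    by split=> //; [exact/edge_setE|exact: IHw].
  by rewrite sE; exact: sub.
- rewrite w1 andbT; apply/negP => /we[e' [/psi_inj-> + _ _]].
  by rewrite !inE eqxx.
- have : uniq (map phi (t e :: q)) by rewrite map_inj_uniq.
  by rewrite /= -w2.
Qed.

Definition tree_in r F : bool :=
  [&& F \subset [set e | rt (s e) == r]%SET, [forall v in cls r, conn F v r] & forest s t F].

Lemma spanning_treeE r F : r \in roots ->
  spanning_tree (cls_set r) (edge_set F) <-> tree_in r F.
Proof.
move=> rR; have rr : rt r = r by move: rR; rewrite inE => /eqP.
split=> [[Fr Fc /forest_acyclic fF]|/and3P[/fintype.subsetP Fr /forall_inP Fc /forest_acyclic fF]].
  apply/and3P; split=> //.
    apply/fintype.subsetP => e eF; rewrite inE; apply/eqP/cls_setE.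
    apply: (Fr (psi e)); first exact/edge_setE.
    by rewrite ends_psi; left.
  apply/forall_inP => v; rewrite inE => /eqP vr.
  have [||w] := Fc (phi v) (phi r); [exact/cls_setE|exact/cls_setE|].
  exact: walk_conn.
split=> //.
  move=> _ [e eF <-]; rewrite ends_psi; have := Fr e eF; rewrite inE => /eqP se.
  move=> x [] ->; apply/cls_setE => //.
  by rewrite -se; apply/esym/(rt_conn (conn_edge s t eF)).
move=> x y; have [u <-] := phi_surj x; have [v <-] := phi_surj y.
move=> /cls_setE ur /cls_setE vr; apply/conn_walk.
have uc : conn F u r by apply: Fc; rewrite inE ur.
have vc : conn F v r by apply: Fc; rewrite inE vr.
by apply: (conn_trans uc); rewrite conn_sym.
Qed.

Lemma edge_set_inj : injective edge_set.
Proof.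
move=> F F' FF'; apply/setP => e; apply/idP/idP => eF; apply/edge_setE.
  by rewrite -FF'; apply/edge_setE.
by rewrite FF'; apply/edge_setE.
Qed.

Lemma spanning_tree_image r : r \in roots ->
  spanning_tree (cls_set r) = edge_set @` [set F | tree_in r F].
Proof.
move=> rR; apply/seteqP; split=> [T sT|_ [F tF <-]]; last exact/spanning_treeE.
have TE : T = edge_set [set e | `[< T (psi e) >]]%SET.
  apply/seteqP; split=> x; have [e <-] := psi_surj x.
    by move=> Te; apply/edge_setE; rewrite inE; apply/asboolP.
  by move=> /edge_setE; rewrite inE => /asboolP.
exists [set e | `[< T (psi e) >]]%SET => //=.
by apply/spanning_treeE => //; rewrite -TE.
Qed.

Definition tree_sum r : int := \sum_(F | tree_in r F) \prod_(e in F) sgn e.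

Lemma component_complexityE r : r \in roots ->
  component_complexity (cls_set r) = `|tree_sum r|.
Proof.
move=> rR; rewrite /component_complexity; congr `|_|.
rewrite (@fsbig_image _ _ _ _ _ edge_set (tree_in r) _ _ _ (spanning_tree_image rR)); last first.
  by move=> F F' _ _; exact: edge_set_inj.
apply: eq_bigr => F _; apply: (@fsbig_image _ _ _ _ _ psi (fun e => e \in F)) => //.
by move=> e e' _ _; exact: psi_inj.
Qed.

Lemma conn_cls F r v : rt v = r ->
  conn (F :&: [set e | rt (s e) == r])%SET v =1 conn F v.
Proof.
move=> vr w; apply/idP/idP; first by apply: connS; exact: finset.subsetIl.
move=> vw; apply: (@conn_ind _ _ s t F (fun w => conn (F :&: [set e | rt (s e) == r])%SET v w)) vw _;
  last exact: conn_refl.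
move=> e eF; have st := rt_conn (conn_edge s t eF).
split=> ve.
  apply: (conn_trans ve); apply: conn_edge; rewrite !inE eF /=.
  by rewrite -(rt_conn ve) vr.
apply: (conn_trans ve); rewrite conn_sym; apply: conn_edge; rewrite !inE eF /=.
by rewrite st -(rt_conn ve) vr.
Qed.

Lemma forest_sumE : forest_sum s t sgn = \prod_(r in roots) tree_sum r.
Proof.
rewrite /tree_sum (big_distr_big_dep finset.set0) /=.
pose part (F : {set E}) r : {set E} := (F :&: [set e | rt (s e) == r])%SET.
pose h (F : {set E}) : {ffun 'I_N -> {set E}} :=
  [ffun r => if r \in roots then part F r else finset.set0].
pose h' (g : {ffun 'I_N -> {set E}}) : {set E} := (\bigcup_(r in roots) g r)%SET.
have gsub g r e : g \in pfamily finset.set0 (mem roots) tree_in -> r \in roots -> e \in g r -> rt (s e) = r.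
  move=> /pfamilyP[_ gP] rR; have /and3P[/fintype.subsetP gr _ _] := gP r rR.
  by move=> /gr; rewrite inE => /eqP.
have part_h' g r : g \in pfamily finset.set0 (mem roots) tree_in -> r \in roots -> part (h' g) r = g r.
  move=> gf rR; apply/setP => e; rewrite !inE; apply/andP/idP => [[/bigcupP[r' rR' er'] /eqP er]|er].
    by rewrite -er (gsub g r' e gf rR' er').
  by split; [apply/bigcupP; exists r|rewrite (gsub g r e gf rR er)].
rewrite [RHS](reindex_onto h h') /=; last first.
  move=> g gf; apply/ffunP => r; rewrite ffunE; case: ifPn => rR; first exact: part_h'.
  have /pfamilyP[gs _] := gf; apply/esym/eqP; apply: contraNT rR => gr.
  by apply: (fintype.subsetP gs); rewrite inE.
have hK F : h' (h F) = F.
  apply/setP => e; apply/bigcupP/idP => [[r rR]|eF].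
    by rewrite ffunE rR !inE => /andP[].
  exists (rt (s e)); first exact: rt_roots.
  by rewrite ffunE rt_roots !inE eF eqxx.
apply: eq_big => [F|F _]; last first.
  rewrite (partition_big (fun e => rt (s e)) (fun r => r \in roots)) /=; last first.
    by move=> e _; exact: rt_roots.
  apply: eq_bigr => r rR; apply: eq_bigl => e.
  by rewrite ffunE rR !inE.
rewrite hK eqxx andbT; apply/andP/pfamilyP => [[/spanningP sF /forestP fF]|[_ hF]].
  split.
    apply/fintype.subsetP => r; rewrite unfold_in /= ffunE; case: ifPn => // _; by rewrite eqxx.
  move=> r rR; rewrite ffunE rR; have rr : rt r = r by move: rR; rewrite inE => /eqP.
  apply/and3P; split; first exact: finset.subsetIr.
    apply/forall_inP => v; rewrite inE => /eqP vr.
    by rewrite conn_cls //; apply: sF; rewrite vr.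
  apply/forestP => e; rewrite !inE => /andP[eF _]; apply: contra (fF e eF).
  by apply: connS; apply: finset.setSD; exact: finset.subsetIl.
have {}hF r : r \in roots -> tree_in r (part F r).
  by move=> rR; have := hF r rR; rewrite ffunE rR.
split.
  apply/forallP => v; have /and3P[_ /forall_inP pc _] := hF _ (rt_roots s t v).
  by rewrite -(@conn_cls F (rt v) v) //; apply: pc; rewrite inE.
apply/forestP => e eF; have /and3P[_ _ /forestP pf] := hF _ (rt_roots s t (s e)).
have /pf : e \in part F (rt (s e)) by rewrite !inE eF /=.
apply: contra; rewrite -(@conn_cls (F :\ e) (rt (s e)) (s e)) //.
apply: connS; apply/fintype.subsetP => e'; rewrite !inE.
by move=> /andP[/andP[-> ->] ->].
Qed.

Theorem tree_complexityE : tree_complexity H = `|forest_sum s t sgn|.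
Proof.
rewrite /tree_complexity (@fsbig_image _ _ _ _ _ cls_set (fun r => r \in roots) _ _ _ componentsE); last first.
  exact: cls_set_inj.
rewrite forest_sumE normr_prod; apply: eq_bigr => r rR.
exact: component_complexityE.
Qed.

End Presentation.

(** * Growth of the tree complexity of cyclic covers *)
(** When only [B.[0]] is known to be nonzero, the orders of vanishing are still
    comparable. *)
Lemma lowest_coef (F : idomainType) a b (A B : {poly F}) :
  'X^a * A = 'X^b * B -> B.[0] != 0 -> (a <= b)%N /\ (A.[0] != 0 \/ a = b -> A.[0] = B.[0]).
Proof.
move=> AB B0.
have ab : (a <= b)%N.
  rewrite leqNgt; apply/negP => ba; move: AB.
  rewrite -(subnK (ltnW ba)) addnC exprD -mulrA => /(mulfI (monic_neq0 (monicXn F _))) E.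
  by move: B0; rewrite -E hornerM hornerXn expr0n subn_eq0 leqNgt ba mul0r eqxx.
split=> // A0; move: AB; rewrite -(subnK ab) addnC exprD -mulrA.
move=> /(mulfI (monic_neq0 (monicXn F _))) E; move: A0; rewrite E hornerM hornerXn expr0n subn_eq0.
case: leqP => [ba _|ab']; first by rewrite mul1r.
by case=> [|aE]; [rewrite mul0r eqxx|rewrite aE ltnn in ab'].
Qed.

Section CoverGrowth.
Variable R : realType.
Variables (I J : finType) (es et : J -> I) (eb : J -> nat) (sg : J -> int) (D0 : {set I}).

(** The determinant of the weighted Laplacian of the periodic graph, as a
    polynomial in the marking variable over the integral polynomials. *)
Definition master : {poly {poly int}} := symbol_det es et eb sg D0 'X%:P 'X.

Definition eval_at (z : R[i]) : {rmorphism {poly int} -> R[i]} :=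
  [the {rmorphism {poly int} -> R[i]} of horner_eval z \o map_poly intr].

Lemma eval_atE z p : eval_at z p = (pint _ p).[z].
Proof. by []. Qed.

Lemma eval_master z : map_poly (eval_at z) master = symbol_det es et eb sg D0 z%:P 'X.
Proof.
rewrite /master (rmorph_symbol_det _ _ _ _ _ (map_poly (eval_at z))).
by rewrite /= map_polyC map_polyX /= map_polyX /horner_eval hornerX.
Qed.

Section Level.
Variable r' : nat.
Let r := r'.+1.
Notation N := #|{: I * 'I_r}|.
Notation cs := (cover_s es (r' := r')).
Notation ct := (cover_t et eb (r' := r')).

Definition cover_forest_sum : int := forest_sum cs ct (cover_sg sg (r' := r')).

Definition cover_weight : nat :=
  (\prod_(q in roots cs ct) #|[set v | (enum_val v).1 \in D0]%SET :&: cls cs ct q|)%N.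

(** The lowest coefficient of the left-hand side counts spanning forests; the
    factors on the right are specialisations of one polynomial. *)
Lemma cover_factorization : exists k Q : {poly R[i]},
  [/\ nc k.[0] = 1, nc Q.[0] = `|cover_weight%:Z * cover_forest_sum|%:~R &
    'X^#|roots cs ct| * (k * Q) = map_poly intr (map_poly (horner_eval 1) master) *
      \prod_(1 <= z < r) map_poly (eval_at (zeta R r z)) master].
Proof.
have [Q QE Q0] := det_laplacian cs ct (cover_sg sg (r' := r')) [set v | (enum_val v).1 \in D0]%SET.
have wp := zeta_prim R (ltn0Sn r').
have wp' : r.-primitive_root ((zeta R r 1)%:P : {poly R[i]}) by rewrite fmorph_primitive_root.
have r0 : r%:R != 0 :> {poly R[i]} by rewrite -polyC_natr polyC_eq0 pnatr_eq0.
have := cover_det es et eb sg D0 wp' r0 'X; set k := (X in X * _ = _).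
rewrite [X in _ * \det X](_ : _ = map_mx (map_poly intr) (\matrix_(i, j)
    ((laplacian cs ct (cover_sg sg (r' := r')) i j)%:P +
      ((i == j) && (i \in [set v | (enum_val v).1 \in D0]%SET))%:R *: 'X))); last first.
  apply/matrixP => u v; rewrite !mxE rmorphD /= map_polyC /= rmorph_int; congr (_ + _).
  by rewrite inE map_polyZ map_polyX /= rmorph_nat -mul_polyC polyC_natr.
rewrite det_map_mx QE rmorphM /= map_polyXn => E.
exists k, (map_poly intr Q); split.
- rewrite /k horner_exp horner_prod ncX nc_prod big1 ?expr1n // => z _.
  by rewrite !horner_exp hornerC !ncX nc_cis !expr1n.
- have := horner_map [the {rmorphism int -> R[i]} of intr] Q 0; rewrite rmorph0 => ->.
  by rewrite nc_int -intr_norm Q0.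
rewrite mulrCA E -(big_mkord xpredT (fun z => symbol_det es et eb sg D0 ((zeta R r 1)%:P ^+ z) 'X)).
rewrite big_ltn // expr0; congr (_ * _).
  rewrite -map_poly_comp -[1]/(1%:P) -eval_master; apply: eq_map_poly => p /=.
  rewrite /horner_eval.
  by have := horner_map [the {rmorphism int -> R[i]} of intr] p 1; rewrite rmorph1 => ->.
by apply: eq_big_nat => z _; rewrite -rmorphXn /= zetaX -eval_master.
Qed.

Lemma cover_forest_sum0 :
  map_poly (horner_eval 1) master = 0 -> cover_weight%:Z * cover_forest_sum = 0.
Proof.
have [k [Q [k1 Q0 E]]] := cover_factorization.
move=> P0; move: E; rewrite P0 rmorph0 mul0r => /eqP.
rewrite !mulf_eq0 (negPf (monic_neq0 (monicXn _ _))) /=.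
have -> : (k == 0) = false by apply: contra_eqF k1 => /eqP ->; rewrite horner0 nc0 eq_sym oner_eq0.
move=> /eqP Q00; move: Q0; rewrite Q00 horner0 nc0 => /esym/eqP.
by rewrite intr_eq0 normr_eq0 => /eqP.
Qed.

(** Only the trivial character contributes the factor [Q1.[0]]; the other
    characters contribute the values of the lowest coefficient [P1.[0]] of the
    master polynomial. The order of vanishing at [0] of the two sides agrees as
    soon as the forest sum is not zero, or the number of components is the
    expected one. *)
Lemma cover_forest_sumE c (P1 : {poly {poly int}}) b (Q1 : {poly int}) :
  master = 'X^c * P1 -> map_poly (horner_eval 1) master = 'X^b * Q1 -> Q1.[0] != 0 ->
  cyclic_product (pint R[i] P1.[0]) r != 0 ->
  (#|roots cs ct| <= b + c * r')%N /\
  (cover_weight%:Z * cover_forest_sum != 0 \/ #|roots cs ct| = (b + c * r')%N -> `|cover_weight%:Z * cover_forest_sum|%:~R =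
    `|Q1.[0]|%:~R * cyclic_product (pint R[i] P1.[0]) r).
Proof.
move=> PE P1E Q10 cp0.
have [k [Q [k1 Q0]]] := cover_factorization.
have -> : map_poly intr (map_poly (horner_eval 1) master) *
      \prod_(1 <= z < r) map_poly (eval_at (zeta R r z)) master =
    'X^(b + c * r') * (map_poly intr Q1 * \prod_(1 <= z < r) map_poly (eval_at (zeta R r z)) P1).
  rewrite exprD mulrACA P1E rmorphM /= map_polyXn; congr (_ * _).
  have -> : 'X^(c * r') = \prod_(1 <= z < r) 'X^c :> {poly R[i]}.
    by rewrite prodr_const_nat subn1 exprM.
  rewrite -big_split /=; apply: eq_big_nat => z _.
  by rewrite PE rmorphM /= map_polyXn.
have ncB0 : nc (map_poly intr Q1 * \prod_(1 <= z < r) map_poly (eval_at (zeta R r z)) P1).[0] =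
    `|Q1.[0]|%:~R * cyclic_product (pint R[i] P1.[0]) r.
  have intr0 : (map_poly intr Q1).[0] = Q1.[0]%:~R :> R[i].
    by have := horner_map [the {rmorphism int -> R[i]} of intr] Q1 0; rewrite rmorph0 => ->.
  rewrite hornerM ncM intr0 nc_int -intr_norm horner_prod nc_prod; congr (_ * _).
  apply: eq_bigr => z _; rewrite -eval_atE.
  by have := horner_map (eval_at (zeta R r z)) P1 0; rewrite rmorph0 => ->.
move=> /lowest_coef[|le_rb AB].
  by rewrite -nc_eq0 ncB0 mulf_neq0 // intr_eq0 normr_eq0.
split=> // W0; rewrite -ncB0 -AB; first by rewrite hornerM ncM k1 mul1r Q0.
case: W0 => W0; [left|by right].
by rewrite -nc_eq0 hornerM ncM k1 mul1r Q0 intr_eq0 normr_eq0.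
Qed.

End Level.

Lemma factor_lowest (F : idomainType) (p : {poly F}) :
  p != 0 -> exists c q, p = 'X^c * q /\ q.[0] != 0.
Proof.
move=> p0; have [c [q /implyP/(_ p0) q0 ->]] := multiplicity_XsubC p 0.
by exists c, q; rewrite subr0 mulrC.
Qed.
End CoverGrowth.

Section PrimeGrowth.
Variable R : realType.

(** For [r] prime, the nontrivial [r]-th roots of unity have order exactly [r],
    so that each root of [f] is excluded for at most one such [r]. *)
Lemma cyclic_product_prime (f : {poly int}) : f != 0 ->
  exists n0, forall r, (n0 <= r)%N -> prime r -> cyclic_product (pint R[i] f) r != 0.
Proof.
move=> f0; pose p := pint R[i] f.
have p0 : p != 0 by rewrite /p map_poly_eq0_id0 // intr_eq0 lead_coef_eq0.
have [s ps] := closed_field_poly_normal p.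
suff [n0 hn0] : exists n0, forall r, (n0 <= r)%N -> prime r ->
    all (fun a => ~~ r.-primitive_root a) s.
  exists n0 => r nr pr; rewrite prodf_seq_neq0; apply/allP => z.
  rewrite mem_index_iota implyTb nc_eq0 => /andP[z0 zr]; apply/negP => fz.
  have zs : zeta R r z \in s.
    move: fz; rewrite -rootE -/p ps rootZ ?lead_coef_eq0 //.
    by rewrite root_prod_XsubC.
  have := allP (hn0 r nr pr) _ zs; rewrite -zetaX; apply/negP/negPn.
  have := exp_prim_root (zeta_prim R (prime_gt0 pr)) z.
  have /eqP -> : coprime z r by rewrite coprime_sym prime_coprime // gtnNdvd.
  by rewrite divn1.
elim: s {ps} => [|a s [n1 hn1]]; first by exists 0%N.
have [[r0 ar0]|ar] := pselect (exists r0, r0.-primitive_root a).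
  exists (maxn n1 r0.+1) => r; rewrite geq_max => /andP[nr r0r] pr /=; rewrite hn1 // andbT.
  apply/negP => ar; have := prim_order_dvd ar r0; rewrite prim_expr_order // eqxx.
  move=> /(dvdn_leq (prim_order_gt0 ar0)); lia.
exists n1 => r nr pr /=; rewrite hn1 // andbT.
by apply/negP => ra; apply: ar; exists r.
Qed.

Variables (n : nat) (J : finType) (es et : J -> 'I_n) (eb : J -> nat) (sg : J -> int).

(** Marking one vertex in each component of the base graph keeps the number of
    choices of marks between [1] and [r ^ n] at prime levels, so that it does
    not affect the growth. *)
Lemma cover_growth : exists2 f : {poly int}, f != 0 &
  growth (fun r => prime r /\ cover_forest_sum es et eb sg r.-1 != 0)
    (fun r => `|cover_forest_sum es et eb sg r.-1|%:~R) (mahler_measure R f).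
Proof.
pose D0 := roots es et; pose M := master es et eb sg D0.
have wgt r : prime r -> (0 < cover_weight es et eb D0 r.-1 <= r ^ n)%N.
  by case: r => // r pr; exact: marks_weight.
(* signs may make the polynomial of the base graph vanish; then all forest sums do *)
have [M0|M0] := eqVneq (map_poly (horner_eval 1) M) 0.
  exists 1; first exact: oner_neq0.
  move=> e e0; exists 0%N => r _ [/wgt/andP[W0 _] /negP[]].
  have := cover_forest_sum0 R r.-1 M0 => /eqP.
  by rewrite mulf_eq0 => /orP[|//]; rewrite -[0]/(0%:Z) eqz_nat gtn_eqF.
have M0' : M != 0 by apply: contraNneq M0 => ->; rewrite rmorph0.
have [c [P1 [PE P10]]] := factor_lowest M0'.
have [b [Q1 [QE Q10]]] := factor_lowest M0.
have [n0 hn0] := cyclic_product_prime P10.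
exists P1.[0] => //.
have Q1n : 0 < `|Q1.[0]|%:~R :> R by rewrite ltr0z normr_gt0.
have g1 : growth (fun r => cyclic_product (pint R[i] P1.[0]) r != 0 /\ prime r) 
  (fun r => ((cover_weight es et eb D0 r.-1)%:R)^-1 * (`|Q1.[0]|%:~R * cyclic_product (pint R[i] P1.[0]) r)) (1^-1 * (1 * mahler_measure R P1.[0])).
  have mm0 : 0 <= mahler_measure R P1.[0] by exact: expR_ge0.
  apply: growthM; rewrite ?invr1 ?mul1r //.
    rewrite -[X in growth _ _ X]invr1; apply: growth_inv; first exact: ltr01.
    have gr : growth (fun=> True) (fun r => r%:R ^+ n : R) 1.
      elim: (n) => [|k IHk].
        by apply: (@eq_growth _ _ (fun=> 1)); [move=> *; rewrite expr0|exact: growth_cst].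
      rewrite -[X in growth _ _ X]mulr1; apply: (@eq_growth _ _ (fun r => r%:R * r%:R ^+ k)).
        by move=> *; rewrite exprS.
      by apply: growthM; rewrite ?ler01 //; exact: growth_id.
    move=> e e0; have [n1 h1] := gr e e0; exists n1 => r nr [_ pr].
    have /andP[W0 Wr] := wgt r pr; have /andP[_ h2] := h1 r nr I.
    rewrite expr1n mulr1 in h2; rewrite expr1n !mulr1; apply/andP; split.
      apply: (@le_trans _ _ 1); last by rewrite ler1n.
      by rewrite -[leRHS]expR0 ler_expR oppr_le0 mulr_ge0 // ltW.
    by apply: le_trans h2; rewrite -natrX ler_nat.
  rewrite -[X in growth _ _ X]mul1r; apply: growthM; rewrite ?ler01 //.
    exact: growth_cst.
  by apply: growthS (growth_cyclic_product P10) => r [].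
rewrite invr1 !mul1r in g1.
move=> e e0; have [n1 h1] := g1 e e0; exists (maxn n0 n1) => r.
rewrite geq_max => /andP[nr0 nr1] [pr F0].
have := h1 r nr1 (conj (hn0 r nr0 pr) pr).
have /andP[W0 _] := wgt r pr.
case: r {nr0 nr1} pr F0 W0 (hn0 r nr0 pr) => // r pr F0 W0 cp0 /=.
have [_] := cover_forest_sumE PE QE Q10 cp0.
have WR : (cover_weight es et eb D0 r)%:R != 0 :> R by rewrite pnatr_eq0 -lt0n.
move=> <-; last by left; rewrite mulf_neq0 // -[0]/(0%:Z) eqz_nat -lt0n.
by rewrite normrM intrM mulKf.
Qed.

End PrimeGrowth.

(** * Presentation of a 1-periodic graph *)
Section Orbits.
Variables (X : choiceType) (act : int -> X -> X).
Hypothesis act0 : forall x, act 0 x = x.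
Hypothesis actD : forall m n x, act (m + n) x = act m (act n x).
Hypothesis act_free : forall n x, act n x = x -> n = 0.

Definition orbit r x : set_type (range (zorbit act r)) :=
  exist _ (zorbit act r x) (mem_set (imageT _ x)).

Lemma orbit_surj r (o : set_type (range (zorbit act r))) : exists x, orbit r x = o.
Proof.
have [x _ xo] : range (zorbit act r) (sval o) by apply: set_mem; case: o.
by exists x; apply: val_inj.
Qed.

Lemma orbitE r x y : orbit r x = orbit r y <-> exists k : int, y = act (k * r%:Z) x.
Proof.
split=> [/(congr1 sval)/= xy|[k ->]].
  have : zorbit act r y y by exists 0 => //; rewrite mul0r act0.
  by rewrite -xy => -[k _ <-]; exists k.
apply: val_inj; apply/seteqP; split=> z [l _ <-].
  by exists (l - k) => //; rewrite -actD -mulrDl subrK.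
by exists (l + k) => //; rewrite mulrDl actD.
Qed.

Definition orbit_basis n (rep : 'I_n -> X) : Prop :=
  (forall x, exists i k, x = act k (rep i)) /\
  (forall i i' k k', act k (rep i) = act k' (rep i') -> i = i' /\ k = k').

Lemma exists_orbit_basis : finite_set [set: set_type (range (zorbit act 1))] ->
  exists n (rep : 'I_n -> X), orbit_basis rep.
Proof.
move=> /finite_seqP[s0 sE].
have [s us sP] : exists2 s, uniq s & forall o : set_type (range (zorbit act 1)), o \in s.
  exists (undup s0); first exact: undup_uniq.
  by move=> o; rewrite mem_undup; have : [set: set_type (range (zorbit act 1))] o by []; rewrite sE.
pose rep i := sval (cid (orbit_surj (tnth (in_tuple s) i))).
have repE i : orbit 1 (rep i) = tnth (in_tuple s) i by rewrite /rep; case: cid.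
exists (size s), rep; split.
  move=> x; have xs : (index (orbit 1 x) s < size s)%N by rewrite index_mem.
  have := repE (Ordinal xs); rewrite (tnth_nth (orbit 1 x)) /= nth_index // => /orbitE[k ->].
  by exists (Ordinal xs), (k * 1).
move=> i i' k k' E.
have ii : i = i'.
  apply/(tuple_uniqP (in_tuple s) us); rewrite -!repE; apply/orbitE; exists (- k' + k).
  by rewrite mulr1 actD E -actD addNr act0.
split=> //; subst i'; apply/eqP; rewrite -subr_eq0; apply/eqP/(@act_free _ (rep i)).
by rewrite addrC actD E -actD addNr act0.
Qed.

Lemma orbit_basis_act n (rep : 'I_n -> X) k : orbit_basis rep ->
  orbit_basis (fun i => act (k i) (rep i)).
Proof.
move=> [rep_surj rep_inj]; split.
  move=> x; have [i [l ->]] := rep_surj x.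
  by exists i, (l - k i); rewrite -actD subrK.
move=> i i' l l'; rewrite -!actD => /rep_inj[<- /addIr <-]; by [].
Qed.

(** The translation is divided by [r] with remainder. *)
Lemma orbit_bij n (rep : 'I_n -> X) r' : orbit_basis rep ->
  bijective (fun p : 'I_n * 'I_r'.+1 => orbit r'.+1 (act (p.2 : nat)%:Z (rep p.1))).
Proof.
move=> [rep_surj rep_inj].
set f := (X in bijective X).
have f_inj : injective f.
  move=> [i a] [i' a'] /orbitE[k]; rewrite -actD => /rep_inj[/= -> ka]; congr (_, _).
  apply: val_inj => /=; move: ka => /(congr1 (fun x => x %% r'.+1%:Z)%Z).
  by rewrite modzMDl !modz_nat !modn_small // => -[].
have f_surj y : exists p, f p = y.
  have [x <-] := orbit_surj y; have [i [k ->]] := rep_surj x.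
  have k_ge0 : 0 <= (k %% r'.+1%:Z)%Z by rewrite modz_ge0.
  have k_lt : (absz (k %% r'.+1%:Z)%Z < r'.+1)%N by rewrite -ltz_nat gez0_abs // ltz_pmod.
  exists (i, Ordinal k_lt); apply/orbitE; exists (k %/ r'.+1%:Z)%Z => /=.
  by rewrite gez0_abs // -actD -divz_eq.
have [g fg] := choice f_surj.
by exists g => // p; apply: f_inj; rewrite fg.
Qed.

End Orbits.

Section PeriodicGraph.
Variable G : zgraph.
Hypothesis periodic : one_periodic G.

Let freev := let: And3 h _ _ := periodic in h.
Let freee := let: And3 _ h _ := periodic in h.

(** A 1-periodic graph is given by its finite quotient, with an integer shift
    on each edge; translating an edge makes the shift nonnegative. *)
Lemma periodic_presentation : exists n m (vr : 'I_n -> vertex G) (er : 'I_m -> edge G)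
    (es et : 'I_m -> 'I_n) (eb : 'I_m -> nat),
  [/\ orbit_basis (@actv G) vr, orbit_basis (@acte G) er &
    forall j, ends (er j) = [set vr (es j); actv (eb j)%:Z (vr (et j))]].
Proof.
have [_ _ [finv fine]] := periodic.
have [n [vr vrP]] := exists_orbit_basis (@actv0 G) (@actvD G) freev finv.
have [m [er erP]] := exists_orbit_basis (@acte0 G) (@acteD G) freee fine.
have ex j : exists q : int * 'I_n * 'I_n * nat, ends (acte q.1.1.1 (er j)) =
    [set vr q.1.1.2; actv q.2%:Z (vr q.1.2)].
  have [u [v uv]] := endsP (er j).
  have [i [k uE]] := vrP.1 u; have [i' [k' vE]] := vrP.1 v.
  have [kk|kk] := lerP k k'.
    exists (- k, i, i', absz (k' - k)) => /=.
    rewrite act_ends uv image_setU !image_set1 uE vE -!actvD addNr actv0.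
    by rewrite gez0_abs ?subr_ge0 // addrC.
  exists (- k', i', i, absz (k - k')) => /=.
  rewrite act_ends uv image_setU !image_set1 uE vE -!actvD addNr actv0.
  by rewrite gez0_abs ?subr_ge0 ?(ltW kk) // setUC addrC.
have [q qP] := choice ex.
exists n, m, vr, (fun j => acte (q j).1.1.1 (er j)), (fun j => (q j).1.1.2),
  (fun j => (q j).1.2), (fun j => (q j).2); split=> //.
exact: (orbit_basis_act (@acteD G)).
Qed.

Section Presented.
Variables (n m : nat) (vr : 'I_n -> vertex G) (er : 'I_m -> edge G).
Variables (es et : 'I_m -> 'I_n) (eb : 'I_m -> nat).
Hypothesis vrP : orbit_basis (@actv G) vr.
Hypothesis erP : orbit_basis (@acte G) er.
Hypothesis ends_er : forall j, ends (er j) = [set vr (es j); actv (eb j)%:Z (vr (et j))].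

Definition rep_sign j : int := edge_sign (er j).

(** The vertices and edges of the level-[r] quotient are the translates of the
    representatives by [0, ..., r - 1]; this identifies it with the cyclic
    cover. *)
Lemma quotient_complexity r' : tree_complexity (quotient G r'.+1) =
  `|cover_forest_sum es et eb rep_sign r'|.
Proof.
pose phi (u : 'I_#|{: 'I_n * 'I_r'.+1}|) : vertex (quotient G r'.+1) :=
  qv r'.+1 (actv ((enum_val u).2 : nat)%:Z (vr (enum_val u).1)).
pose psi (x : 'I_m * 'I_r'.+1) : edge (quotient G r'.+1) :=
  qe r'.+1 (acte (x.2 : nat)%:Z (er x.1)).
have phi_bij : bijective phi :=
  bij_comp (orbit_bij (@actv0 G) (@actvD G) r' vrP) (@enum_val_bij _).
have psi_bij : bijective psi := orbit_bij (@acte0 G) (@acteD G) r' erP.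
have qvE a i : qv r'.+1 (actv a%:Z (vr i)) = qv r'.+1 (actv ((a %% r'.+1)%N%:Z) (vr i)).
  apply/(orbitE (@actv0 G) (@actvD G)); exists (- (a %/ r'.+1)%N%:Z).
  have aE : a%:Z = (a %/ r'.+1)%N%:Z * r'.+1%:Z + (a %% r'.+1)%N%:Z.
    by rewrite -PoszM -PoszD -divn_eq.
  by rewrite -actvD; congr actv; rewrite [in RHS]aE mulNr addKr.
have ends_psi x : ends (psi x) = [set phi (cover_s es x); phi (cover_t et eb x)].
  rewrite /psi /= qends_qe act_ends ends_er !image_setU !image_set1 /phi /cover_s /cover_t.
  rewrite !enum_rankK /= -actvD -PoszD (qvE (x.2 + eb x.1)%N); congr [set _; qv _ (actv _ _)].
  by rewrite modnDmr.
rewrite (tree_complexityE phi_bij psi_bij ends_psi); congr `|_|.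
apply: eq_bigr => F _; apply: eq_bigr => x _; rewrite /sgn /cover_sg /rep_sign /edge_sign.
congr (_ ^+ _); rewrite /psi /= /qnegative /=; congr nat_of_bool.
apply/asboolP/idP => [[e [k _ <-]]|nx]; first by rewrite !act_sign.
exists (acte (x.2 : nat)%:Z (er x.1)); last by rewrite act_sign.
by exists 0 => //; rewrite mul0r acte0.
Qed.

End Presented.
End PeriodicGraph.

Lemma periodic_growth (R : realType) (G : zgraph) : one_periodic G ->
  exists2 f : {poly int}, f != 0 &
    growth (fun r => prime r /\ tree_complexity (quotient G r) != 0)
      (fun r => (tree_complexity (quotient G r))%:~R) (mahler_measure R f).
Proof.
move=> perG; have [n [m [vr [er [es [et [eb [vrP erP ends_er]]]]]]]] := periodic_presentation perG.
have [f f0 gf] := cover_growth R es et eb (rep_sign er).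
exists f => // e /gf[n0 hn0]; exists n0 => -[_ []//|r' nr [pr]].
rewrite (quotient_complexity vrP erP ends_er) normr_eq0 => F0.
exact: (hn0 r'.+1 nr (conj pr F0)).
Qed.

(** The limit exceeds [1], so the tree complexity is not zero at large levels,
    and the growth along the primes determines the limit. *)
Lemma periodic_limit (R : realType) (G : zgraph) (L : R) : one_periodic G ->
  (fun r : nat => ((tree_complexity (quotient G r))%:~R : R) `^ r%:R^-1) @ \oo --> L ->
  1 < L -> exists2 f : {poly int}, f != 0 & mahler_measure R f = L.
Proof.
move=> perG cvL L1; have [f f0 gf] := periodic_growth R perG; exists f => //.
apply/eqP; rewrite -subr_eq0 -normr_le0; apply/ler_addgt0Pl => eta eta0; rewrite addr0.
have e2 : 0 < eta / 2 by rewrite divr_gt0.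
have [n1 h1] := growth_powR (expR_gt0 _) gf e2.
have /cvgrPdist_lt/(_ _ e2)[n2 _ h2] := cvL.
have /cvgr_gt/(_ _ (lt_trans ltr01 L1))[n3 _ h3] := cvL.
have [r rn pr] := prime_above (maxn n1 (maxn n2 n3)).
have [nr1 nr2 nr3] : [/\ (n1 <= r)%N, (n2 <= r)%N & (n3 <= r)%N].
  by move: rn; rewrite !gtn_max => /and3P[/ltnW ? /ltnW ? /ltnW ?].
have /= h2r := h2 r nr2; have /= h3r := h3 r nr3.
have F0 : tree_complexity (quotient G r) != 0.
  apply: contraTneq h3r => ->; rewrite powR0 ?ltxx // invr_eq0 pnatr_eq0 -lt0n.
  exact: prime_gt0.
have := h1 r nr1 (conj pr F0) => h1r.
set u := _ `^ _ in h1r h2r.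
have -> : mahler_measure R f - L = - (L - u) - (u - mahler_measure R f) by ring.
apply: (le_trans (ler_normB _ _)); rewrite normrN.
by rewrite [leRHS]splitr lerD // ltW.
Qed.

(** * Dividing out roots of unity *)
Section Kronecker.
Variable R : realType.
Implicit Types f g h : {poly int}.

Lemma pint_factor f : f != 0 -> exists s,
  pint R[i] f = (lead_coef f)%:~R *: \prod_(a <- s) ('X - a%:P) /\
  mahler_measure R f = `|lead_coef f|%:~R * \prod_(a <- s) Num.max 1 (nc a).
Proof.
move=> f0; have [s fs] := closed_field_poly_normal (pint R[i] f).
have lf : lead_coef (pint R[i] f) = (lead_coef f)%:~R.
  by apply: lead_coef_map_inj => //; exact: intr_inj.
rewrite lf in fs; exists s; split => //.
by rewrite (mahler_measureE _ fs) ?intr_eq0 ?lead_coef_eq0 // nc_int intr_norm.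
Qed.

Lemma mahler_measureM f g : f != 0 -> g != 0 ->
  mahler_measure R (f * g) = mahler_measure R f * mahler_measure R g.
Proof.
move=> f0 g0; have [s [fs ->]] := pint_factor f0; have [t [gt ->]] := pint_factor g0.
have fg : pint R[i] (f * g) = (lead_coef f * lead_coef g)%:~R *: \prod_(a <- s ++ t) ('X - a%:P).
  by rewrite /pint rmorphM /= -/(pint R[i] f) -/(pint R[i] g) fs gt big_cat -scalerAl -scalerAr scalerA -intrM.
rewrite (mahler_measureE _ fg) ?intr_eq0 ?mulf_neq0 ?lead_coef_eq0 //.
by rewrite nc_int -intr_norm normrM intrM big_cat mulrACA.
Qed.

(** The leading coefficient is a nonzero integer. *)
Lemma mahler_measure_ge1 f : f != 0 -> 1 <= mahler_measure R f.
Proof.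
move=> f0; have [s [_ ->]] := pint_factor f0.
apply: mulr_ege1; first by rewrite ler1z -gtz0_ge1 normr_gt0 lead_coef_eq0.
elim: s => [|a s IHs]; first by rewrite big_nil.
by rewrite big_cons mulr_ege1 // le_max lexx.
Qed.

Lemma mahler_measure_Xn_sub_1 k : (0 < k)%N -> mahler_measure R ('X^k - 1) = 1.
Proof.
move=> k0; have m1 : 'X^k - 1 \is @monic int by exact: monicXnsubC.
have [s [fs ->]] := pint_factor (monic_neq0 m1).
rewrite (monicP m1) normr1 mul1r big1_seq // => a /andP[_ sa].
have : root (pint R[i] ('X^k - 1)) a.
  by rewrite fs (monicP m1) scale1r root_prod_XsubC.
rewrite /pint rmorphB rmorph1 /= map_polyXn rootE !hornerE subr_eq0 => /eqP ak.
have /eqP : nc a ^+ k = 1 by rewrite -ncX ak nc1.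
by rewrite pexpr_eq1 ?nc_ge0 // => /eqP ->; rewrite maxxx.
Qed.

Lemma dvdp_minimal g h (a : R[i]) : g != 0 -> root (pint R[i] g) a ->
  (forall u : {poly int}, (size u < size g)%N -> root (pint R[i] u) a -> u = 0) ->
  root (pint R[i] h) a -> g %| h.
Proof.
move=> g0 ga gmin ha; apply/eqP/gmin; first by rewrite ltn_modp.
have /(congr1 (fun p => (pint R[i] p).[a])) := Pdiv.Idomain.divp_eq h g.
rewrite /pint map_polyZ rmorphD rmorphM /= hornerZ hornerD hornerM.
by rewrite (rootP ha) (rootP ga) !mulr0 add0r => /esym/rootP.
Qed.

(** The minimal polynomial of a root of unity divides some [X^k - 1], hence has
    Mahler measure 1 and can be divided out. *)
Lemma strip_roots_of_unity f : f != 0 -> exists g, [/\ g != 0,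
  mahler_measure R g = mahler_measure R f &
  forall a k, (0 < k)%N -> a ^+ k = 1 -> (pint R[i] g).[a] != 0].
Proof.
have [n] := ubnP (size f); elim: n f => // n IHn f fn f0.
have [[a [k [k0 ak fa]]]|noroot] := pselect (exists a k, [/\ (0 < k)%N, a ^+ k = 1 & root (pint R[i] f) a]);
  last first.
  exists f; split=> // a k k0 ak; apply: contra_not_neq noroot => fa.
  by exists a, k; split=> //; exact/rootP.
have [g [g0 ga] gmin] := minimal_annihilator f0 fa.
have /dvdpP_int[f1 fE] := dvdp_minimal g0 ga gmin fa.
have ka : root (pint R[i] ('X^k - 1)) a.
  by rewrite /pint rmorphB rmorph1 /= map_polyXn rootE !hornerE ak subrr.
have /dvdpP_int[h hE] := dvdp_minimal g0 ga gmin ka.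
set z := zprimitive g in fE hE.
have z0 : z != 0 by rewrite zprimitive_eq0.
have f10 : f1 != 0 by apply: contraNneq f0 => f1E; rewrite fE f1E mulr0.
have X0 : 'X^k - 1 != 0 :> {poly int} by apply: monic_neq0; exact: monicXnsubC.
have h0 : h != 0 by apply: contraNneq X0 => h0; rewrite hE h0 mulr0.
have z1 : mahler_measure R z = 1.
  apply/eqP; rewrite eq_le mahler_measure_ge1 // andbT.
  rewrite -(mahler_measure_Xn_sub_1 k0) hE mahler_measureM // ler_peMr ?mahler_measure_ge1 //.
  exact: expR_ge0.
have gs : (1 < size g)%N.
  rewrite ltnNge; apply/negP => /size1_polyC gE.
  move: ga g0; rewrite gE /pint map_polyC rootC /= intr_eq0 => /eqP ->.
  by rewrite eqxx.
have [|g1 [g10 g1M g1r]] := IHn f1 _ f10.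
  rewrite ltnS in fn; apply: leq_trans fn; rewrite fE size_mul // size_zprimitive.
  have f1s : (0 < size f1)%N by rewrite size_poly_gt0.
  by rewrite -ltnS prednK ?addn_gt0 ?f1s ?orbT // -[X in (X <= _)%N]add2n leq_add2r.
exists g1; split; [exact: g10| |exact: g1r].
rewrite g1M fE (mahler_measureM z0 f10) z1; exact/esym/mul1r.
Qed.

End Kronecker.

(** * Graphs realising squares of Mahler measures *)
Section Representation.
Variable F : numFieldType.

(** The contribution to the Laplacian of an edge of sign [(-1) ^+ p.1] joining
    every integer to its translate by [p.2]. *)
Definition second_difference (p : bool * nat) (x : F) : F :=
  (-1) ^+ p.1 * (2 - x ^+ p.2 - x ^- p.2).

(** [q] is the Laplacian of a signed graph on the integers, invariant by
    translation. *)
Definition representable (q : F -> F) : Prop :=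
  exists l : seq (bool * nat), forall x, x != 0 -> q x = \sum_(p <- l) second_difference p x.

Lemma eq_representable q q' : (forall x, x != 0 -> q x = q' x) ->
  representable q' -> representable q.
Proof. by move=> qq [l lE]; exists l => x x0; rewrite qq // lE. Qed.

Lemma representable0 : representable (fun=> 0).
Proof. by exists [::] => x _; rewrite big_nil. Qed.

Lemma representable1 b : representable (fun x => 2 - x ^+ b - x ^- b).
Proof. by exists [:: (false, b)] => x _; rewrite big_seq1 /second_difference mul1r. Qed.

Lemma representableD q q' : representable q -> representable q' ->
  representable (fun x => q x + q' x).
Proof. by move=> [l lE] [l' lE']; exists (l ++ l') => x x0; rewrite big_cat lE // lE'. Qed.

Lemma representableN q : representable q -> representable (fun x => - q x).
Proof.
move=> [l lE]; exists [seq (~~ p.1, p.2) | p <- l] => x x0; rewrite lE // big_map -sumrN.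
apply: eq_bigr => -[s b] _; rewrite /second_difference /= -mulNr.
by case: s; rewrite ?expr0 ?expr1 ?opprK.
Qed.

Lemma representableZ (c : int) q : representable q -> representable (fun x => c%:~R * q x).
Proof.
move=> rq; have rn (n : nat) : representable (fun x => n%:R * q x).
  elim: n => [|n IHn].
    by apply: eq_representable representable0 => x _; rewrite mul0r.
  apply: eq_representable (representableD rq IHn) => x _.
  by rewrite -[n.+1]add1n natrD mulrDl mul1r.
case: (intP c) => [|n|n].
- by apply: eq_representable representable0 => x _; rewrite mul0r.
- exact: rn.
- by apply: eq_representable (representableN (rn n.+1)) => x _; rewrite mulrNz mulNr.
Qed.

(** With [u b] for [2 - x ^ b - x ^ - b], the product for [b.+1] is
    [u b.+2 + u b - 2 * u b.+1]. *)
Lemma representable_pair b : representable (fun x => (x ^+ b + x ^- b) * (2 - x - x^-1)).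
Proof.
case: b => [|b].
  apply: eq_representable (representableZ 2 (representable1 1)) => x _.
  by rewrite !expr0 invr1 expr1.
apply: eq_representable (representableD (representableD (representable1 b.+2) (representable1 b))
  (representableZ (- 2) (representable1 b.+1))) => x x0.
rewrite ![x ^+ _.+1]exprS; set y := x ^+ b; have y0 : y != 0 by rewrite expf_neq0.
by field; rewrite y0 x0.
Qed.

Definition peval (f : {poly int}) (x : F) : F := (pint F f).[x].

Lemma pevalE f (c : int) x : peval (f * 'X + c%:P) x = peval f x * x + c%:~R.
Proof.
by rewrite /peval /pint rmorphD rmorphM /= map_polyX map_polyC hornerD hornerMX hornerC.
Qed.

Lemma peval0 x : peval 0 x = 0.
Proof. by rewrite /peval /pint rmorph0 horner0. Qed.

Lemma representable_linear f b :
  representable (fun x => (x ^+ b * peval f x + x ^- b * peval f x^-1) * (2 - x - x^-1)).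
Proof.
elim/poly_ind: f b => [|f c IHf] b.
  by apply: eq_representable representable0 => x _; rewrite !peval0 !mulr0 addr0 mul0r.
apply: eq_representable (representableD (IHf b.+1) (representableZ c (representable_pair b))) => x x0.
rewrite !pevalE !exprS invfM; ring.
Qed.

(** Symmetric Laurent polynomials are combinations of the [x ^ b + x ^ - b], to
    which the previous lemmas apply; the induction adds one coefficient of [f]
    at a time. *)
Lemma representable_square f :
  representable (fun x => peval f x * peval f x^-1 * (2 - x - x^-1)).
Proof.
elim/poly_ind: f => [|f c IHf].
  by apply: eq_representable representable0 => x _; rewrite !peval0 !mul0r.
apply: eq_representable (representableD (representableD IHf
  (representableZ c (representable_linear f 1))) (representableZ (c * c) (representable1 1))) => x x0.
by rewrite !pevalE !expr1 intrM; field.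
Qed.

End Representation.

Section Circulant.
Variables (m' : nat) (eb : 'I_m'.+1 -> nat) (ng : 'I_m'.+1 -> bool).

Definition circulant_ends (e : int * 'I_m'.+1) : set int := [set e.1; e.1 + (eb e.2)%:Z].

Lemma circulant_endsP e : exists u v, circulant_ends e = [set u; v].
Proof. by exists e.1, (e.1 + (eb e.2)%:Z). Qed.

Lemma circulant_no_isolated v : exists e, circulant_ends e v.
Proof. by exists (v, ord0); left. Qed.

Definition circulant_sgraph : sgraph :=
  @SGraph int (int * 'I_m'.+1)%type circulant_ends (fun e => ng e.2)
    circulant_endsP circulant_no_isolated.

Definition circulant_act (n : int) (e : int * 'I_m'.+1) := (n + e.1, e.2).

Lemma circulant_act0 e : circulant_act 0 e = e.
Proof. by case: e => k j; rewrite /circulant_act add0r. Qed.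

Lemma circulant_actD m n e :
  circulant_act (m + n) e = circulant_act m (circulant_act n e).
Proof. by rewrite /circulant_act addrA. Qed.

Lemma circulant_act_ends n e :
  circulant_ends (circulant_act n e) = [eta +%R n] @` circulant_ends e.
Proof. by rewrite /circulant_ends image_setU !image_set1 /= addrA. Qed.

Definition circulant : zgraph :=
  @ZGraph circulant_sgraph +%R circulant_act (@add0r int) (fun m n v => esym (addrA m n v))
    circulant_act0 circulant_actD circulant_act_ends (fun _ _ => erefl).

Lemma circulant_vertices : orbit_basis (@actv circulant) (fun _ : 'I_1 => 0 : vertex circulant).
Proof.
split=> [x|i i' k k']; first by exists (ord0 : 'I_1), x; rewrite /= addr0.
by rewrite /= !addr0 => ->; rewrite !ord1.
Qed.

Lemma circulant_edges :
  orbit_basis (@acte circulant) (fun j : 'I_m'.+1 => (0, j) : edge circulant).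
Proof.
split=> [[k j]|i i' k k']; first by exists j, k; rewrite /= /circulant_act addr0.
by rewrite /= /circulant_act !addr0 => -[-> ->].
Qed.

Lemma circulant_periodic : one_periodic circulant.
Proof.
split=> [n v|n [k j]|].
- by rewrite /= -[X in _ = X]add0r => /addIr.
- by rewrite /= /circulant_act => -[] /=; rewrite -[X in _ = X]add0r => /addIr.
have bij_finite (T : finType) (Y : Type) (h : T -> Y) : bijective h -> finite_set [set: Y].
  move=> [g _ gK]; have -> : [set: Y] = h @` setT by apply/seteqP; split=> // y _; exists (g y).
  by apply: finite_image; exact: finite_finset.
split; apply: bij_finite.
  exact: (orbit_bij (@actv0 circulant) (@actvD circulant) 0 circulant_vertices).
exact: (orbit_bij (@acte0 circulant) (@acteD circulant) 0 circulant_edges).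
Qed.

Lemma circulant_complexity r' : tree_complexity (quotient circulant r'.+1) =
  `|cover_forest_sum (fun=> ord0 : 'I_1) (fun=> ord0) eb (fun j => (-1) ^+ ng j) r'|.
Proof.
rewrite (quotient_complexity circulant_vertices circulant_edges (es := fun=> ord0)
  (et := fun=> ord0) (eb := eb)) //.
by move=> j; rewrite /= /circulant_ends /= addr0 add0r.
Qed.

End Circulant.

Section OneVertex.
Variables (J : finType) (eb : J -> nat) (sg : J -> int).
Let e0 := fun _ : J => ord0 : 'I_1.

Lemma symbol_det_one (S : comNzRingType) (x y : S) :
  symbol_det e0 e0 eb sg finset.setT x y =
  \sum_j (sg j)%:~R * (x ^+ max_shift eb - x ^+ (max_shift eb - eb j)) * (1 - x ^+ eb j)
  + x ^+ max_shift eb * y.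
Proof.
rewrite /symbol_det.
have det1x1 k (k1 : k = 1%N) (g : 'I_k -> 'I_1) (A : 'I_1 -> 'I_1 -> S) :
    \det (\matrix_(i < k, j < k) A (g i) (g j)) = A ord0 ord0.
  by subst k; rewrite det_mx11 mxE !ord1.
rewrite (det1x1 _ (card_ord 1) enum_val) /symbol finset.in_setT eqxx; congr (_ + _); last exact: mul1r.
by apply: eq_bigr => j _; rewrite !mul1r.
Qed.

Variable R : realType.
Let M := master e0 e0 eb sg finset.setT.

Lemma master_one_at1 : map_poly (horner_eval 1) M = 'X.
Proof.
rewrite /M /master (rmorph_symbol_det _ _ _ _ _ (map_poly (horner_eval 1))) symbol_det_one.
rewrite /= map_polyC map_polyX /= /horner_eval hornerX expr1n mul1r big1 ?add0r // => j _.
by rewrite !expr1n subrr mulr0.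
Qed.

Lemma pint_master_one z : z != 0 -> (pint R[i] M.[0]).[z] =
  z ^+ max_shift eb * \sum_j (sg j)%:~R * (2 - z ^+ eb j - z ^- eb j).
Proof.
move=> z0; rewrite -eval_atE.
have := horner_map (eval_at z) M 0; rewrite rmorph0 => <-.
rewrite eval_master -[X in X = _]/(horner_eval 0 _).
rewrite (rmorph_symbol_det _ _ _ _ _ (horner_eval 0)) symbol_det_one /= /horner_eval hornerC hornerX.
rewrite mulr0 addr0 mulr_sumr; apply: eq_bigr => j _.
have -> : z ^+ max_shift eb = z ^+ (max_shift eb - eb j) * z ^+ eb j.
  by rewrite -exprD subnK // eb_le.
set y := z ^+ eb j; have y0 : y != 0 by rewrite expf_neq0.
by field.
Qed.

(** At [x = 1] the determinant is the marking variable, so the cover has a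
    single component as soon as the other factors do not vanish; the factor on
    the left counts the choices of the marked vertex. *)
Lemma cover_forest_sum_one r' : cyclic_product (pint R[i] M.[0]) r'.+1 != 0 ->
  r'.+1%:R * `|cover_forest_sum e0 e0 eb sg r'|%:~R = cyclic_product (pint R[i] M.[0]) r'.+1.
Proof.
move=> cp0.
have ME : M = 'X^0 * M by rewrite mul1r.
have M1 : map_poly (horner_eval 1) M = 'X^1 * 1 by rewrite mulr1 master_one_at1.
have := cover_forest_sumE ME M1 _ cp0; rewrite hornerC oner_eq0 => /(_ isT)[le1 sumE].
pose N := #|{: 'I_1 * 'I_r'.+1}|.
have [q qP] : exists q, roots (cover_s e0 (r' := r')) (cover_t e0 eb (r' := r')) = [set q]%SET.
  apply/finset.cards1P; rewrite eqn_leq (leq_trans le1) // card_gt0; apply/set0Pn.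
  exists (rt (cover_s e0 (r' := r')) (cover_t e0 eb (r' := r')) (enum_rank (ord0, ord0))).
  exact: rt_roots.
have := sumE (or_intror _); rewrite qP cards1 normr1 mul1r => <- //.
rewrite normrM intrM; congr (_ * _); rewrite /cover_weight qP big_set1.
rewrite (_ : _ :&: _ = finset.setT) ?cardsT ?card_ord ?card_prod ?card_ord ?mul1n //.
apply/setP => v; rewrite !inE /=.
have : rt (cover_s e0 (r' := r')) (cover_t e0 eb (r' := r')) v \in [set q]%SET.
  by rewrite -qP rt_roots.
by rewrite inE.
Qed.

End OneVertex.

Section Realisation.
Variable R : realType.

Lemma cyclic_productM (p q : {poly R[i]}) r :
  cyclic_product (p * q) r = cyclic_product p r * cyclic_product q r.
Proof. by rewrite /cyclic_product -big_split; apply: eq_bigr => z _; rewrite hornerM ncM. Qed.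

(** Inversion permutes the nontrivial roots of unity. *)
Lemma cyclic_product_inv (p : {poly R[i]}) r :
  \prod_(1 <= z < r) nc p.[(zeta R r z)^-1] = cyclic_product p r.
Proof.
rewrite /cyclic_product big_nat_rev /=; apply: eq_big_nat => z /andP[z1 zr]; congr (nc _.[_]).
have r0 : (0 < r)%N by exact: leq_trans zr.
rewrite subSS -zetaX -[RHS]zetaX; apply: (@mulIf _ (zeta R r 1 ^+ (r - z))).
  by rewrite expf_neq0 ?cis_neq0.
rewrite mulVf ?expf_neq0 ?cis_neq0 //.
by rewrite -exprD addnC subnK ?(ltnW zr) // prim_expr_order // zeta_prim.
Qed.

(** The tree complexity of the graph attached to [F(x) F(1/x) (2 - x - 1/x)] is
    the product of its values at the nontrivial roots of unity, divided by [r].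
    Each of [F(x)] and [F(1/x)] contributes a growth of [mahler_measure R F], and
    the factors of [2 - x - 1/x = (1 - x) (1 - 1/x)] multiply to [r ^ 2]. *)
Lemma realisation (F : {poly int}) : F != 0 ->
  (forall a k, (0 < k)%N -> a ^+ k = 1 -> (pint R[i] F).[a] != 0) ->
  exists G : zgraph, one_periodic G /\
   (fun r : nat => ((tree_complexity (quotient G r))%:~R : R) `^ r%:R^-1) @ \oo -->
     mahler_measure R F ^+ 2.
Proof.
move=> F0 Froot.
have [l lE] := @representable_square R[i] F.
have zr r z : (0 < r)%N -> zeta R r z ^+ r = 1.
  by move=> r0; rewrite -zetaX exprAC (prim_expr_order (zeta_prim R r0)) expr1n.
have cpF r : (0 < r)%N -> cyclic_product (pint R[i] F) r != 0.
  move=> r0; rewrite prodf_seq_neq0; apply/allP => z _; rewrite implyTb nc_eq0.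
  exact: Froot (zr r z r0).
case: l lE => [lE|p0 l lE].
  have : peval F (-1 : R[i]) * peval F (-1)^-1 * (2 - -1 - (-1)^-1) = 0.
    by rewrite lE ?big_nil // oppr_eq0 oner_eq0.
  have m1 : (-1 : R[i])^-1 = -1 by rewrite invrN1.
  move/eqP; rewrite m1 !mulf_eq0 orbb /peval (negPf (Froot _ 2%N isT _)) ?sqrrN ?expr1n //=.
  have -> : 2 - -1 - -1 = 4%:R :> R[i] by ring.
  by rewrite pnatr_eq0.
pose t := in_tuple (p0 :: l).
pose eb j := (tnth t j).2; pose ng j := (tnth t j).1.
exists (circulant eb ng); split; first exact: circulant_periodic.
pose M := master (fun=> ord0 : 'I_1) (fun=> ord0) eb (fun j => (-1) ^+ ng j) finset.setT.
have cpM r : (0 < r)%N -> cyclic_product (pint R[i] M.[0]) r = (r%:R * cyclic_product (pint R[i] F) r) ^+ 2.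
  move=> r0; have hE : (r%:R * cyclic_product (pint R[i] F) r) = cyclic_product (('X - 1%:P) * pint R[i] F) r.
    rewrite cyclic_productM -(root_term1 R r0); congr (_ * _).
    by apply: eq_bigr => z _; rewrite hornerXsubC.
  rewrite hE expr2 -{2}(cyclic_product_inv (('X - 1%:P) * pint R[i] F)) -big_split /=; apply: eq_bigr => z _.
  have z0 : zeta R r z != 0 by exact: cis_neq0.
  rewrite pint_master_one // ncM ncX nc_cis expr1n mul1r -ncM; congr nc.
  rewrite (eq_bigr (fun j => second_difference (tnth t j) (zeta R r z))); last first.
    by move=> j _; rewrite rmorphXn rmorphN rmorph1.
  rewrite -(big_tuple _ _ t xpredT (fun p => second_difference p (zeta R r z))) /= -lE //.
  rewrite !hornerM !hornerXsubC /peval; move: z0; set x := zeta R r z; set u := _.[x]; set v := _.[x^-1].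
  by move=> x0; field.
have tau r : (0 < r)%N -> (tree_complexity (quotient (circulant eb ng) r))%:~R =
    r%:R * (cyclic_product (pint R[i] F) r * cyclic_product (pint R[i] F) r) :> R.
  case: r => // r r0; rewrite circulant_complexity.
  have rR : r.+1%:R != 0 :> R by rewrite pnatr_eq0.
  apply: (mulfI rR); rewrite cover_forest_sum_one -/M cpM //; first by rewrite expr2; ring.
  by rewrite expf_neq0 // mulf_neq0 // cpF.
have mm0 : 0 < mahler_measure R F by exact: expR_gt0.
have gF : growth (fun=> True) (cyclic_product (pint R[i] F)) (mahler_measure R F).
  move=> e e0; have [n0 hn0] := growth_cyclic_product F0 e0; exists n0.+1 => r nr _.
  by apply: hn0; [exact: ltnW|apply: cpF; exact: leq_trans nr].
have g : growth (fun=> True) (fun r => (tree_complexity (quotient (circulant eb ng) r))%:~R)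
    (mahler_measure R F ^+ 2).
  apply: (eq_growth (u := fun r => r%:R * (cyclic_product (pint R[i] F) r * cyclic_product (pint R[i] F) r))).
    by move=> r r0 _; rewrite tau.
  rewrite -[X in growth _ _ X]mul1r expr2.
  apply: growthM; rewrite ?ler01 ?mulr_ge0 ?(ltW mm0) //; first exact: growth_id.
  by apply: growthM; rewrite ?(ltW mm0).
apply/cvgrPdist_le => eta eta0.
have [n0 hn0] := growth_powR (exprn_gt0 2 mm0) g eta0.
by exists n0 => // r nr; rewrite /= distrC; exact: hn0.
Qed.

End Realisation.

(** * Equivalence with Lehmer's question *)
Theorem theorem10p4 (R : realType) :
  (forall eps : R, 0 < eps ->
     exists f : {poly int}, f != 0 /\ 1 < mahler_measure R f < 1 + eps)
  <->
  (forall eps : R, 0 < eps ->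
     exists G : zgraph, one_periodic G /\
       exists L : R,
         (fun r : nat =>
            ((tree_complexity (quotient G r))%:~R : R) `^ r%:R^-1) @ \oo --> L
         /\ 1 < L < 1 + eps).
Proof.
split=> [lehmer|periodic] eps eps0.
  (* [(1 + d) ^ 2 <= 1 + 3 * d] *)
  pose d := Num.min 1 (eps / 3).
  have d0 : 0 < d by rewrite lt_min ltr01 divr_gt0.
  have [f [f0 /andP[f1 fd]]] := lehmer d d0.
  have [g [g0 gf groot]] := strip_roots_of_unity R f0.
  have [G [perG cvG]] := realisation g0 groot.
  rewrite gf in cvG; exists G; split; first exact: perG.
  exists (mahler_measure R f ^+ 2); split; first exact: cvG.
  have d1 : d <= 1 by rewrite ge_min lexx.
  have d3 : d <= eps / 3 by rewrite ge_min lexx orbT.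
  move: (mahler_measure R f) f1 fd d1 d3; clear -eps0 d0 => m m1 md d1 d3.
  by apply/andP; split; nra.
have [G [perG [L [cvL /andP[L1 Le]]]]] := periodic eps eps0.
have [f f0 fL] := periodic_limit perG cvL L1.
by exists f; split; [exact: f0|rewrite fL L1 Le].
Qed.
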